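(* (a) We have that $$\int_{\theta}^{\tau}\sigma(s)^2\,ds = 2\log|Y_{\gamma}(\tau)|\quad\text{almost surely}.$$ (b) If $\sigma(t)=\sigma$ is constant, then, for any $h\in[0,1]$, $$\sigma^2=2\left(\int_{\theta}^{\tau}y(s)^{2(\gamma-h)}\,ds\right)^{-1}\log|Y_h(\tau)|\quad\text{almost surely}.$$
   Context: Let $\theta\in\mathbb{R}$ and $T\in(\theta,+\infty)$ be given, together with a complete probability space $(\Omega,\mathcal{F},\mathbf{P})$ and a right-continuous filtration $\{\mathcal{F}_t\}_{t\in[\theta,T]}$ of complete $\sigma$-algebras of events. Let $w(t)$, $t\in[\theta,T]$, be a one-dimensional Wiener process with $w(\theta)=0$, adapted to $\{\mathcal{F}_t\}$, such that $\mathcal{F}_t$ is independent of $w(s)-w(q)$ whenever $s>q\ge t$. Let $\gamma\in[0,1]$, and let $\sigma(t)$ be a bounded real-valued $\mathcal{F}_t$-adapted process. Let $f(s,t):C([\theta,T])\times[\theta,T]\to\mathbb{R}$ be a measurable (possibly random) function such that $f(s,t)$ is $\mathcal{F}_t$-adapted for any $s\in C([\theta,T])$, and $f(s_1,t)=f(s_2,t)$ if $(s_1-s_2)|_{[\theta,t]}\equiv 0$. For any $\delta>0$ there are constants $c_k=c_k(\delta)>0$, $k=1,2$, such that, almost surely, $|f(s_1,t)-f(s_2,t)|\le c_1\|s_1-s_2\|_{C([\theta,T])}$ and $|f(s,t)|\le c_2(\|s\|_{C([\theta,T])}+1)$ for all $t\in[\theta,T]$ and all $s,s_1,s_2\in C([\theta,T])$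 whose infimum over $[\theta,T]$ is larger than $\delta$. The process $y$ is the real-valued almost surely continuous $\mathcal{F}_t$-adapted solution, with $y(\theta)>0$, of the Itô equation $$dy(t)=f(y(\cdot),t)\,dt+\sigma(t)\,y(t)^{\gamma}\,dw(t)$$ on $[\theta,\tau]$, where $\tau$ is a Markov time (stopping time) with respect to $\{\mathcal{F}_t\}$ such that $\tau\in(\theta,T]$ a.s. and $\inf_{s\in[\theta,\tau]}y(s)>0$ a.s. For $h\in[0,1]$, $Y_h(s)$, $s\in[\theta,\tau]$, is the complex-valued process satisfying the Itô equation (driven by the continuous semimartingale $y$, with $i=\sqrt{-1}$) $$dY_h(s)=i\,Y_h(s)\,\frac{dy(s)}{y(s)^h},\quad s\in(\theta,\tau),\qquad Y_h(\theta)=1.$$ $Y_\gamma$ denotes $Y_h$ with $h=\gamma$. *)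

(* Defs.v *)
From HB Require Import structures.
From mathcomp Require Import all_boot all_order all_algebra.
From mathcomp Require Import all_classical all_reals all_analysis.
From mathcomp.real_closed Require Export complex.

Set Implicit Arguments.
Unset Strict Implicit.
Unset Printing Implicit Defensive.

Import Order.TTheory GRing.Theory Num.Theory.
Import numFieldNormedType.Exports.

Local Open Scope classical_set_scope.
Local Open Scope ring_scope.

(* Conventions: a process is a function [X : R -> Omega -> _], time first; only
   its values at times in [theta, T] (or in [theta, tau omega]) are ever used.
   A filtration is a family [F : R -> set (set Omega)] of sets of events. *)

Section Stochastic.
Context d (Omega : measurableType d) (R : realType) (P : probability Omega R).
Variables (theta T : R) (F : R -> set (set Omega)).

Local Notation mu := (@lebesgue_measure R).

(* The F_t are complete in the sense of the usual conditions: each contains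
   every P-null set of the (complete) probability space. *)
Definition complete_rc_filtration : Prop :=
  [/\ (forall t, t \in `[theta, T] ->
         sigma_algebra setT (F t) /\ F t `<=` measurable),
      (forall s t, theta <= s -> s <= t -> t <= T -> F s `<=` F t),
      (forall t, theta <= t -> t < T ->
         \bigcap_(s in [set` `]t, T]]) F s `<=` F t) &
      (forall t, t \in `[theta, T] -> P.-negligible `<=` F t)].

Definition measurable_wrt (G : set (set Omega)) (X : Omega -> R) : Prop :=
  forall B : set R, measurable B -> G (X @^-1` B).

Definition adapted (X : R -> Omega -> R) : Prop :=
  forall t, t \in `[theta, T] -> measurable_wrt (F t) (X t).

Definition jointly_measurable (X : R -> Omega -> R) : Prop :=
  measurable_fun ([set` `[theta, T]] `*` [set: Omega])
    (fun p : R * Omega => X p.1 p.2).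

Definition stopping_time (tau : Omega -> R) : Prop :=
  forall t, t \in `[theta, T] -> F t [set omega | tau omega <= t].

Definition independent_of (G : set (set Omega)) (X : Omega -> R) : Prop :=
  forall (A : set Omega) (B : set R), G A -> measurable B ->
    P (A `&` X @^-1` B) = (P A * P (X @^-1` B))%E.

(* The second argument of [normal_prob] is the standard deviation.  The last
   clause, together with adaptedness, contains the mutual independence of the
   increments. *)
Definition wiener_process (w : R -> Omega -> R) : Prop :=
  [/\ {ae P, forall omega, w theta omega = 0},
      adapted w,
      {ae P, forall omega, {within `[theta, T], continuous (w ^~ omega)}},
      (forall q s, theta <= q -> q < s -> s <= T -> forall B : set R, measurable B ->
         P ((fun omega => w s omega - w q omega) @^-1` B)
         = normal_prob 0 (Num.sqrt (s - q)) B) &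
      (forall t q s, theta <= t -> t <= q -> q < s -> s <= T ->
         independent_of (F t) (fun omega => w s omega - w q omega))].

(* The process  sum_(k < sp_size) sp_coef k * 1_(]sp_node k, sp_node k.+1])  *)
Record simple_process := SimpleProcess {
  sp_size : nat;
  sp_node : nat -> R;
  sp_coef : nat -> Omega -> R;
  sp_node_in : forall k, (k <= sp_size)%N -> sp_node k \in `[theta, T];
  sp_node_le : forall k, (k < sp_size)%N -> sp_node k <= sp_node k.+1;
  sp_coef_meas : forall k, (k < sp_size)%N ->
    measurable_wrt (F (sp_node k)) (sp_coef k);
  sp_coef_bnd : forall k, (k < sp_size)%N ->
    exists M : R, forall omega, `|sp_coef k omega| <= M
}.

Definition sp_val (H : simple_process) (t : R) (omega : Omega) : R :=
  \sum_(k < sp_size H)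
    sp_coef H k omega * \1_[set` `]sp_node H k, sp_node H k.+1]] t.

Definition sp_integral (H : simple_process) (X : R -> Omega -> R)
    (t : R) (omega : Omega) : R :=
  \sum_(k < sp_size H)
    sp_coef H k omega *
      (X (Num.min (sp_node H k.+1) t) omega - X (Num.min (sp_node H k) t) omega).

(* Convergence to 0 in probability; the outer measure [P^*] coincides with P on
   events and avoids a separate measurability proof for suprema over time. *)
Definition cvg0_in_prob (D : nat -> Omega -> \bar R) : Prop :=
  forall e : R, 0 < e ->
    (P^*)%mu [set omega | (e%:E < D n omega)%E] @[n --> \oo] --> 0%E.

Definition sup_dist (J : interval R) (A B : R -> Omega -> R) (omega : Omega)
    : \bar R :=
  ereal_sup [set (`|A t omega - B t omega|)%:E | t in [set` J]].

Definition L2_dist2 (J : interval R) (A B : R -> Omega -> R) (omega : Omega)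
    : \bar R :=
  (\int[mu]_(s in [set` J]) ((A s omega - B s omega) ^+ 2)%:E)%E.

Variable tau : Omega -> R.

(* I(t) = int_theta^t H dw for t in [theta, tau]: extension of the integral from
   simple processes, with respect to the convergence in probability of
   int_theta^tau (H_n - H)^2 ds to 0. *)
Definition ito_integral (w H I : R -> Omega -> R) : Prop :=
  exists Hn : nat -> simple_process,
    cvg0_in_prob (fun n omega =>
      L2_dist2 `[theta, tau omega] (sp_val (Hn n)) H omega) /\
    cvg0_in_prob (fun n omega =>
      sup_dist `[theta, tau omega] (sp_integral (Hn n) w) I omega).

(* J(t) = int_theta^t H dX for t in [theta, tau], for a continuous
   semimartingale X and a continuous adapted integrand H: extension of the
   integral from simple processes by continuity for uniform convergence in
   probability.  A simple process vanishes at theta, whence ]theta, tau] for the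
   integrands. *)
Definition semimartingale_integral (X H J : R -> Omega -> R) : Prop :=
  exists Hn : nat -> simple_process,
    cvg0_in_prob (fun n omega =>
      sup_dist `]theta, tau omega] (sp_val (Hn n)) H omega) /\
    cvg0_in_prob (fun n omega =>
      sup_dist `[theta, tau omega] (sp_integral (Hn n) X) J omega).

Definition semimartingale_integralC (X : R -> Omega -> R)
    (H J : R -> Omega -> R[i]) : Prop :=
  semimartingale_integral X (fun t omega => complex.Re (H t omega))
    (fun t omega => complex.Re (J t omega)) /\
  semimartingale_integral X (fun t omega => complex.Im (H t omega))
    (fun t omega => complex.Im (J t omega)).

Definition continuous_adapted_upto (X : R -> Omega -> R) : Prop :=
  {ae P, forall omega, {within `[theta, tau omega], continuous (X ^~ omega)}} /\
  adapted (fun t omega => X (Num.min t (tau omega)) omega).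

(* dX = a dt + b dw on [theta, tau].  That int_theta^tau |a| dt < oo is part of
   the meaning of the equation; the square integrability of b is part of
   [ito_integral]. *)
Definition ito_process (w X a b : R -> Omega -> R) : Prop :=
  [/\ continuous_adapted_upto X,
      {ae P, forall omega,
        mu.-integrable `[theta, tau omega] (EFin \o a ^~ omega)} &
      exists2 I : R -> Omega -> R, ito_integral w b I &
        {ae P, forall omega, forall t, t \in `[theta, tau omega] ->
          X t omega = X theta omega
                      + \int[mu]_(s in `[theta, t]) a s omega + I t omega}].

(* The drift f(s, t) is defined for s in C([theta, T]); the path of y, known on
   [theta, tau] only, is continued after tau by its value at tau.  Since f is
   nonanticipating, f(y, t) for t <= tau does not depend on this choice. *)
Definition y_solution (f : (R -> R) -> R -> Omega -> R) (sigma w : R -> Omega -> R)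
    (gamma : R) (y : R -> Omega -> R) : Prop :=
  ito_process w y
    (fun t omega => f (fun s => y (Num.min s (tau omega)) omega) t omega)
    (fun t omega => sigma t omega * (y t omega) `^ gamma).

(* dY = i Y y^(-h) dy on [theta, tau], Y(theta) = 1 *)
Definition Y_solution (y : R -> Omega -> R) (h : R) (Y : R -> Omega -> R[i])
    : Prop :=
  [/\ continuous_adapted_upto (fun t omega => complex.Re (Y t omega)),
      continuous_adapted_upto (fun t omega => complex.Im (Y t omega)),
      {ae P, forall omega, Y theta omega = 1} &
      exists2 J : R -> Omega -> R[i],
        semimartingale_integralC y
          (fun t omega => 'i%C * Y t omega / (real_complex R ((y t omega) `^ h))) J &
        {ae P, forall omega, forall t, t \in `[theta, tau omega] ->
          Y t omega = Y theta omega + J t omega}].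

End Stochastic.

Section Drift.
Context d (Omega : measurableType d) (R : realType) (P : probability Omega R).
Variables (theta T : R) (F : R -> set (set Omega)).
Variable f : (R -> R) -> R -> Omega -> R.

(* A path in C([theta, T]) is represented by any function R -> R that is
   continuous on [theta, T]; by [nonanticipating], f only sees its restriction. *)
Definition Cpath (s : R -> R) : Prop := {within `[theta, T], continuous s}.

Definition Cnorm (s : R -> R) : R := sup [set `|s t| | t in `[theta, T]].

Definition Cinf (s : R -> R) : R := inf [set s t | t in `[theta, T]].

(* Measurability on C([theta, T]) x [theta, T] x Omega for the product of the
   Borel sigma-algebras (the one of the uniform norm on C([theta, T])) and of the
   sigma-algebra of events. *)
Definition drift_measurable : Prop :=
  let D := [set p : (R -> R) * R * Omega | Cpath p.1.1 /\ p.1.2 \in `[theta, T]] in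
  forall V : set R, measurable V ->
    <<s D, [set A | exists (U : set {uniform` [set` `[theta, T]] -> R})
                           (B : set R) (E : set Omega),
              [/\ open U, measurable B, measurable E &
                  A = D `&` ((U : set (R -> R)) `*` B `*` E)]] >>
      (D `&` (fun p => f p.1.1 p.1.2 p.2) @^-1` V).

Definition drift_adapted : Prop :=
  forall s, Cpath s -> adapted theta T F (f s).

Definition nonanticipating : Prop :=
  forall s1 s2 t omega, Cpath s1 -> Cpath s2 -> t \in `[theta, T] ->
    (forall r, r \in `[theta, t] -> s1 r = s2 r) ->
    f s1 t omega = f s2 t omega.

Definition drift_lipschitz_growth : Prop :=
  forall delta : R, 0 < delta ->
    exists c1 c2 : R, [/\ 0 < c1, 0 < c2 &
      {ae P, forall omega, forall t, t \in `[theta, T] ->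
        (forall s1 s2, Cpath s1 -> Cpath s2 ->
           delta < Cinf s1 -> delta < Cinf s2 ->
           `|f s1 t omega - f s2 t omega| <= c1 * Cnorm (s1 \- s2)) /\
        (forall s, Cpath s -> delta < Cinf s ->
           `|f s t omega| <= c2 * (Cnorm s + 1))}].

End Drift.

(* Main.v *)
(* The increment of Z = |Y|^2 over a short time interval is
   2 Re(conj(Y) dY) + |dY|^2, and conj(Y) dY = i |Y|^2 y^(-h) dy is purely
   imaginary, so that only the quadratic variation |Y|^2 y^(-2h) d[y] remains:
   almost surely Z(t) = 1 + int_theta^t Z g ds with
   g = sigma^2 y^(2 (gamma - h)), whence log Z(tau) = int_theta^tau g ds.

   The identity for Z is proved without Ito's formula.  Outside an event of small
   probability, y and Y are replaced by integrals of simple processes and Z is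
   telescoped along a fine deterministic grid containing their nodes.  The first
   order terms have small coefficients by the cancellation above, and Lenglart's
   inequality makes their martingale part small; the second order terms are
   compared with their conditional means through the fourth moment of the Wiener
   increments. *)
Require Import Defs.
From mathcomp Require Import all_boot all_order all_algebra.
From mathcomp Require Import all_classical all_reals all_analysis.
From mathcomp Require Import measurable_realfun ring lra.
Import Order.TTheory GRing.Theory Num.Theory.
Import numFieldNormedType.Exports.
Local Open Scope classical_set_scope.
Local Open Scope ring_scope.

Set Implicit Arguments.
Unset Strict Implicit.
Unset Printing Implicit Defensive.

(** * Statements holding off small events *)

Section OffSmallEvents.
Context d (Omega : measurableType d) (R : realType) (P : probability Omega R).
Implicit Types (Q : Omega -> Prop) (e p : R).

(** Stochastic integrals are available only as limits in probability, so estimates hold off events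
    of small probability, and these probabilities add up. The property [Q] may fail to be
    measurable, whence an exceptional event that contains its failures. Three obstacles shape the
    argument. The sup bound of the approximating simple processes depends on the tolerance [eps], so
    it must not enter the final constant: the Wiener oscillation and the mesh, chosen afterwards,
    absorb it. The grid is deterministic but the stopping time is random: martingale sums run over
    complete grid steps, and the single step that straddles the stopping time costs one oscillation.
    Bounds valid off an event do not make coefficients square integrable: these are switched off by
    indicators known at the left end of the step, and clamped. The identity for [Z] then holds
    almost surely at each fixed stopped time, hence at countably many together, and the passage to
    the logarithm uses only such times. *)

Definition off_event e Q := exists B : set Omega,
  [/\ measurable B, (P B <= e%:E)%E & forall omega, ~ B omega -> Q omega].

Lemma off_eventW e e' Q Q' : e <= e' -> (forall omega, Q omega -> Q' omega) ->
  off_event e Q -> off_event e' Q'.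
Proof.
move=> ee' QQ' [B [mB PB BQ]]; exists B; split=> //.
  by apply: (le_trans PB); rewrite lee_fin.
by move=> omega nB; exact/QQ'/BQ.
Qed.

Lemma off_eventI e1 e2 Q1 Q2 : off_event e1 Q1 -> off_event e2 Q2 ->
  off_event (e1 + e2) (fun omega => Q1 omega /\ Q2 omega).
Proof.
move=> [B1 [mB1 PB1 BQ1]] [B2 [mB2 PB2 BQ2]]; exists (B1 `|` B2); split.
- exact: measurableU.
- apply: (le_trans (measureU2 _ _ _)) => //.
  by rewrite EFinD; exact: leeD.
- by move=> omega /not_orP[n1 n2]; split; [exact: BQ1|exact: BQ2].
Qed.

Lemma ae_off_event Q : {ae P, forall omega, Q omega} -> off_event 0 Q.
Proof.
move=> [B [mB PB QB]]; exists B; split=> //; first by rewrite PB.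
by move=> omega nB; apply: contrapT => nQ; exact/nB/QB.
Qed.

Lemma off_event_ae Q : (forall e, 0 < e -> off_event e Q) ->
  {ae P, forall omega, Q omega}.
Proof.
move=> H.
have /choice[B HB] : forall n : nat, exists B : set Omega,
    [/\ measurable B, (P B <= (n.+1%:R^-1)%:E)%E &
        forall omega, ~ B omega -> Q omega].
  by move=> n; apply: H; rewrite invr_gt0.
exists (\bigcap_n B n); split.
- by apply: bigcapT_measurable => n; have [] := HB n.
- apply/eqP; rewrite eq_le measure_ge0 andbT.
  apply/lee_addgt0Pr => e e0; rewrite add0e.
  have [n ne] : exists n : nat, n.+1%:R^-1 < e.
    exists (Num.truncn e^-1); rewrite invf_plt ?posrE//.
    by rewrite truncnS_gt.
  have [mB PB _] := HB n.
  apply: (@le_trans _ _ (P (B n))).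
    apply: le_measure; rewrite ?inE//; last exact: bigcap_inf.
    by apply: bigcapT_measurable => k; have [] := HB k.
  by apply: (le_trans PB); rewrite lee_fin ltW.
- move=> omega nQ n _; apply: contrapT => nB; apply: nQ.
  by have [_ _] := HB n; apply.
Qed.

(** The outer measure is an infimum over countable measurable covers; the union of a cover of total
    measure below [p] is the exceptional event. *)
Lemma off_event_cvg0 (D : nat -> Omega -> \bar R) : cvg0_in_prob P D ->
  forall e p, 0 < e -> 0 < p ->
  exists n0, forall n, (n0 <= n)%N -> off_event p (fun omega => (D n omega <= e%:E)%E).
Proof.
move=> HD e p e0 p0.
have /fine_cvgP[fH /cvgrPdist_lt] := HD e e0.
move=> /(_ p p0)[n1 _ H1].
have [n2 _ H2] := fH.
exists (maxn n1 n2) => n; rewrite geq_max => /andP[n1n n2n].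
have lt_p : ((P^*)%mu [set omega | (e%:E < D n omega)%E] < p%:E)%E.
  have /fineK <- := H2 _ n2n; rewrite lte_fin; have := H1 _ n1n.
  rewrite /= sub0r normrN; apply: le_lt_trans; exact: ler_norm.
have [_ [A [cA sA] <-] Ap] := ereal_inf_lt lt_p.
exists (\bigcup_k A k); split.
- by apply: bigcupT_measurable => k; exact: cA.
- apply: le_trans (ltW Ap); apply: measure_sigma_subadditive => //.
  by apply: bigcupT_measurable => k; exact: cA.
- move=> omega nA; rewrite leNgt; apply/negP => lt; apply: nA; exact: sA.
Qed.

(** Continuity of [P] from above along the failures of [Q n]. This turns a random bound, finite
    almost surely, into a deterministic one off a small event. *)
Lemma off_event_monotone (Q : nat -> Omega -> Prop) :
  (forall n, measurable [set omega | Q n omega]) ->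
  (forall n omega, Q n omega -> Q n.+1 omega) ->
  {ae P, forall omega, exists n, Q n omega} ->
  forall p, 0 < p -> exists n, off_event p (Q n).
Proof.
move=> mQ Qn [N [mN PN QN]] p p0.
pose A n := ~` [set omega | Q n omega].
have mA n : measurable (A n) by apply: measurableC; exact: mQ.
have cA : P \o A @ \oo --> P (\bigcap_n A n).
  apply: nonincreasing_cvg_mu => //.
  - by rewrite -ge0_fin_numE ?fin_num_measure.
  - exact: bigcapT_measurable.
  - move=> m n mn; apply/subsetPset => omega; rewrite /A /=; apply: contra_not.
    move: mn; elim: n => [|n IH]; first by rewrite leqn0 => /eqP ->.
    rewrite leq_eqVlt => /orP[/eqP ->//|]; rewrite ltnS => mn Qm.
    exact/Qn/IH.
have P0 : P (\bigcap_n A n) = 0%E.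
  apply/eqP; rewrite eq_le measure_ge0 andbT -PN.
  apply: le_measure; rewrite ?inE//; first exact: bigcapT_measurable.
  by move=> omega H; apply: QN => /= -[n Qo]; exact: (H n).
rewrite P0 in cA; have /fine_cvgP[fH /cvgrPdist_lt] := cA.
move=> /(_ p p0)[n1 _ H1]; exists n1, (A n1); split => //.
- rewrite -[P _]fineK ?fin_num_measure// lee_fin.
  have := H1 _ (leqnn n1); rewrite /= sub0r normrN => /ltW.
  by apply: le_trans; exact: ler_norm.
- by move=> omega; rewrite /A /= => /contrapT.
Qed.

End OffSmallEvents.

(** * Measurability with respect to a sub-sigma-algebra *)

Section MeasurableWrt.
Context d (Omega : measurableType d) (R : realType).
Variable G : set (set Omega).
Hypothesis sG : sigma_algebra setT G.
Implicit Types X Y : Omega -> R.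

(** The sigma-algebra generated by [G] is [G] itself, so closure under arithmetic and composition is
    inherited from [measurable_fun]. *)
Lemma measurable_wrtP X :
  measurable_wrt G X <-> measurable_fun setT (X : g_sigma_algebraType G -> R).
Proof.
split=> [H _ B mB|H B mB].
  by rewrite setTI; apply: sub_sigma_algebra; exact: H.
have := H measurableT B mB; rewrite setTI /measurable/=.
by rewrite sigma_algebra_id.
Qed.

Lemma measurable_wrt_cst (c : R) : measurable_wrt G (fun=> c).
Proof. exact/measurable_wrtP/measurable_cst. Qed.

Lemma measurable_wrtD X Y : measurable_wrt G X -> measurable_wrt G Y ->
  measurable_wrt G (fun omega => X omega + Y omega).
Proof.
move=> /measurable_wrtP mX /measurable_wrtP mY; apply/measurable_wrtP.
exact: measurable_funD.
Qed.

Lemma measurable_wrtB X Y : measurable_wrt G X -> measurable_wrt G Y ->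
  measurable_wrt G (fun omega => X omega - Y omega).
Proof.
move=> /measurable_wrtP mX /measurable_wrtP mY; apply/measurable_wrtP.
exact: measurable_funB.
Qed.

Lemma measurable_wrtM X Y : measurable_wrt G X -> measurable_wrt G Y ->
  measurable_wrt G (fun omega => X omega * Y omega).
Proof.
move=> /measurable_wrtP mX /measurable_wrtP mY; apply/measurable_wrtP.
exact: measurable_funM.
Qed.

Lemma measurable_wrt_sum (I : Type) (r : seq I) (Pr : pred I) (X : I -> Omega -> R) :
  (forall i, Pr i -> measurable_wrt G (X i)) ->
  measurable_wrt G (fun omega => \sum_(i <- r | Pr i) X i omega).
Proof.
move=> mX; elim: r => [|i r IH].
  under eq_fun do rewrite big_nil; exact: measurable_wrt_cst.
have [Pi|nPi] := boolP (Pr i); last first.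
  by rewrite (_ : (fun _ => _) = fun omega => \sum_(i <- r | Pr i) X i omega)//;
    apply/funext => omega; rewrite big_cons (negbTE nPi).
rewrite (_ : (fun _ => _) = fun omega => X i omega + \sum_(i <- r | Pr i) X i omega);
  last by apply/funext => omega; rewrite big_cons Pi.
by apply: measurable_wrtD => //; exact: mX.
Qed.

Lemma measurable_wrt_comp (phi : R -> R) X : measurable_fun setT phi ->
  measurable_wrt G X -> measurable_wrt G (fun omega => phi (X omega)).
Proof.
move=> mphi /measurable_wrtP mX; apply/measurable_wrtP.
exact: (measurableT_comp mphi mX).
Qed.

Lemma measurable_wrt_indic (A : set Omega) : G A -> measurable_wrt G (\1_A : Omega -> R).
Proof.
move=> GA; apply/measurable_wrtP; apply: measurable_indic.
exact: sub_sigma_algebra.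
Qed.

Lemma wrt_setC (A : set Omega) : G A -> G (~` A).
Proof.
move=> GA; case: sG => _ GC _; rewrite -[~` A]setTD; exact: GC.
Qed.

Lemma wrt_bigcup (A : nat -> set Omega) : (forall n, G (A n)) -> G (\bigcup_n A n).
Proof. by case: sG => _ _; apply. Qed.

Lemma wrt_setU (A B : set Omega) : G A -> G B -> G (A `|` B).
Proof.
move=> GA GB; rewrite -bigcup2E; apply: wrt_bigcup => -[|[|n]] //=.
by case: sG.
Qed.

Lemma wrt_setI (A B : set Omega) : G A -> G B -> G (A `&` B).
Proof.
move=> GA GB; rewrite -[A `&` B]setCK setCI; apply/wrt_setC/wrt_setU; exact: wrt_setC.
Qed.

Lemma wrt_bigcap (A : nat -> set Omega) : (forall n, G (A n)) -> G (\bigcap_n A n).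
Proof.
move=> GA; rewrite -[X in G X]setCK setC_bigcap.
by apply/wrt_setC/wrt_bigcup => n; exact/wrt_setC/GA.
Qed.

Lemma measurable_wrt_gt X (c : R) : measurable_wrt G X -> G [set omega | c < X omega].
Proof.
move=> /(_ `]c, +oo[%classic (measurable_itv _)); congr G.
by apply/seteqP; split=> omega /=; rewrite in_itv/= andbT.
Qed.

Lemma measurable_wrt_le X (c : R) : measurable_wrt G X -> G [set omega | X omega <= c].
Proof.
move=> /(_ `]-oo, c]%classic (measurable_itv _)); congr G.
Qed.

Lemma measurable_wrt_of_gt X : (forall c, G [set omega | c < X omega]) ->
  measurable_wrt G X.
Proof.
move=> H; apply/measurable_wrtP.
apply: (@measurability _ _ (g_sigma_algebraType G) _ _ _ (@RGenOInfty.G R)).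
  exact: RGenOInfty.measurableE.
move=> _ [_ [c ->] <-]; rewrite setTI; apply: sub_sigma_algebra.
move: (H c); congr G; apply/seteqP; split=> omega /=; by rewrite in_itv/= andbT.
Qed.

End MeasurableWrt.

Lemma measurable_wrtS d (Omega : measurableType d) (R : realType)
    (G G' : set (set Omega)) (X : Omega -> R) :
  G `<=` G' -> measurable_wrt G X -> measurable_wrt G' X.
Proof. by move=> GG' mX B mB; exact/GG'/mX. Qed.

Lemma measurable_wrt_measurable d (Omega : measurableType d) (R : realType)
    (G : set (set Omega)) (X : Omega -> R) :
  G `<=` measurable -> measurable_wrt G X -> measurable_fun setT X.
Proof. by move=> GG' mX _ B mB; rewrite setTI; exact/GG'/mX. Qed.

(** * Limits in probability under completeness *)

Section MeasurableLimit.
Context d (Omega : measurableType d) (R : realType) (P : probability Omega R).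
Variable G : set (set Omega).
Hypothesis sG : sigma_algebra setT G.
Hypothesis nG : P.-negligible `<=` G.

Lemma measurable_wrt_ae (A B : set Omega) : G A ->
  {ae P, forall omega, A omega <-> B omega} -> G B.
Proof.
move=> GA AB.
have GN : G [set omega | ~ (A omega <-> B omega)] by apply: nG.
have GBA : G (B `\` A).
  apply: nG; apply: negligibleS AB => omega [Bo nAo]; by move=> -[/= _ /(_ Bo)].
have GAB : G (A `\` B).
  apply: nG; apply: negligibleS AB => omega [Ao nBo]; by move=> -[/= /(_ Ao)].
have -> : B = (A `&` ~` (A `\` B)) `|` (B `\` A).
  apply/seteqP; split=> omega.
    move=> Bo; have [Ao|nAo] := pselect (A omega); [left|right] => //.
    by split=> // -[].
  by move=> [[Ao nAB]|[]//]; apply: contrapT => nB; exact: nAB.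
by apply: (wrt_setU sG) => //; apply: (wrt_setI sG) => //; exact: (wrt_setC sG).
Qed.

(* The summable exceptional probabilities give, by Borel-Cantelli, almost sure
   convergence, and completeness carries measurability to the limit. *)
Lemma measurable_wrt_limit (X : Omega -> R) :
  (forall e, 0 < e -> exists2 X', measurable_wrt G X' &
     off_event P e (fun omega => `|X' omega - X omega| <= e)) ->
  measurable_wrt G X.
Proof.
move=> H.
(* Errors and exceptional probabilities are both [2^-(n+1)], of sum 1. *)
have /choice[Xn HX] : forall n : nat, exists X', measurable_wrt G X' /\
    off_event P (2^-1 ^+ n.+1) (fun omega => `|X' omega - X omega| <= 2^-1 ^+ n.+1).
  move=> n; have [|X' ? ?] := H (2^-1 ^+ n.+1); last by exists X'.
  by rewrite exprn_gt0 // invr_gt0.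
have /choice[B HB] : forall n, exists B : set Omega, [/\ measurable B,
   (P B <= (2^-1 ^+ n.+1)%:E)%E &
   forall omega, ~ B omega -> `|Xn n omega - X omega| <= 2^-1 ^+ n.+1].
  by move=> n; have [_ [B ?]] := HX n; exists B.
have lim0 : P (lim_sup_set B) = 0%E.
  apply: lim_sup_set_cvg0; first by move=> n; have [] := HB n.
    apply: (@le_lt_trans _ _ (\sum_(0 <= n <oo) (2^-1 ^+ n.+1 : R)%:E)%E).
      by apply: lee_nneseries => [n _ _|n _] //; have [] := HB n.
    have -> : (\sum_(0 <= n <oo) (2^-1 ^+ n.+1 : R)%:E)%E = 1%:E :> \bar R.
      apply/cvg_lim => //; apply: cvg_EFin; first by near=> n; rewrite sumEFin.
      rewrite [X in X @ _](_ : _ = (fun n => 1 - (2^-1 : R) ^+ n)).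
        rewrite -[X in _ --> X]subr0; apply: cvgB; first exact: cvg_cst.
        by apply: cvg_expr; rewrite ger0_norm ?invr_ge0// invf_lt1 ?ltr1n.
      apply/funext => n /=; rewrite sumEFin /=.
      elim: n => [|n IH]; first by rewrite big_geq// expr0 subrr.
      rewrite big_nat_recr//= IH exprS; lra.
    by rewrite ltry.
apply: (measurable_wrt_of_gt sG) => c.
(* Off the limsup of the exceptional events, [c < X] holds exactly when some gap [1/(i+1)] separates
   [c] from all late [Xn]: a countable combination of events of [G]. *)
apply: (@measurable_wrt_ae (\bigcup_i \bigcup_j \bigcap_n
  [set omega | c + i.+1%:R^-1 < Xn (j + n)%N omega])).
  apply: (wrt_bigcup sG) => i; apply: (wrt_bigcup sG) => j.
  apply: (wrt_bigcap sG) => n.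
  by apply: measurable_wrt_gt; have [] := HX (j + n)%N.
exists (lim_sup_set B); split=> //.
  apply: bigcapT_measurable => n; apply: bigcup_measurable => k _.
  by have [] := HB k.
move=> omega /= nAB; apply: contrapT => nL; apply: nAB.
have {nL}[n0 n0B] : exists n0, forall k, (n0 <= k)%N ->
    `|Xn k omega - X omega| <= 2^-1 ^+ k.+1.
  move/existsNP: nL => [n0 /not_implyP[_ nB]]; exists n0 => k n0k.
  have [_ _] := HB k; apply => Bk; apply: nB; by exists k.
have small (e : R) : 0 < e -> exists n1, forall k, (n1 <= k)%N ->
    `|Xn k omega - X omega| < e.
  move=> e0.
  have /cvgrPdist_lt : (2^-1 : R) ^+ n @[n --> \oo] --> 0.
    by apply: cvg_expr; rewrite ger0_norm ?invr_ge0// invf_lt1 ?ltr1n.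
  move=> /(_ e e0)[n1 _ H1]; exists (maxn n0 n1) => k; rewrite geq_max => /andP[k0 k1].
  apply: (le_lt_trans (n0B k k0)).
  have := H1 k.+1 (leq_trans k1 (leqnSn _)); rewrite /= sub0r normrN.
  by apply: le_lt_trans; exact: ler_norm.
split.
  move=> [i _ [j _ ij]].
  have [n1 Hn1] := small (i.+1%:R^-1) ltac:(by rewrite invr_gt0).
  have := Hn1 _ (leq_addl j n1); have /= := ij n1 I.
  by move: (i.+1%:R^-1) => a h1 /ltr_normlP[h2 h3]; lra.
move=> cX.
have [i Hi] : exists i : nat, i.+1%:R^-1 < (X omega - c) / 2.
  exists (Num.truncn ((X omega - c) / 2)^-1); rewrite invf_plt ?posrE ?truncnS_gt//.
  by rewrite divr_gt0 ?subr_gt0.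
have [j Hj] := small ((X omega - c) / 2) ltac:(by rewrite divr_gt0 ?subr_gt0).
exists i => //; exists j => // n _ /=.
have := Hj (j + n)%N (leq_addr _ _); move: Hi; move: (i.+1%:R^-1) => a Hi.
by move=> /ltr_normlP[h1 h2]; lra.
Unshelve. all: by end_near. Qed.

End MeasurableLimit.

(** * Moments of the centered normal law *)

Section NormalMoments.
Context (R : realType).
Local Notation mu := (@lebesgue_measure R).
Import HBNNSimple.

(** Passage from the law to its density: indicators, then nonnegative simple functions, then
    monotone convergence on both sides along the same sequence [f_]. *)
Lemma ge0_integral_normal_prob (m s : R) (f : measurableTypeR R -> \bar R) :
  measurable_fun setT f -> (forall x, (0 <= f x)%E) ->
  (\int[normal_prob m s]_x f x = \int[mu]_x (f x * (normal_pdf m s x)%:E))%E.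
Proof.
move=> mf f0.
pose f_ := nnsfun_approx measurableT mf.
have mpdf : measurable_fun setT (EFin \o normal_pdf m s).
  by apply/measurable_EFinP; exact: measurable_normal_pdf.
have indic A : measurable A -> (\int[normal_prob m s]_x (\1_A x)%:E =
    \int[mu]_x ((\1_A x)%:E * (normal_pdf m s x)%:E))%E.
  move=> mA; rewrite integral_indic// setIT /= /normal_prob integral_mkcond.
  apply: eq_integral => x _; rewrite patchE indicE.
  by case: (x \in A); rewrite ?mul1e ?mul0e.
have simple (g : {nnsfun measurableTypeR R >-> R}) : (\int[normal_prob m s]_x (g x)%:E =
    \int[mu]_x ((g x)%:E * (normal_pdf m s x)%:E))%E.
  under eq_integral do rewrite fimfunE -fsumEFin//.
  rewrite ge0_integral_fsum//; last 2 first.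
  - by move=> r; exact/measurable_EFinP/measurableT_comp.
  - by move=> n x _; rewrite EFinM nnfun_muleindic_ge0.
  under [RHS]eq_integral.
    move=> x _; rewrite fimfunE -fsumEFin// ge0_mule_fsuml; last first.
      by move=> y; rewrite EFinM nnfun_muleindic_ge0.
    over.
  rewrite [RHS]ge0_integral_fsum//; last 2 first.
  - move=> r; apply: emeasurable_funM => //.
    exact/measurable_EFinP/measurableT_comp.
  - move=> n x _; apply: mule_ge0; last by rewrite lee_fin normal_pdf_ge0.
    by rewrite EFinM nnfun_muleindic_ge0.
  apply: eq_fsbigr => r _.
  (* A nonnegative simple function takes no negative value, so both terms vanish for [r < 0]. *)
  have [r0|r0] := leP 0 r; last first.
    under eq_integral do rewrite EFinM preimage_nnfun0//= indicE in_set0 mule0.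
    under [RHS]eq_integral do rewrite EFinM preimage_nnfun0//= indicE in_set0 mule0 mul0e.
    by rewrite !integral0.
  under eq_integral do rewrite EFinM.
  rewrite ge0_integralZl//; last exact/measurable_EFinP/measurable_indic.
  rewrite indic//.
  under [RHS]eq_integral do rewrite EFinM -muleA.
  rewrite ge0_integralZl//.
  - apply: emeasurable_funM => //; exact/measurable_EFinP/measurable_indic.
  - by move=> x _; rewrite mule_ge0 ?lee_fin ?normal_pdf_ge0.
transitivity (lim (\int[normal_prob m s]_x (f_ n x)%:E @[n --> \oo])%E).
  rewrite -monotone_convergence//=.
  - by apply: eq_integral => ? /[!inE] xD; apply/esym/cvg_lim => //=; exact: cvg_nnsfun_approx.
  - by move=> n; apply/measurable_EFinP; exact: measurable_funPT.
  - by move=> n ? _; rewrite lee_fin.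
  - by move=> ? _ ? ? mn; rewrite lee_fin; exact/lefP/nd_nnsfun_approx.
rewrite [RHS](_ : _ = lim
    (\int[mu]_x ((f_ n x)%:E * (normal_pdf m s x)%:E)%E @[n --> \oo])%E).
  by apply: congr_lim; apply/funext => n /=; exact: simple.
rewrite -monotone_convergence//=.
- apply: eq_integral => x _; apply/esym/cvg_lim => //.
  apply: cvgeZr => //; exact: cvg_nnsfun_approx.
- by move=> n; apply: emeasurable_funM => //; apply/measurable_EFinP; exact: measurable_funPT.
- by move=> n x _; rewrite mule_ge0 ?lee_fin ?normal_pdf_ge0.
- move=> x _ a b ab; rewrite lee_wpmul2r ?lee_fin ?normal_pdf_ge0//.
  exact/lefP/nd_nnsfun_approx.
Qed.

(** Dominated convergence with bound [|g|]. It reduces integrals over the line to segments, where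
    antiderivatives apply. *)
Lemma cvg_integral_symmetric (g : R -> R) : mu.-integrable setT (EFin \o g) ->
  (\int[mu]_(x in `[(- n%:R)%R, (n%:R)%R]) (g x)%:E @[n --> \oo] --> \int[mu]_x (g x)%:E)%E.
Proof.
move=> ig.
have mg : measurable_fun setT (EFin \o g) by exact: measurable_int ig.
rewrite [X in X @ _ --> _](_ : _ = fun n : nat =>
    (\int[mu]_x (((EFin \o g) \_ `[(- n%:R)%R, (n%:R)%R]) x))%E); last first.
  by apply/funext => n; rewrite integral_mkcond.
apply: (@dominated_cvg _ _ _ mu setT measurableT _ _ (abse \o (EFin \o g))) => //.
- move=> n; apply/(measurable_restrictT _ _).1 => //; exact: measurable_funTS.
- move=> x _; apply: cvg_near_cst; near=> n.
  rewrite patchE mem_set//= in_itv/= -ler_norml.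
  near: n; exact: nbhs_infty_ger.
- exact: integrable_norm.
- move=> n x _; rewrite patchE; case: ifPn => //= _.
  by rewrite normr0 lee_fin.
Unshelve. all: by end_near. Qed.

Variable s : R.
Hypothesis s0 : 0 < s.

Let sN0 : s != 0. Proof. by rewrite gt_eqF. Qed.

Lemma normal_pdf_even x : normal_pdf 0 s (- x) = normal_pdf 0 s x.
Proof. by rewrite normal_pdfE// /normal_fun !subr0 sqrrN. Qed.

Lemma is_derive_normal_pdf (x : R) :
  is_derive x 1 (normal_pdf 0 s) (- (x / s ^+ 2) * normal_pdf 0 s x).
Proof.
rewrite normal_pdfE//.
have -> : normal_fun (0:R) s = expR \o (fun x => - (s ^+ 2 *+ 2)^-1 * x ^+ 2).
  by apply/funext => z; rewrite /normal_fun subr0 /= mulNr [in RHS]mulNr mulrC.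
have D1 : is_derive x 1 (fun x => - (s ^+ 2 *+ 2)^-1 * x ^+ 2) (- (x / s ^+ 2)).
  apply: is_derive_eq; rewrite /GRing.scale/=.
  by field.
apply: is_derive_eq.
rewrite /GRing.scale /=; ring.
Qed.

(* [x^4 exp (- x^2 / (2 s^2))] is at most a multiple of [exp (- x^2 / (8 s^2))],
   the density of standard deviation [2 s]. *)
Lemma normal_pdf_pow4_le x :
  x ^+ 4 * normal_pdf 0 s x <= 30 * s ^+ 4 * normal_pdf 0 (2 * s) x.
Proof.
have s2 : 2 * s != 0 by rewrite mulf_neq0.
rewrite !normal_pdfE// /normal_fun !subr0.
have -> : normal_peak (2 * s) = 2^-1 * normal_peak s.
  rewrite /normal_peak (_ : (2 * s) ^+ 2 * pi *+ 2 = 2 ^+ 2 * (s ^+ 2 * pi *+ 2)); last ring.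
  by rewrite sqrtrM ?exprn_ge0// sqrtr_sqr ger0_norm// invfM.
(* The part of the exponent given up to absorb the power: [x^2/(2 s^2) = u + x^2/(8 s^2)]. *)
pose u : R := 3 * x ^+ 2 / (8 * s ^+ 2).
have -> : - x ^+ 2 / (s ^+ 2 *+ 2) = - u + (- x ^+ 2 / ((2 * s) ^+ 2 *+ 2)).
  by rewrite /u; field.
rewrite expRD.
have u0 : 0 <= u by rewrite /u divr_ge0// mulr_ge0// sqr_ge0.
have key : x ^+ 4 * expR (- u) <= 15 * s ^+ 4.
  rewrite expRN ler_pdivrMr ?expR_gt0//.
  have -> : x ^+ 4 = (64 / 9) * s ^+ 4 * u ^+ 2.
    by rewrite /u; field.
  (* From [exp u >= 1 + u^2/2]; the factor 15 works because [64/9 <= 15/2]. It becomes 30 since the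
     peak of the wider density is half as high. *)
  have := @expR_ge1Dxn R u 1 u0; rewrite (_ : 2`!%:R = 2 :> R)// => hu.
  have s4 : 0 <= s ^+ 4 by rewrite exprn_ge0// ltW.
  have : (64 / 9) * s ^+ 4 * u ^+ 2 <= 15 * s ^+ 4 * (1 + u ^+ 2 / 2).
    have := mulr_ge0 s4 (exprn_ge0 2 u0); nra.
  move/le_trans; apply; rewrite ler_wpM2l// mulr_ge0//.
have p0 := normal_peak_ge0 s.
have e0 := expR_ge0 (- x ^+ 2 / ((2 * s) ^+ 2 *+ 2)).
have := ler_wpM2r (mulr_ge0 p0 e0) key.
set E := expR (- x ^+ 2 / _); set pk := normal_peak s.
have -> : x ^+ 4 * (pk * (expR (- u) * E)) = x ^+ 4 * expR (- u) * (pk * E) by ring.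
move=> h; apply: (le_trans h); rewrite le_eqVlt; apply/orP; left; apply/eqP; field.
by [].
Qed.

(** The exact fourth moment is [3 s^4]; only the order [s^4] matters later, so the crude constant of
    the domination is kept. *)
Lemma integrable_normal_pow4 :
  mu.-integrable setT (EFin \o (fun x => x ^+ 4 * normal_pdf 0 s x)) /\
  (\int[mu]_x (x ^+ 4 * normal_pdf 0 s x)%:E <= (30 * s ^+ 4)%:E)%E.
Proof.
have m4 : measurable_fun setT (fun x : R => x ^+ 4 * normal_pdf 0 s x).
  by apply: measurable_funM => //; exact: measurable_normal_pdf.
have ge0 x : 0 <= x ^+ 4 * normal_pdf 0 s x.
  by rewrite mulr_ge0 ?normal_pdf_ge0// exprn_even_ge0.
have H : (\int[mu]_x (x ^+ 4 * normal_pdf 0 s x)%:E <= (30 * s ^+ 4)%:E)%E.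
  apply: (@le_trans _ _ (\int[mu]_x ((30 * s ^+ 4)%:E * (normal_pdf 0 (2 * s) x)%:E))%E).
    apply: ge0_le_integral => //.
    - by move=> x _; rewrite lee_fin.
    - exact/measurable_EFinP.
    - apply: measurable_funeM; apply/measurable_EFinP; exact: measurable_normal_pdf.
    - by move=> x _; rewrite -EFinM lee_fin normal_pdf_pow4_le.
  rewrite ge0_integralZl//.
  - by rewrite integral_normal_pdf mule1.
  - by apply/measurable_EFinP; exact: measurable_normal_pdf.
  - by move=> x _; rewrite lee_fin normal_pdf_ge0.
  - by rewrite lee_fin mulr_ge0// exprn_ge0// ltW.
split => //; apply/integrableP; split; first exact/measurable_EFinP.
under eq_integral do rewrite /= ger0_norm//.
by apply: (le_lt_trans H); rewrite ltry.
Qed.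

Lemma integrable_normal_pow (n : nat) : (n <= 4)%N ->
  mu.-integrable setT (EFin \o (fun x => x ^+ n * normal_pdf 0 s x)).
Proof.
move=> n4; have [i4 _] := integrable_normal_pow4.
have i0 := integrable_normal_pdf 0 s.
apply: (le_integrable _ _ _ (integrableD _ i0 i4)) => //.
  by apply/measurable_EFinP; apply: measurable_funM => //; exact: measurable_normal_pdf.
move=> x _ /=; rewrite lee_fin normrM (ger0_norm (normal_pdf_ge0 _ _ _)) normrX.
have p0 := normal_pdf_ge0 0 s x.
have x4 : 0 <= (x : R) ^+ 4 by rewrite exprn_even_ge0.
rewrite [leRHS]ger0_norm; last by rewrite addr_ge0// mulr_ge0.
rewrite -[X in X + _]mul1r -mulrDl ler_wpM2r//.
have [x1|x1] := leP `|x| 1.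
  by apply: (@le_trans _ _ 1); [rewrite exprn_ile1|rewrite lerDl].
have -> : (x : R) ^+ 4 = `|x| ^+ 4 by rewrite -normrX ger0_norm.
apply: (@le_trans _ _ (`|x| ^+ 4)); last by rewrite lerDr.
by rewrite ler_eXn2l.
Qed.

(* Integration over [[-n, n]] by the fundamental theorem of calculus. *)
Lemma integral_normal_antiderivative (F f : R -> R) :
  (forall x : R, is_derive x 1 F (f x)) -> continuous f ->
  mu.-integrable setT (EFin \o f) ->
  (F n%:R - F (- n%:R)) @[n --> \oo] --> (0 : R) ->
  \int[mu]_x f x = 0.
Proof.
move=> dF cf ifT cvgF.
have cF : continuous F.
  by move=> x; apply: differentiable_continuous; apply/derivable1_diffP; have [] := dF x.
have H0 : (F n%:R - F (- n%:R))%:E @[n --> \oo] --> (0 : R)%:E.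
  by apply: cvg_EFin => //; near=> n.
have HE : \forall n \near \oo,
    (F n%:R - F (- n%:R))%:E = (\int[mu]_(x in `[(- n%:R)%R, (n%:R)%R]) (f x)%:E)%E.
  near=> n.
  have n0 : - n%:R < n%:R :> R.
    rewrite ltrNl -subr_gt0 opprK -natrD ltr0n addn_gt0.
    by rewrite orbb; near: n; exact: nbhs_infty_gt.
  rewrite (@continuous_FTC2 _ f F)// => [|| x _].
  - exact: continuous_subspaceT.
  - split=> [x _||]; first by have [] := dF x.
    + by apply: cvg_at_right_filter; exact: cF.
    + by apply: cvg_at_left_filter; exact: cF.
  - by rewrite derive1E; have [] := dF x.
have H1 := cvg_trans (near_eq_cvg HE) H0.
by rewrite /Rintegral (cvg_unique _ (cvg_integral_symmetric ifT) (H1 _)).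
Unshelve. all: by end_near. Qed.

(** Since [exp v >= v] at [v = n^2/(2 s^2)], the product is at most a multiple of [1/n]. *)
Lemma cvg_mul_normal_pdf : n%:R * normal_pdf 0 s n%:R @[n --> \oo] --> (0 : R).
Proof.
have bnd (n : nat) : (0 < n)%N ->
    n%:R * normal_pdf 0 s n%:R <= (2 * s ^+ 2 * normal_peak s) * n%:R^-1.
  move=> n0; have nR : 0 < n%:R :> R by rewrite ltr0n.
  rewrite normal_pdfE// /normal_fun subr0.
  have -> : - n%:R ^+ 2 / (s ^+ 2 *+ 2) = - (n%:R ^+ 2 / (s ^+ 2 *+ 2)) :> R.
    by rewrite mulNr.
  rewrite expRN.
  have ns : 0 < n%:R ^+ 2 / (s ^+ 2 *+ 2) :> R.
    by rewrite divr_gt0 ?exprn_gt0// mulrn_wgt0// exprn_gt0.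
  have e1 := expR_ge1Dx (n%:R ^+ 2 / (s ^+ 2 *+ 2) : R).
  have : (expR (n%:R ^+ 2 / (s ^+ 2 *+ 2)))^-1 <= (n%:R ^+ 2 / (s ^+ 2 *+ 2))^-1 :> R.
    by rewrite lef_pV2 ?posrE ?expR_gt0//; lra.
  move=> h; have := ler_wpM2l (mulr_ge0 (ltW nR) (normal_peak_ge0 s)) h.
  rewrite mulrA => /le_trans; apply; rewrite le_eqVlt; apply/orP; left; apply/eqP.
  by field; rewrite sN0 gt_eqF.
apply: (@squeeze_cvgr _ _ _ _ (cst 0)
    (fun n : nat => (2 * s ^+ 2 * normal_peak s) * n%:R^-1)).
- near=> n; rewrite mulr_ge0 ?normal_pdf_ge0//= bnd//.
  near: n; exact: nbhs_infty_gt.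
- exact: cvg_cst.
- rewrite -[X in _ --> X](mulr0 (2 * s ^+ 2 * normal_peak s)).
  apply: cvgM; first exact: cvg_cst.
  apply/gtr0_cvgV0; last exact: cvgr_idn.
  by near=> n; rewrite ltr0n; near: n; exact: nbhs_infty_gt.
Unshelve. all: by end_near. Qed.

Lemma normal_mean : \int[mu]_x (x * normal_pdf 0 s x) = 0.
Proof.
apply: (@integral_normal_antiderivative (fun x => - s ^+ 2 * normal_pdf 0 s x)
  (fun x => x * normal_pdf 0 s x)).
- move=> x; have D := is_derive_normal_pdf x.
  by apply: is_derive_eq; rewrite /GRing.scale/=; field.
- by move=> x; apply: cvgM; [exact: cvg_id|exact: continuous_normal_pdf].
- exact: (@integrable_normal_pow 1).
- rewrite (_ : (fun _ => _) = cst 0); first exact: cvg_cst.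
  by apply/funext => n /=; rewrite normal_pdf_even subrr.
Qed.

(** With [p] the density, [(x^2 - s^2) p] has the antiderivative [- s^2 x p], which tends to 0 at
    both ends. *)
Lemma normal_second_moment : \int[mu]_x (x ^+ 2 * normal_pdf 0 s x) = s ^+ 2.
Proof.
have i2 := @integrable_normal_pow 2 isT.
have i0 : mu.-integrable setT (EFin \o (fun x => s ^+ 2 * normal_pdf 0 s x)).
  exact: (integrableZl measurableT (s ^+ 2) (integrable_normal_pdf 0 s)).
have : \int[mu]_x (x ^+ 2 * normal_pdf 0 s x - s ^+ 2 * normal_pdf 0 s x) = 0.
  apply: (@integral_normal_antiderivative (fun x => - s ^+ 2 * x * normal_pdf 0 s x)
    (fun x => x ^+ 2 * normal_pdf 0 s x - s ^+ 2 * normal_pdf 0 s x)).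
  - move=> x; have D := is_derive_normal_pdf x.
    by apply: is_derive_eq; rewrite /GRing.scale/=; field.
  - move=> x; apply: cvgB; apply: cvgM; try exact: continuous_normal_pdf.
      exact: exprn_continuous.
    exact: cvg_cst.
  - exact: (integrableB measurableT i2 i0).
  - rewrite [X in X @ _ --> _](_ : _ =
        fun n : nat => - 2 * s ^+ 2 * (n%:R * normal_pdf 0 s n%:R)); last first.
      by apply/funext => n /=; rewrite normal_pdf_even; ring.
    rewrite -[X in _ --> X](mulr0 (- 2 * s ^+ 2)); apply: cvgM; first exact: cvg_cst.
    exact: cvg_mul_normal_pdf.
rewrite RintegralB// => /eqP; rewrite subr_eq0 => /eqP ->.
rewrite RintegralZl//; last exact: integrable_normal_pdf.
by rewrite /Rintegral integral_normal_pdf mulr1.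
Qed.

End NormalMoments.

(** * Moments of a random variable with centered normal law *)

Section NormalLaw.
Context d (Omega : measurableType d) (R : realType) (P : probability Omega R).
Local Notation mu := (@lebesgue_measure R).
Variables (X : Omega -> R) (s : R).
Hypothesis mX : measurable_fun setT X.
Hypothesis lawX : forall B : set R, measurable B -> P (X @^-1` B) = normal_prob 0 s B.

Lemma ge0_integral_normal_law (g : measurableTypeR R -> \bar R) :
  measurable_fun setT g -> (forall x, 0 <= g x)%E ->
  (\int[P]_omega g (X omega) = \int[mu]_x (g x * (normal_pdf 0 s x)%:E))%E.
Proof.
move=> mg g0.
(* [normal_prob] is a measure on [measurableTypeR R]; the random variable is read with that
   codomain. *)
have mX' : @measurable_fun _ _ Omega (measurableTypeR R) setT X.
  by move=> _ B mB; exact: mX.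
pose X' : {RV P >-> measurableTypeR R} := @mfun_Sub _ _ Omega (measurableTypeR R) X (mem_set mX').
rewrite -ge0_integral_normal_prob//.
rewrite (_ : (\int[P]_omega _)%E = (\int[P]_omega (g \o X') omega)%E)//.
rewrite -(@ge0_integral_distribution _ _ _ _ _ P X')//.
by apply: (eq_measure_integral (normal_prob 0 s)) => A mA _; exact: lawX.
Qed.

Lemma integral_normal_law (g : R -> R) : measurable_fun setT g ->
  mu.-integrable setT (EFin \o (fun x => g x * normal_pdf 0 s x)) ->
  P.-integrable setT (EFin \o (g \o X)) /\
  \int[P]_omega g (X omega) = \int[mu]_x (g x * normal_pdf 0 s x).
Proof.
move=> mg ig.
have mEg : measurable_fun setT (EFin \o g) by exact/measurable_EFinP.
have p0 x := normal_pdf_ge0 0 s x.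
split.
  apply/integrableP; split; first by apply/measurable_EFinP; exact: measurableT_comp.
  rewrite (@ge0_integral_normal_law (fun x => `|(g x)%:E|%E))//; last exact: measurableT_comp.
  move/integrableP: ig => [_]; congr (_ < _)%E; apply: eq_integral => x _ /=.
  by rewrite normrM (ger0_norm (p0 x)).
rewrite /Rintegral integralE [in RHS]integralE; congr (fine (_ - _)).
  transitivity (\int[P]_omega ((EFin \o g)^\+ (X omega)))%E.
    by apply: eq_integral => omega _; rewrite !funeposE.
  rewrite (ge0_integral_normal_law (measurable_funepos mEg))//.
  apply: eq_integral => x _; rewrite !funeposE /= -!EFin_max -EFinM.
  by rewrite maxr_pMl// mul0r.
transitivity (\int[P]_omega ((EFin \o g)^\- (X omega)))%E.
  by apply: eq_integral => omega _; rewrite !funenegE.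
rewrite (ge0_integral_normal_law (measurable_funeneg mEg))//.
apply: eq_integral => x _; rewrite !funenegE /= -!EFin_max -EFinM.
by rewrite maxr_pMl// mul0r mulNr.
Qed.

End NormalLaw.

Section NormalLawMoments.
Context d (Omega : measurableType d) (R : realType) (P : probability Omega R).
Variables (X : Omega -> R) (t : R).
Hypothesis t0 : 0 < t.
Hypothesis mX : measurable_fun setT X.
Hypothesis lawX : forall B : set R, measurable B ->
  P (X @^-1` B) = normal_prob 0 (Num.sqrt t) B.

Let s0 : 0 < Num.sqrt t. Proof. by rewrite sqrtr_gt0. Qed.

Let law_pow n : (n <= 4)%N ->
  P.-integrable setT (EFin \o (fun omega => X omega ^+ n)) /\
  \int[P]_omega (X omega ^+ n) =
    \int[lebesgue_measure]_x (x ^+ n * normal_pdf 0 (Num.sqrt t) x).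
Proof.
move=> n4; have in4 := integrable_normal_pow s0 n4.
exact: (integral_normal_law mX lawX (@exprn_measurable _ _ n) in4).
Qed.

Lemma normal_law_mean : \int[P]_omega X omega = 0.
Proof.
have [_ e] := @law_pow 1 isT.
transitivity (\int[P]_omega (X omega ^+ 1)) => //.
by rewrite e; have := normal_mean s0.
Qed.

Lemma normal_law_sqr :
  P.-integrable setT (EFin \o (fun omega => X omega ^+ 2)) /\
  \int[P]_omega (X omega ^+ 2) = t.
Proof.
have [i e] := @law_pow 2 isT; split => //.
by rewrite e normal_second_moment// sqr_sqrtr// ltW.
Qed.

(** Expanding the square leaves [E X^4 - t^2]. This bound, quadratic in the time step, is what makes
    the second order terms negligible on a fine grid. *)
Lemma normal_law_sqr_deviation :
  P.-integrable setT (EFin \o (fun omega => (X omega ^+ 2 - t) ^+ 2)) /\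
  \int[P]_omega ((X omega ^+ 2 - t) ^+ 2) <= 30 * t ^+ 2.
Proof.
have [i4 e4] := @law_pow 4 isT; have [i2 e2] := normal_law_sqr.
have ic : P.-integrable setT (EFin \o (fun _ : Omega => t ^+ 2)).
  exact: finite_measure_integrable_cst.
have i2' := integrableZl measurableT (- 2 * t) i2.
have E : (fun omega => (X omega ^+ 2 - t) ^+ 2) =
    (fun omega => X omega ^+ 4 + - 2 * t * X omega ^+ 2 + t ^+ 2).
  by apply/funext => omega; ring.
have i42 := integrableD measurableT i4 i2'.
have i420 := integrableD measurableT i42 ic.
rewrite E; split; first exact: i420.
rewrite RintegralD// RintegralD// RintegralZl// e2.
rewrite (_ : \int[P]_omega t ^+ 2 = t ^+ 2); last first.
  by rewrite /Rintegral integral_cst// [X in (_ * X)%E]probability_setT mule1.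
have : \int[P]_omega (X omega ^+ 4) <= 30 * t ^+ 2.
  rewrite e4; have [i b] := integrable_normal_pow4 s0.
  rewrite -lee_fin /Rintegral fineK; last exact: integrable_fin_num i.
  apply: (le_trans b); rewrite lee_fin.
  have -> : Num.sqrt t ^+ 4 = (Num.sqrt t ^+ 2) ^+ 2 by rewrite -exprM.
  by rewrite sqr_sqrtr// ltW.
have := sqr_ge0 t; nra.
Qed.

End NormalLawMoments.

(** * Martingale transforms and Lenglart's inequality *)

Section Independence.
Context d (Omega : measurableType d) (R : realType) (P : probability Omega R).
Variable G : set (set Omega).
Hypothesis Gm : G `<=` measurable.

(** Independence says that the joint law of [(X, Z)] agrees with the product of the two laws on
    rectangles, hence everywhere; Tonelli gives integrability and Fubini factors the integral. *)
Lemma independent_integralM (X Z : Omega -> R) :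
  measurable_wrt G X -> measurable_fun setT Z -> independent_of P G Z ->
  P.-integrable setT (EFin \o X) -> P.-integrable setT (EFin \o Z) ->
  P.-integrable setT (EFin \o (fun omega => X omega * Z omega)) /\
  \int[P]_omega (X omega * Z omega) =
    (\int[P]_omega X omega) * (\int[P]_omega Z omega).
Proof.
move=> GX mZ indep iX iZ.
have mX : measurable_fun setT X := measurable_wrt_measurable Gm GX.
have mXZ : measurable_fun setT (fun omega => (X omega, Z omega)).
  exact: measurable_fun_pair.
pose X' : {RV P >-> R} := mfun_Sub (mem_set mX).
pose Z' : {RV P >-> R} := mfun_Sub (mem_set mZ).
pose XZ : {RV P >-> (R * R)%type} := mfun_Sub (mem_set mXZ).
have dE : forall A, measurable A ->
    (distribution P X' \x distribution P Z')%E A = distribution P XZ A.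
  apply: product_measure_unique => A B mA mB.
  have := indep (X @^-1` A) B (GX A mA) mB.
  exact.
have mmul : measurable_fun setT (fun p : R * R => p.1 * p.2).
  exact: measurable_funM.
have inner (x : R) : (\int[distribution P Z']_z (`|x * z|)%:E =
    (`|x|)%:E * \int[distribution P Z']_z (`|z|)%:E)%E.
  under eq_integral do rewrite normrM EFinM.
  by rewrite ge0_integralZl//; apply/measurable_EFinP; exact: normr_measurable.
have ia : P.-integrable setT (EFin \o (fun omega => X omega * Z omega)).
  apply/integrableP; split; first by apply/measurable_EFinP; exact: measurable_funM.
  rewrite (_ : (\int[P]_x _)%E =
      (\int[P]_x ((fun p : R * R => `|(p.1 * p.2)%:E|%E) \o XZ) x)%E)//.
  rewrite -ge0_integral_distribution//; last first.
    by apply: measurableT_comp => //; exact/measurable_EFinP.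
  rewrite (eq_measure_integral (distribution P X' \x distribution P Z')%E); last first.
    by move=> A mA _; exact: (esym (dE A mA)).
  rewrite fubini_tonelli1//=; last first.
    by apply/measurable_EFinP; exact: measurableT_comp.
  under eq_integral do rewrite /fubini_F inner.
  rewrite /= ge0_integralZr//; last 2 first.
    by apply/measurable_EFinP; exact: normr_measurable.
    exact: integral_ge0.
  rewrite (@ge0_integral_distribution _ _ _ _ _ P X' (fun x => (`|x|)%:E))//; last first.
    by apply/measurable_EFinP; exact: normr_measurable.
  rewrite (@ge0_integral_distribution _ _ _ _ _ P Z' (fun x => (`|x|)%:E))//; last first.
    by apply/measurable_EFinP; exact: normr_measurable.
  move/integrableP: iX => [_ iX]; move/integrableP: iZ => [_ iZ].
  apply: lte_mul_pinfty; [by apply: integral_ge0 => omega _ /=; rewrite lee_fin| |exact: iZ].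
  rewrite ge0_fin_numE; [exact: iX|by apply: integral_ge0 => omega _ /=; rewrite lee_fin].
split => //.
have eX : \int[P]_omega X omega = \int[distribution P X']_x x.
  by rewrite /Rintegral (@integral_distribution _ _ _ _ _ P X' EFin).
have eZ : \int[P]_omega Z omega = \int[distribution P Z']_x x.
  by rewrite /Rintegral (@integral_distribution _ _ _ _ _ P Z' EFin).
have iX' : (distribution P X').-integrable setT EFin.
  apply/integrableP; split; first exact/measurable_EFinP.
  rewrite (@ge0_integral_distribution _ _ _ _ _ P X' (fun x => `|x%:E|%E))//; last first.
    by apply: measurableT_comp => //; exact/measurable_EFinP.
  by move/integrableP: iX => [].
have iZ' : (distribution P Z').-integrable setT EFin.
  apply/integrableP; split; first exact/measurable_EFinP.
  rewrite (@ge0_integral_distribution _ _ _ _ _ P Z' (fun x => `|x%:E|%E))//; last first.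
    by apply: measurableT_comp => //; exact/measurable_EFinP.
  by move/integrableP: iZ => [].
rewrite eX eZ /Rintegral.
rewrite (_ : (\int[P]_omega (X omega * Z omega)%:E)%E =
   (\int[P]_omega (((fun p : R * R => (p.1 * p.2)%:E) \o XZ) omega))%E)//.
rewrite -integral_distribution//; last exact/measurable_EFinP.
have ip : (distribution P X' \x distribution P Z')%E.-integrable setT
    (fun p : R * R => (p.1 * p.2)%:E).
  apply/integrable12ltyP; first exact/measurable_EFinP.
  under eq_integral do rewrite /= inner.
  rewrite /= ge0_integralZr//; last 2 first.
    by apply/measurable_EFinP; exact: normr_measurable.
    exact: integral_ge0.
  move/integrableP: iX' => [_ iX']; move/integrableP: iZ' => [_ iZ'].
  apply: lte_mul_pinfty; [by apply: integral_ge0 => omega _ /=; rewrite lee_fin| |exact: iZ'].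
  rewrite ge0_fin_numE; [exact: iX'|by apply: integral_ge0 => omega _ /=; rewrite lee_fin].
rewrite (eq_measure_integral (distribution P X' \x distribution P Z')%E); last first.
  by move=> A mA _; exact: (esym (dE A mA)).
rewrite -integral12_prod_meas1//.
have inner' (x : R) : (fubini_F (distribution P Z') (fun p : R * R => (p.1 * p.2)%:E) x =
    x%:E * \int[distribution P Z']_z z%:E)%E.
  rewrite /fubini_F /=; under eq_integral do rewrite EFinM.
  by rewrite integralZl.
rewrite (_ : (\int[_]_x fubini_F _ _ x)%E =
    (\int[distribution P X']_x (x%:E * \int[distribution P Z']_z z%:E))%E); last first.
  by apply: eq_integral => x _; exact: inner'.
have fZ := integrable_fin_num measurableT iZ'.
rewrite -(fineK fZ) integralZr//= fineM//; exact: integrable_fin_num.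
Qed.

End Independence.

Section BoundedMultiple.
Context d (Omega : measurableType d) (R : realType) (P : probability Omega R).

Lemma integrable_bounded_mul (C X : Omega -> R) (M : R) :
  measurable_fun setT C -> (forall omega, `|C omega| <= M) ->
  P.-integrable setT (EFin \o X) ->
  P.-integrable setT (EFin \o (fun omega => C omega * X omega)).
Proof.
move=> mC CM iX.
have mX : measurable_fun setT X by apply/measurable_EFinP; exact: measurable_int iX.
have iMX := integrableZl measurableT M iX.
apply: (le_integrable _ _ _ iMX) => //.
  by apply/measurable_EFinP; exact: measurable_funM.
move=> omega _ /=; rewrite lee_fin !normrM ler_wpM2r//.
by apply: (le_trans (CM omega)); exact: ler_norm.
Qed.

Lemma integrable_bounded (C : Omega -> R) (M : R) :
  measurable_fun setT C -> (forall omega, `|C omega| <= M) ->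
  P.-integrable setT (EFin \o C).
Proof.
move=> mC CM.
have i1 : P.-integrable setT (EFin \o (fun _ : Omega => 1 : R)).
  exact: finite_measure_integrable_cst.
have := integrable_bounded_mul mC CM i1.
by under eq_fun do rewrite mulr1.
Qed.

(** Chebyshev's inequality. *)
Lemma off_event_second_moment (S : Omega -> R) (eta kappa : R) : 0 < kappa ->
  measurable_fun setT S ->
  (\int[P]_omega (S omega ^+ 2)%:E <= eta%:E)%E ->
  off_event P (eta / kappa ^+ 2) (fun omega => `|S omega| <= kappa).
Proof.
move=> k0 mS Seta.
exists [set omega | (kappa ^+ 2)%:E <= `|(S omega ^+ 2)%:E|]%E; split.
- have -> : [set omega | (kappa ^+ 2)%:E <= `|(S omega ^+ 2)%:E|]%E =
     (fun omega => S omega ^+ 2) @^-1` `[kappa ^+ 2, +oo[%classic.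
    apply/seteqP; split=> omega /=; rewrite in_itv/= andbT lee_fin ger0_norm ?sqr_ge0//.
  rewrite -[X in measurable X]setTI; apply: measurable_funX => //.
- have k20 : 0 < kappa ^+ 2 by rewrite exprn_gt0.
  rewrite -(@lee_pmul2l _ (kappa ^+ 2)%:E) ?lte_fin//.
  apply: (@le_trans _ _ eta%:E); last first.
    by rewrite -EFinM lee_fin mulrCA divff ?mulr1// gt_eqF.
  apply: le_trans Seta.
  have mS2 : measurable_fun setT (EFin \o (fun omega => S omega ^+ 2)).
    by apply/measurable_EFinP; exact: measurable_funX.
  have := le_integral_abse P measurableT mS2 k20; rewrite setTI => /le_trans; apply.
  by under eq_integral do rewrite /= ger0_norm ?sqr_ge0//.
- move=> omega /= /negP; rewrite -ltNge lte_fin ger0_norm ?sqr_ge0// => h.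
  by rewrite -(ler_pXn2r (n := 2)) ?nnegrE ?normr_ge0 ?ltW// real_normK ?num_real// ltW.
Qed.

End BoundedMultiple.

Section MartingaleTransform.
Context d (Omega : measurableType d) (R : realType) (P : probability Omega R).

Lemma integrable_of_sqr (X : Omega -> R) : measurable_fun setT X ->
  P.-integrable setT (EFin \o (fun omega => X omega ^+ 2)) ->
  P.-integrable setT (EFin \o X).
Proof.
move=> mX iX2.
have i1 : P.-integrable setT (EFin \o (fun _ : Omega => 1 : R)).
  exact: finite_measure_integrable_cst.
apply: (le_integrable _ _ _ (integrableD _ i1 iX2)) => //; first exact/measurable_EFinP.
move=> omega _ /=; rewrite lee_fin [leRHS]ger0_norm; last by rewrite addr_ge0// sqr_ge0.
have := sqr_ge0 (`|X omega| - 1); rewrite -[X omega ^+ 2]real_normK ?num_real//.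
have := normr_ge0 (X omega); nra.
Qed.

Lemma independent_of_comp (G : set (set Omega)) (X : Omega -> R) (phi : R -> R) :
  measurable_fun setT phi -> independent_of P G X ->
  independent_of P G (fun omega => phi (X omega)).
Proof.
move=> mphi indep A B GA mB; apply: (indep A (phi @^-1` B)) => //.
by rewrite -[X in measurable X]setTI; exact: mphi.
Qed.

Variables (G : nat -> set (set Omega)) (xi : nat -> Omega -> R).
Hypothesis sG : forall k, sigma_algebra setT (G k).
Hypothesis Gm : forall k, G k `<=` measurable.
Hypothesis Gmono : forall k, G k `<=` G k.+1.
Hypothesis xi_meas : forall k, measurable_wrt (G k.+1) (xi k).
Hypothesis xi_indep : forall k, independent_of P (G k) (xi k).
Hypothesis xi_sqr : forall k, P.-integrable setT (EFin \o (fun omega => xi k omega ^+ 2)).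
Hypothesis xi_mean : forall k, \int[P]_omega xi k omega = 0.
Let v k := \int[P]_omega (xi k omega ^+ 2).

Section Coefficients.
Variables (c : nat -> Omega -> R) (M : R).
Hypothesis c_meas : forall k, measurable_wrt (G k) (c k).
Hypothesis c_bnd : forall k omega, `|c k omega| <= M.

Let S n omega := \sum_(k < n) c k omega * xi k omega.

Let S_meas n : measurable_wrt (G n) (S n).
Proof.
elim: n => [|n IH].
  by rewrite /S (_ : (fun _ => _) = fun=> 0); [exact: measurable_wrt_cst|
    apply/funext => omega; rewrite big_ord0].
rewrite /S (_ : (fun _ => _) = fun omega => S n omega + c n omega * xi n omega).
  apply: (measurable_wrtD (sG _)); first exact: (measurable_wrtS (@Gmono n)).
  by apply: (measurable_wrtM (sG _)) => //; exact: (measurable_wrtS (@Gmono n)).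
by apply/funext => omega; rewrite big_ord_recr.
Qed.

Let mc k : measurable_fun setT (c k).
Proof. exact: measurable_wrt_measurable (c_meas k). Qed.

Let c2_bnd k omega : `|c k omega ^+ 2| <= M ^+ 2.
Proof. by rewrite normrX lerXn2r ?nnegrE// (le_trans _ (c_bnd k omega)). Qed.

(** Increments are orthogonal: [c n * S n] is known at time [n] and [xi n] is centered and
    independent of [G n], so the cross term has mean zero; [c n ^+ 2] and [xi n ^+ 2] are
    independent and their means multiply. *)
Lemma martingale_transform_sqr n :
  P.-integrable setT (EFin \o (fun omega => S n omega ^+ 2)) /\
  \int[P]_omega (S n omega ^+ 2) = \int[P]_omega (\sum_(k < n) c k omega ^+ 2 * v k).
Proof.
elim: n => [|n [iS IH]].
  have E0 : (fun omega => S 0%N omega ^+ 2) = fun=> 0.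
    by apply/funext => omega; rewrite /S big_ord0 expr0n.
  rewrite E0; split; first exact: finite_measure_integrable_cst.
  by congr Rintegral; apply/funext => omega; rewrite big_ord0.
have mS : measurable_fun setT (S n) := measurable_wrt_measurable (@Gm n) (S_meas n).
have mxi k : measurable_fun setT (xi k) := measurable_wrt_measurable (@Gm _) (xi_meas k).
have ixi k : P.-integrable setT (EFin \o xi k) by exact: integrable_of_sqr.
have iS1 : P.-integrable setT (EFin \o S n) by exact: integrable_of_sqr.
pose X omega := 2 * c n omega * S n omega.
have mX : measurable_wrt (G n) X.
  by do 2 (apply: (measurable_wrtM (sG _)) => //); exact: measurable_wrt_cst.
have iX : P.-integrable setT (EFin \o X).
  apply: (@integrable_bounded_mul _ _ _ P (fun omega => 2 * c n omega) (S n) (2 * M)) => //.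
    exact: measurable_funM.
  by move=> omega; rewrite normrM ger0_norm// ler_wpM2l.
have [iXx eXx] := independent_integralM (@Gm n) mX (mxi n) (@xi_indep n) iX (ixi n).
have ic2 : P.-integrable setT (EFin \o (fun omega => c n omega ^+ 2)).
  by apply: (@integrable_bounded _ _ _ P _ (M ^+ 2)) => //; exact: measurable_funX.
have mc2 : measurable_wrt (G n) (fun omega => c n omega ^+ 2).
  apply: (@measurable_wrt_comp _ _ _ _ (sG n) (fun x => x ^+ 2)) => //.
have [icx ecx] := independent_integralM (@Gm n) mc2
  (measurable_funX 2 (mxi n)) (independent_of_comp (@exprn_measurable _ _ 2) (@xi_indep n))
  ic2 (xi_sqr n).
have ES : (fun omega => S n.+1 omega ^+ 2) = fun omega =>
    S n omega ^+ 2 + X omega * xi n omega + c n omega ^+ 2 * xi n omega ^+ 2.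
  by apply/funext => omega; rewrite /X /S big_ord_recr/=; ring.
have isum m : P.-integrable setT
    (EFin \o (fun omega => \sum_(k < m) c k omega ^+ 2 * v k)).
  apply: (@integrable_bounded _ _ _ _ _ (\sum_(k < m) M ^+ 2 * `|v k|)).
    apply: measurable_sum => k; apply: measurable_funM => //; exact: measurable_funX.
  move=> omega; apply: (le_trans (ler_norm_sum _ _ _)); apply: ler_sum => k _.
  by rewrite normrM ler_wpM2r.
have i12 := integrableD measurableT iS iXx.
have i123 := integrableD measurableT i12 icx.
rewrite ES; split; first exact: i123.
rewrite RintegralD// RintegralD// IH eXx ecx xi_mean mulr0 addr0 -/(v n).
rewrite -RintegralZr// -RintegralD//.
- by congr Rintegral; apply/funext => omega; rewrite big_ord_recr.
- apply: (@integrable_bounded _ _ _ _ _ (M ^+ 2 * `|v n|)).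
    by apply: measurable_funM => //; exact: measurable_funX.
  by move=> omega; rewrite normrM ler_wpM2r.
Qed.

Lemma martingale_transform_small n (eta kappa : R) : 0 < kappa ->
  (forall omega, \sum_(k < n) c k omega ^+ 2 * v k <= eta) ->
  off_event P (eta / kappa ^+ 2)
    (fun omega => `|\sum_(k < n) c k omega * xi k omega| <= kappa).
Proof.
move=> k0 bnd; have [iS eS] := martingale_transform_sqr n.
apply: off_event_second_moment => //.
  exact: measurable_wrt_measurable (@Gm n) (S_meas n).
rewrite -[X in (X <= _)%E]fineK; last exact: integrable_fin_num iS.
rewrite lee_fin -/(Rintegral P setT (fun omega => S n omega ^+ 2)) eS.
have ieta : P.-integrable setT (EFin \o (fun _ : Omega => eta)).
  exact: finite_measure_integrable_cst.
apply: (@le_trans _ _ (\int[P]_omega eta)).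
  apply: le_Rintegral => //.
  apply: (@integrable_bounded _ _ _ _ _ (\sum_(k < n) M ^+ 2 * `|v k|)).
    apply: measurable_sum => k; apply: measurable_funM => //; exact: measurable_funX.
  move=> omega; apply: (le_trans (ler_norm_sum _ _ _)); apply: ler_sum => k _.
  by rewrite normrM ler_wpM2r.
by rewrite /Rintegral integral_cst// [X in (_ * X)%E]probability_setT mule1.
Qed.

End Coefficients.

Lemma v_ge0 k : 0 <= v k.
Proof. by apply: Rintegral_ge0 => omega _; exact: sqr_ge0. Qed.

(* The coefficients are truncated at the first time the accumulated variance
   exceeds [eta]. *)
Lemma lenglart (c : nat -> Omega -> R) (M : R) n (p eta kappa : R) :
  (forall k, measurable_wrt (G k) (c k)) -> (forall k omega, `|c k omega| <= M) ->
  0 < kappa -> 0 <= eta ->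
  off_event P p (fun omega => \sum_(k < n) c k omega ^+ 2 * v k <= eta) ->
  off_event P (p + eta / kappa ^+ 2)
    (fun omega => `|\sum_(k < n) c k omega * xi k omega| <= kappa).
Proof.
move=> c_meas c_bnd k0 eta0 H.
pose V k omega := \sum_(j < k) c j omega ^+ 2 * v j.
(* [V k.+1] contains only the coefficients up to [c k], so the truncation of step [k] is decided at
   time [k]. *)
pose A k := [set omega | V k.+1 omega <= eta].
pose c' k omega := c k omega * \1_(A k) omega.
have V_meas k : measurable_wrt (G k) (V k.+1).
  apply: (measurable_wrt_sum (sG k)) => j _.
  apply: (measurable_wrtM (sG k)); last exact: measurable_wrt_cst.
  apply: (@measurable_wrt_comp _ _ _ _ (sG k) (fun x => x ^+ 2)) => //.
  apply: (measurable_wrtS _ (c_meas j)).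
  have : (j <= k)%N by rewrite -ltnS.
  elim: k {j} (j : nat) => [|k IH] j; first by rewrite leqn0 => /eqP ->.
  rewrite leq_eqVlt => /orP[/eqP ->//|]; rewrite ltnS => /IH h; exact: subset_trans h (@Gmono k).
have Vmono omega i k : (i <= k)%N -> V i omega <= V k omega.
  elim: k => [|k IH]; first by rewrite leqn0 => /eqP ->.
  rewrite leq_eqVlt => /orP[/eqP ->//|]; rewrite ltnS => /IH/le_trans; apply.
  by rewrite /V big_ord_recr/= lerDl mulr_ge0 ?sqr_ge0 ?v_ge0.
have c'_meas k : measurable_wrt (G k) (c' k).
  apply: (measurable_wrtM (sG k)) => //; apply: (measurable_wrt_indic (sG k)).
  exact: measurable_wrt_le.
have c'_bnd k omega : `|c' k omega| <= M.
  rewrite /c' indicE; case: (omega \in A k); first by rewrite mulr1.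
  by rewrite mulr0 normr0 (le_trans _ (c_bnd k omega)).
have small omega : \sum_(k < n) c' k omega ^+ 2 * v k <= eta.
  (* The second conjunct carries the induction: while the accumulated variance is at most [eta],
     nothing has been truncated. *)
  suff : \sum_(k < n) c' k omega ^+ 2 * v k <= eta /\
      (V n omega <= eta -> \sum_(k < n) c' k omega ^+ 2 * v k = V n omega) by case.
  elim: n {H} => [|m [IH1 IH2]]; first by rewrite /V !big_ord0.
  rewrite big_ord_recr/=.
  have [le|lt] := leP (V m.+1 omega) eta.
    have E : c' m omega = c m omega by rewrite /c' indicE mem_set ?mulr1.
    rewrite IH2 ?(le_trans (Vmono omega m m.+1 _))// E.
    by move: le; rewrite /V big_ord_recr/=.
  have E : c' m omega = 0.
    by rewrite /c' indicE memNset ?mulr0// => /(lt_le_trans lt); rewrite ltxx.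
  by rewrite E expr0n mul0r addr0; split.
have := off_eventI H (martingale_transform_small c'_meas c'_bnd k0 small).
apply: off_eventW => // omega [Vn]; congr (`|_| <= _).
apply: eq_bigr => k _; congr (_ * _); rewrite /c' indicE mem_set ?mulr1// /A/=.
by apply: le_trans Vn; exact: Vmono.
Qed.

End MartingaleTransform.

(** * Simple processes on refining grids *)

Section Grids.
Context (R : realType) (theta T : R).
Hypothesis theta_le_T : theta <= T.
Implicit Types (g : nat -> R) (N : nat).

(** An infinite sequence, constant from [N] on, so that [g k.+1] makes sense for every [k]. Repeated
    points are allowed, which keeps the insertion of points simple; the price is that degenerate
    steps must be treated wherever Wiener increments occur. *)
Definition grid g N :=
  [/\ g 0%N = theta, (forall k, (N <= k)%N -> g k = T) & (forall k, g k <= g k.+1)].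

Lemma grid_mono g N i j : grid g N -> (i <= j)%N -> g i <= g j.
Proof.
move=> [_ _ gS]; elim: j => [|j IH]; first by rewrite leqn0 => /eqP ->.
rewrite leq_eqVlt => /orP[/eqP ->//|]; rewrite ltnS => /IH/le_trans; exact.
Qed.

Lemma grid_ge g N k : grid g N -> theta <= g k.
Proof. by move=> gg; case: (gg) => <- _ _; exact: grid_mono gg _. Qed.

Lemma grid_le g N k : grid g N -> g k <= T.
Proof.
move=> gg; case: (gg) => _ gN _; rewrite -(gN (maxn k N)) ?leq_maxr//.
by apply: grid_mono gg _; exact: leq_maxl.
Qed.

Lemma grid_in g N k : grid g N -> g k \in `[theta, T].
Proof. by move=> gg; rewrite in_itv/= (grid_ge _ gg) (grid_le _ gg). Qed.

Lemma uniform_grid (delta : R) : 0 < delta ->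
  exists g N, grid g N /\ forall k, g k.+1 - g k <= delta.
Proof.
move=> d0; exists (fun k => Num.min T (theta + k%:R * delta)).
exists (Num.truncn ((T - theta) / delta)).+1; split; last first.
  move=> k; rewrite -natr1; set a := k%:R * delta.
  have -> : theta + (k%:R + 1) * delta = theta + a + delta by rewrite /a; ring.
  by case: (leP T (theta + a + delta)) => h1; case: (leP T (theta + a)) => h2; lra.
split.
- by rewrite mul0r addr0 min_r.
- move=> k kN; rewrite min_l// -lerBlDl -ler_pdivrMr// ltW//.
  by apply: lt_le_trans (truncnS_gt _) _; rewrite ler_nat.
- by move=> k; rewrite le_min2// lerD2l ler_wpM2r ?ltW// ltr_nat.
Qed.

(* [max (min (g k) p) (g k.-1)] enumerates the increasing sequence [g] with the
   point [p] inserted at its place. *)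
Lemma insert_grid g N p delta : grid g N -> p \in `[theta, T] ->
  (forall k, g k.+1 - g k <= delta) ->
  exists g' N', [/\ grid g' N', (forall k, g' k.+1 - g' k <= delta),
    (exists j, p = g' j) & forall q, (exists j, q = g j) -> exists j, q = g' j].
Proof.
move=> gg; rewrite in_itv/= => /andP[tp pT] gd; case: (gg) => g0 gN gS.
have d0 : 0 <= delta by apply: le_trans (gd 0%N); rewrite subr_ge0.
exists (fun k => Num.max (Num.min (g k) p) (g k.-1)), N.+1; split.
- split.
  + by rewrite /= g0 min_l// maxxx.
  + move=> [//|k]; rewrite ltnS => Nk; rewrite /= (gN k)// max_r// ge_min.
    by rewrite (grid_le _ gg).
  + move=> k /=; rewrite ge_max; apply/andP; split.
      by rewrite le_max; apply/orP; left; rewrite le_min2.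
    rewrite le_max; apply/orP; right; case: k => //= k; exact: gS.
- move=> k /=; rewrite lerBlDr ge_max; apply/andP; split.
    apply: (@le_trans _ _ (delta + Num.min (g k) p)).
      have := gd k; have := gS k.
      by case: (leP (g k.+1) p) => h1; case: (leP (g k) p) => h2; lra.
    by rewrite lerD2l le_max lexx.
  apply: (@le_trans _ _ (delta + g k.-1)).
    case: k => [|k] /=; first by rewrite lerDr.
    by have := gd k; lra.
  by rewrite lerD2l le_max lexx orbT.
- have ex : exists j, p <= g j by exists N; rewrite gN.
  (* The least [j] with [p <= g j] is the index at which [p] occurs in the new sequence; if it is 0,
     then [p] is [theta]. *)
  case: (ex_minnP ex) => -[|j] pj jmin.
    have -> : p = g 0%N by apply/le_anti; rewrite pj g0 tp.
    by exists 0%N; rewrite /= minxx maxxx.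
  exists j.+1 => /=; rewrite min_r// max_l//.
  by have [//|/ltW/jmin] := leP (g j) p; rewrite ltnn.
- move=> _ [j ->]; have [jp|pj] := leP (g j) p.
    exists j; rewrite min_l// max_l//; case: j {jp} => //= j; exact: gS.
  exists j.+1 => /=; rewrite max_r// ge_min; apply/orP; right; exact: ltW.
Qed.

Lemma refining_grid (pts : seq R) (delta : R) : 0 < delta ->
  {in pts, forall p, p \in `[theta, T]} ->
  exists g N, [/\ grid g N, (forall k, g k.+1 - g k <= delta) &
    {in pts, forall p, exists j, p = g j}].
Proof.
move=> d0; elim: pts => [_|p pts IH Hp].
  by have [g [N [gg gd]]] := uniform_grid d0; exists g, N.
have [|g [N [gg gd gp]]] := IH.
  by move=> q qp; apply: Hp; rewrite inE qp orbT.
have Hp0 : p \in `[theta, T] by apply: (Hp p); rewrite inE eqxx.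
have [g' [N' [gg' gd' pg' gg2]]] := insert_grid gg Hp0 gd.
exists g', N'; split => // q; rewrite inE => /orP[/eqP ->//|/gp]; exact: gg2.
Qed.

(** A telescoping sum up to [p], written over all [N] steps with indicators, so that sums for
    different nodes of a simple process can be combined term by term. *)
Lemma grid_telescope g N (p : R) (Z : R -> R) t : grid g N -> (exists j, p = g j) ->
  theta <= t ->
  Z (Num.min p t) - Z theta =
    \sum_(k < N) (g k.+1 <= p)%R%:R * (Z (Num.min (g k.+1) t) - Z (Num.min (g k) t)).
Proof.
move=> gg [j0 ->] tt; case: (gg) => g0 gN gS.
(* An index beyond [N] may be replaced by [N], since the grid stays at [T]. *)
have [j [jN ->]] : exists j, (j <= N)%N /\ g j0 = g j.
  have [h|/ltnW h] := leqP j0 N; first by exists j0.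
  by exists N; rewrite !gN.
have : \sum_(0 <= k < j) (Z (Num.min (g k.+1) t) - Z (Num.min (g k) t)) =
   Z (Num.min (g j) t) - Z theta.
  by rewrite (telescope_sumr (fun k => Z (Num.min (g k) t)))// g0 (min_l tt).
move=> <-; rewrite big_mkord (big_ord_widen N
  (fun k => Z (Num.min (g k.+1) t) - Z (Num.min (g k) t)) jN) big_mkcond/=.
apply: eq_bigr => k _; have [kj|jk] := ltnP k j.
  by rewrite (grid_mono gg kj) mul1r.
(* A step after index [j] that still satisfies [g k.+1 <= g j] is degenerate and contributes 0. *)
have [le|_] := boolP (g k.+1 <= g j); last by rewrite mul0r.
have -> : g k.+1 = g k.
  apply/le_anti; rewrite gS andbT (le_trans le)//; exact: grid_mono gg jk.
by rewrite subrr mulr0.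
Qed.

End Grids.

(** * Simple processes on a grid and measurability before a stopping time *)

Section SimpleProcesses.
Context d (Omega : measurableType d) (R : realType) (P : probability Omega R).
Variables (theta T : R) (F : R -> set (set Omega)).
Hypothesis theta_le_T : theta <= T.
Hypothesis F_filtration : complete_rc_filtration P theta T F.
Implicit Type H : simple_process theta T F.

Lemma indic_itvoc (a b s : R) : a <= b ->
  \1_[set` `]a, b]] s = (s <= b)%R%:R - (s <= a)%R%:R :> R.
Proof.
move=> ab; rewrite indicE; have [sb|bs] := leP s b; last first.
  rewrite memNset ?leNgt ?(le_lt_trans ab bs) ?subrr//= in_itv/= leNgt bs andbF//.
have [sa|as_] := leP s a.
  by rewrite memNset ?subrr//= in_itv/= ltNge sa.
by rewrite mem_set ?subr0//= in_itv/= as_.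
Qed.

Definition sp_nodes H : seq R := [seq sp_node H k | k <- iota 0 (sp_size H).+1].

Lemma sp_nodes_in H : {in sp_nodes H, forall p, p \in `[theta, T]}.
Proof.
move=> p /mapP[k]; rewrite mem_iota add0n ltnS => /andP[_ kn] ->; exact: sp_node_in.
Qed.

Lemma mem_sp_nodes H k : (k <= sp_size H)%N -> sp_node H k \in sp_nodes H.
Proof. by move=> kn; apply: map_f; rewrite mem_iota add0n ltnS. Qed.

Lemma sp_val_bounded H : exists B : R, 0 <= B /\ forall t omega, `|sp_val H t omega| <= B.
Proof.
rewrite /sp_val; set c := sp_coef H; set n := sp_size H.
have /choice[M HM] : forall k, exists M : R, (k < n)%N -> forall omega, `|c k omega| <= M.
  move=> k; have [kn|nk] := ltnP k n; last by exists 0.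
  by have [M HM] := sp_coef_bnd kn; exists M.
exists (\sum_(k < n) `|M k|); split; first exact: sumr_ge0.
move=> t omega; apply: (le_trans (ler_norm_sum _ _ _)); apply: ler_sum => k _.
rewrite normrM; apply: (@le_trans _ _ (`|M k| * 1)); last by rewrite mulr1.
apply: ler_pM => //; first by apply: (le_trans (HM k (ltn_ord k) omega)); exact: ler_norm.
by rewrite indicE; case: (_ \in _); rewrite ?normr1// normr0.
Qed.

(** The constant depends on [H] alone, not on the integrator. It controls the effect of replacing
    the martingale part of [y] by a uniformly close process, once [H] has been fixed. *)
Lemma sp_integral_bound H : exists K : R, 0 <= K /\
  forall (Z : R -> Omega -> R) (c t : R) omega, theta <= t ->
    (forall s, s \in `[theta, t] -> `|Z s omega| <= c) ->
    `|sp_integral H Z t omega| <= K * c.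
Proof.
set n := sp_size H.
have /choice[M HM] : forall k, exists M : R, (k < n)%N -> forall omega, `|sp_coef H k omega| <= M.
  move=> k; have [kn|nk] := ltnP k n; last by exists 0.
  by have [M HM] := sp_coef_bnd kn; exists M.
exists (\sum_(k < n) `|M k| * 2); split; first by apply: sumr_ge0 => k _; rewrite mulr_ge0.
move=> Z c t omega tt Zc; apply: (le_trans (ler_norm_sum _ _ _)); rewrite mulr_suml.
apply: ler_sum => k _; rewrite normrM -mulrA; apply: ler_pM => //.
  by apply: (le_trans (HM k (ltn_ord k) omega)); exact: ler_norm.
have Zm j : (j <= n)%N -> `|Z (Num.min (sp_node H j) t) omega| <= c.
  move=> jn; apply: Zc; rewrite in_itv/= ge_min lexx orbT andbT le_min tt andbT.
  by have := sp_node_in jn; rewrite in_itv/= => /andP[].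
rewrite mulr_natl mulr2n; apply: (le_trans (ler_normB _ _)).
by apply: lerD; apply: Zm => //; exact: ltnW.
Qed.

Section OnGrid.
Variables (g : nat -> R) (N : nat) (H : simple_process theta T F).
Hypothesis gg : grid theta T g N.
Hypothesis gH : {in sp_nodes H, forall p, exists j, p = g j}.

(** Each increment between nodes splits over grid steps; exchanging the two sums collects the value
    of [H] on each step. *)
Lemma sp_integral_grid (X : R -> Omega -> R) t omega : theta <= t ->
  sp_integral H X t omega =
  \sum_(k < N) sp_val H (g k.+1) omega *
    (X (Num.min (g k.+1) t) omega - X (Num.min (g k) t) omega).
Proof.
move=> tt; rewrite /sp_integral /sp_val.
under [RHS]eq_bigr do rewrite mulr_suml.
rewrite exchange_big/=; apply: eq_bigr => j _.
have E p := @grid_telescope _ theta T g N p (X ^~ omega) t gg.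
have := E _ (gH (mem_sp_nodes (ltn_ord j))) tt.
have := E _ (gH (mem_sp_nodes (ltnW (ltn_ord j)))) tt.
move=> e1 e2.
rewrite (_ : X (Num.min (sp_node H j.+1) t) omega - X (Num.min (sp_node H j) t) omega =
  (X (Num.min (sp_node H j.+1) t) omega - X theta omega) -
  (X (Num.min (sp_node H j) t) omega - X theta omega)); last by ring.
rewrite e1 e2 -sumrB mulr_sumr; apply: eq_bigr => k _.
rewrite indic_itvoc ?sp_node_le//; ring.
Qed.

(** All other terms cancel: those before step [j] are the same at both times, those after it are
    zero at both. *)
Lemma sp_integral_step (X : R -> Omega -> R) r omega j : theta <= r -> (j < N)%N ->
  sp_integral H X (Num.min (g j.+1) r) omega - sp_integral H X (Num.min (g j) r) omega =
  sp_val H (g j.+1) omega *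
    (X (Num.min (g j.+1) r) omega - X (Num.min (g j) r) omega).
Proof.
move=> tr jN; have [_ _ gS] := gg.
rewrite !sp_integral_grid; try by rewrite le_min (grid_ge _ gg).
rewrite -sumrB (bigD1 (Ordinal jN))//= big1 ?addr0 => [|k kj].
  have e1 : Num.min (g j.+1) (Num.min (g j.+1) r) = Num.min (g j.+1) r by rewrite minA minxx.
  have e2 : Num.min (g j) (Num.min (g j.+1) r) = Num.min (g j) r by rewrite minA (min_l (gS j)).
  have e3 : Num.min (g j.+1) (Num.min (g j) r) = Num.min (g j) r by rewrite minA (min_r (gS j)).
  have e4 : Num.min (g j) (Num.min (g j) r) = Num.min (g j) r by rewrite minA minxx.
  by rewrite e1 e2 e3 e4; ring.
have [kj'|jk] : (k < j)%N \/ (j < k)%N.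
  by apply/orP; rewrite -neq_ltn; apply: contra kj => /eqP h; apply/eqP/val_inj.
- have h1 : g k.+1 <= g j := grid_mono gg kj'.
  have h2 : g k <= g j := le_trans (gS k) h1.
  rewrite !minA (min_l h1) (min_l h2) (min_l (le_trans h1 (gS j))).
  by rewrite (min_l (le_trans h2 (gS j))) subrr.
- have h1 : g j.+1 <= g k := grid_mono gg jk.
  have h2 : g j.+1 <= g k.+1 := le_trans h1 (gS k).
  rewrite !minA (min_r h1) (min_r h2) (min_r (le_trans (gS j) h1)) (min_r (le_trans (gS j) h2)).
  by rewrite !subrr.
Qed.

(** Predictability: a node lying strictly before [g k.+1] is a grid point at most [g k], so the
    coefficient active on the step is already known at its left end. *)
Lemma sp_val_grid_meas k : measurable_wrt (F (g k)) (sp_val H (g k.+1)).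
Proof.
have [sF Fmono _ _] := F_filtration.
have [sFk _] := sF _ (grid_in k gg).
rewrite /sp_val; apply: (measurable_wrt_sum sFk) => j _.
have [inH|ninH] := boolP (g k.+1 \in `]sp_node H j, sp_node H j.+1]); last first.
  rewrite (_ : (fun _ => _) = fun=> 0); first exact: measurable_wrt_cst.
  by apply/funext => omega; rewrite indicE memNset ?mulr0//; apply/negP.
apply: (measurable_wrtM sFk); last exact: measurable_wrt_cst.
move: inH; rewrite in_itv/= => /andP[lt _].
have [i ei] := gH (mem_sp_nodes (ltnW (ltn_ord j))).
apply: (measurable_wrtS _ (sp_coef_meas (ltn_ord j))); apply: Fmono.
- by have := sp_node_in (ltnW (ltn_ord j)); rewrite in_itv/= => /andP[].
- rewrite ei; apply: (grid_mono gg); rewrite leqNgt; apply/negP => ki.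
  by move: lt; rewrite ei ltNge (grid_mono gg ki).
- exact: grid_le gg.
Qed.

Lemma sp_val_grid k s omega : g k < s -> s <= g k.+1 ->
  sp_val H s omega = sp_val H (g k.+1) omega.
Proof.
move=> gs sg; rewrite /sp_val; apply: eq_bigr => j _; congr (_ * _).
rewrite !indic_itvoc ?sp_node_le//.
suff E p : (exists i, p = g i) -> (s <= p) = (g k.+1 <= p).
  by rewrite !E//; apply: gH; apply: mem_sp_nodes => //; exact: ltnW.
move=> [i ->]; apply/idP/idP; last exact: le_trans.
move=> si; apply: (grid_mono gg); rewrite ltnNge; apply/negP => ik.
by have := lt_le_trans gs si; rewrite ltNge (grid_mono gg ik).
Qed.

End OnGrid.

Section Stopped.
Variable tau : Omega -> R.
Hypothesis tau_stopping : stopping_time theta T F tau.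

Definition alive (t : R) : Omega -> R := \1_[set omega | t < tau omega].

Lemma alive_measurable t : t \in `[theta, T] -> measurable_wrt (F t) (alive t).
Proof.
have [sF _ _ _] := F_filtration => tt; have [sFt _] := sF t tt.
apply: (measurable_wrt_indic sFt).
have := wrt_setC sFt (tau_stopping tt); congr (F t _).
by apply/seteqP; split=> omega /=; [move/negP; rewrite -ltNge|rewrite ltNge => /negP].
Qed.

Lemma aliveM s t omega : s <= t -> alive t omega = alive t omega * alive s omega.
Proof.
move=> st; rewrite /alive !indicE.
have [h|h] := boolP (omega \in [set omega | t < tau omega]); last by rewrite mul0r.
by rewrite mem_set ?mulr1//=; apply: le_lt_trans st _; rewrite inE in h.
Qed.

(** The processes of interest are specified up to [tau] only; multiplying by the indicator of
    [t < tau] removes the arbitrary values afterwards, and that indicator is itself known at time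
    [t]. *)
Definition known_before (X : R -> Omega -> R) := forall t, t \in `[theta, T] ->
  measurable_wrt (F t) (fun omega => alive t omega * X t omega).

Lemma known_before_adapted X : adapted theta T F X -> known_before X.
Proof.
move=> aX t tt; have [sF _ _ _] := F_filtration; have [sFt _] := sF t tt.
apply: (measurable_wrtM sFt); [exact: alive_measurable|exact: aX].
Qed.

Lemma known_before_stopped X :
  adapted theta T F (fun t omega => X (Num.min t (tau omega)) omega) -> known_before X.
Proof.
move=> aX t tt; have := known_before_adapted aX tt.
congr measurable_wrt; apply/funext => omega; rewrite /alive indicE.
have [h|h] := boolP (omega \in [set omega | t < tau omega]); last by rewrite !mul0r.
by rewrite min_l// ltW//; rewrite inE in h.
Qed.

Lemma known_beforeD X Y : known_before X -> known_before Y ->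
  known_before (fun t omega => X t omega + Y t omega).
Proof.
move=> kX kY t tt; have [sF _ _ _] := F_filtration; have [sFt _] := sF t tt.
have := measurable_wrtD sFt (kX t tt) (kY t tt).
by congr measurable_wrt; apply/funext => omega; rewrite mulrDr.
Qed.

Lemma known_beforeB X Y : known_before X -> known_before Y ->
  known_before (fun t omega => X t omega - Y t omega).
Proof.
move=> kX kY t tt; have [sF _ _ _] := F_filtration; have [sFt _] := sF t tt.
have := measurable_wrtB sFt (kX t tt) (kY t tt).
by congr measurable_wrt; apply/funext => omega; rewrite mulrBr.
Qed.

Lemma known_before_earlier X s t : known_before X ->
  theta <= s -> s <= t -> t <= T ->
  measurable_wrt (F t) (fun omega => alive t omega * X s omega).
Proof.
move=> kX ts st tT; have [sF Fmono _ _] := F_filtration.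
have tt : t \in `[theta, T] by rewrite in_itv/= tT (le_trans ts).
have ss : s \in `[theta, T] by rewrite in_itv/= ts (le_trans st).
have [sFt _] := sF t tt.
have := measurable_wrtM sFt (alive_measurable tt) (measurable_wrtS (Fmono s t ts st tT) (kX s ss)).
by congr measurable_wrt; apply/funext => omega; rewrite mulrA -aliveM.
Qed.

Lemma known_before_integral H X : known_before X -> known_before (sp_integral H X).
Proof.
move=> kX t tt; have [sF Fmono _ _] := F_filtration; have [sFt _] := sF t tt.
move: (tt); rewrite in_itv/= => /andP[thetat tT].
rewrite /sp_integral; under eq_fun do rewrite mulr_sumr.
apply: (measurable_wrt_sum sFt) => j _.
have := sp_node_in (ltnW (ltn_ord j)); have := sp_node_in (ltn_ord j).
rewrite !in_itv/= => /andP[a1 _] /andP[a0 _].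
(* A coefficient whose node is later than [t] need not be known at [t], but its increment is then
   zero. *)
have [jt|tj] := leP (sp_node H j) t; last first.
  rewrite (_ : (fun _ => _) = fun=> 0); first exact: measurable_wrt_cst.
  have tj' : t <= sp_node H j.+1 by apply: (le_trans (ltW tj)); exact: sp_node_le.
  by apply/funext => omega; rewrite (min_r tj') subrr !mulr0.
rewrite (_ : (fun _ => _) = fun omega => sp_coef H j omega *
   (alive t omega * X (Num.min (sp_node H j.+1) t) omega -
    alive t omega * X (sp_node H j) omega)); last by apply/funext => omega; ring.
apply: (measurable_wrtM sFt).
  by apply: (measurable_wrtS _ (sp_coef_meas (ltn_ord j))); exact: Fmono.
apply: (measurable_wrtB sFt); apply: known_before_earlier => //.
  by rewrite le_min a1 thetat.
by rewrite ge_min lexx orbT.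
Qed.

(** Limits in probability stay measurable because each [F t] contains the negligible sets. It
    supplies the measurability of [I], which [ito_integral] describes only as a limit. *)
Lemma known_before_limit X :
  (forall e : R, 0 < e -> exists2 X', known_before X' & off_event P e (fun omega =>
     forall t, t \in `[theta, tau omega] -> `|X' t omega - X t omega| <= e)) ->
  known_before X.
Proof.
move=> HX t tt; have [sF _ _ nF] := F_filtration; have [sFt _] := sF t tt.
apply: (measurable_wrt_limit sFt (nF t tt)) => e e0.
have [X' kX' oX'] := HX e e0; exists (fun omega => alive t omega * X' t omega); first exact: kX'.
apply: off_eventW oX' => // omega HE; rewrite /alive indicE.
have [h|h] := boolP (omega \in [set omega | t < tau omega]); last first.
  by rewrite !mul0r subrr normr0 ltW.
rewrite !mul1r; apply: HE; rewrite inE in h; move: tt; rewrite !in_itv/= => /andP[-> _] /=.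
exact: ltW.
Qed.

End Stopped.

End SimpleProcesses.

(** * Discrete quadratic expansion *)

Section DiscreteIto.
Context (R : realType).

Lemma ler_norm_sum_weight (N : nat) (t b : nat -> R) (c : R) :
  (forall k, (k < N)%N -> `|t k| <= c * b k) ->
  `|\sum_(k < N) t k| <= c * \sum_(k < N) b k.
Proof.
move=> H; apply: (le_trans (ler_norm_sum _ _ _)); rewrite mulr_sumr.
by apply: ler_sum => k _; exact: H.
Qed.

Variables (N : nat) (G C h a om dw dt dr : nat -> R).
Variables (eps L B C0 T0 kappa delta : R).
Hypotheses (L0 : 0 <= L) (B0 : 0 <= B) (k0 : 0 <= kappa).
Hypothesis G_le : forall k, (k < N)%N -> `|G k| <= eps.
Hypothesis C_le : forall k, (k < N)%N -> `|C k| <= C0.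
Hypothesis h_le : forall k, (k < N)%N -> `|h k| <= B.
Hypothesis a_le : forall k, (k < N)%N -> `|a k| <= L * dr k.
Hypothesis dr_le : forall k, (k < N)%N -> 0 <= dr k <= delta.
Hypothesis om_le : forall k, (k < N)%N -> `|om k| <= kappa.
Hypothesis dw_le : forall k, (k < N)%N -> `|dw k| <= kappa.
Hypothesis sum_dr : \sum_(k < N) dr k <= T0.
Hypothesis sum_dw : \sum_(k < N) `|dw k - om k| <= kappa.
Hypothesis sum_dt : \sum_(k < N) `|dt k - dr k| <= delta.
Hypotheses (eps0 : 0 <= eps) (C00 : 0 <= C0) (d0 : 0 <= delta).

(** [a k + h k * om k] is a stopped increment split into drift and Wiener parts. [om] and [dr] are
    the Wiener and time increments cut at the stopping time, [dw] and [dt] those over complete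
    active steps. Martingale arguments apply to the latter, so the sums are rewritten with them and
    the overshoot is charged to the remainder. *)
Lemma discrete_ito :
  `|\sum_(k < N) (2 * G k * (a k + h k * om k) + C k * (a k + h k * om k) ^+ 2)
    - \sum_(k < N) C k * h k ^+ 2 * dr k| <=
  2 * `|\sum_(k < N) G k * h k * dw k| +
  `|\sum_(k < N) C k * h k ^+ 2 * (dw k ^+ 2 - dt k)| +
  (2 * eps * L + C0 * L ^+ 2 * delta + 2 * C0 * L * B * kappa) * T0 +
  (2 * eps * B + 2 * C0 * B ^+ 2 * kappa) * kappa + C0 * B ^+ 2 * delta.
Proof.
(* [rest1] gathers the terms containing a drift increment, [rest2] the overshoot of the Wiener
   process, [rest3] that of time. *)
pose rest1 k := 2 * G k * a k + C k * a k ^+ 2 + 2 * C k * a k * h k * om k.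
pose rest2 k := - 2 * G k * h k * (dw k - om k)
  - C k * h k ^+ 2 * ((dw k + om k) * (dw k - om k)).
pose rest3 k := C k * h k ^+ 2 * (dt k - dr k).
have -> : \sum_(k < N) (2 * G k * (a k + h k * om k) + C k * (a k + h k * om k) ^+ 2)
    - \sum_(k < N) C k * h k ^+ 2 * dr k =
   2 * (\sum_(k < N) G k * h k * dw k) +
   \sum_(k < N) C k * h k ^+ 2 * (dw k ^+ 2 - dt k) +
   \sum_(k < N) rest1 k + \sum_(k < N) rest2 k + \sum_(k < N) rest3 k.
  rewrite mulr_sumr -sumrB -!big_split/=; apply: eq_bigr => k _.
  rewrite /rest1 /rest2 /rest3; ring.
have hC k : (k < N)%N -> `|C k * h k ^+ 2| <= C0 * B ^+ 2.
  move=> kN; rewrite normrM normrX ler_pM ?exprn_ge0 ?C_le//.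
  by rewrite lerXn2r ?nnegrE ?h_le.
have b1 : `|\sum_(k < N) rest1 k| <=
    (2 * eps * L + C0 * L ^+ 2 * delta + 2 * C0 * L * B * kappa) * T0.
  set K := _ + 2 * C0 * L * B * kappa.
  have K0 : 0 <= K by rewrite !addr_ge0// !mulr_ge0// exprn_ge0.
  apply: (@le_trans _ _ (K * \sum_(k < N) dr k)); last by rewrite ler_wpM2l.
  apply: ler_norm_sum_weight => k kN; rewrite /rest1 /K.
  have /andP[dr0 drd] := dr_le kN.
  apply: (le_trans (ler_normD _ _)); rewrite [leRHS]mulrDl; apply: lerD.
    apply: (le_trans (ler_normD _ _)); rewrite [leRHS]mulrDl; apply: lerD.
      rewrite !normrM (ger0_norm (x := 2))// -!mulrA ler_pM2l//.
      by apply: ler_pM => //; [exact: G_le|exact: a_le].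
    rewrite normrM normrX -!mulrA; apply: ler_pM => //; rewrite ?exprn_ge0 ?C_le//.
    apply: (@le_trans _ _ ((L * dr k) ^+ 2)).
      by rewrite lerXn2r ?nnegrE ?mulr_ge0// a_le.
    have -> : (L * dr k) ^+ 2 = L * (L * (dr k * dr k)) by ring.
    by do 2 rewrite ler_wpM2l//; rewrite ler_wpM2r.
  rewrite !normrM (ger0_norm (x := 2))//.
  have -> : 2 * C0 * L * B * kappa * dr k = 2 * C0 * (L * dr k) * B * kappa by ring.
  by do 3 (apply: ler_pM; rewrite ?mulr_ge0 ?a_le ?h_le ?om_le ?ler_pM2l ?C_le//).
have b2 : `|\sum_(k < N) rest2 k| <= (2 * eps * B + 2 * C0 * B ^+ 2 * kappa) * kappa.
  set K := _ + 2 * C0 * B ^+ 2 * kappa.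
  have K0 : 0 <= K by rewrite !addr_ge0// !mulr_ge0// exprn_ge0.
  apply: (@le_trans _ _ (K * \sum_(k < N) `|dw k - om k|)); last by rewrite ler_wpM2l.
  apply: (@ler_norm_sum_weight N rest2 (fun k => `|dw k - om k|)) => k kN; rewrite /rest2 /K.
  apply: (le_trans (ler_normB _ _)); rewrite [leRHS]mulrDl; apply: lerD.
    rewrite !normrM normrN (ger0_norm (x := 2))// ler_wpM2r//.
    by apply: ler_pM; rewrite ?mulr_ge0 ?h_le ?ler_pM2l ?G_le.
  rewrite [X in X <= _]normrM [X in _ * X]normrM mulrA ler_wpM2r//.
  have -> : 2 * C0 * B ^+ 2 * kappa = C0 * B ^+ 2 * (kappa + kappa) by ring.
  apply: ler_pM => //; first exact: hC.
  by apply: (le_trans (ler_normD _ _)); apply: lerD; [exact: dw_le|exact: om_le].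
have b3 : `|\sum_(k < N) rest3 k| <= C0 * B ^+ 2 * delta.
  have K0 : 0 <= C0 * B ^+ 2 by rewrite mulr_ge0// exprn_ge0.
  apply: (@le_trans _ _ (C0 * B ^+ 2 * \sum_(k < N) `|dt k - dr k|)); last by rewrite ler_wpM2l.
  apply: (@ler_norm_sum_weight N rest3 (fun k => `|dt k - dr k|)) => k kN.
  by rewrite /rest3 normrM ler_wpM2r// hC.
apply: (le_trans (ler_normD _ _)); apply: lerD => //.
apply: (le_trans (ler_normD _ _)); apply: lerD => //.
apply: (le_trans (ler_normD _ _)); apply: lerD => //.
apply: (le_trans (ler_normD _ _)); apply: lerD => //.
by rewrite normrM (ger0_norm (x := 2)).
Qed.

End DiscreteIto.

(** * The one grid step that straddles a given time *)

Section Overshoot.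
Context (R : realType) (g : nat -> R) (r : R).
Hypothesis g_nd : forall k, g k <= g k.+1.

Lemma sum_straddle N : \sum_(k < N) ((g k < r) && (r < g k.+1))%:R <= 1 :> R.
Proof.
(* Strengthened for the induction: no step among the first [N] can straddle [r] before the grid has
   passed [r]. *)
suff: \sum_(k < N) ((g k < r) && (r < g k.+1))%:R <= (r < g N)%R%:R :> R.
  by move=> /le_trans; apply; case: (r < g N) => //; exact: ler01.
elim: N => [|N IH]; first by rewrite big_ord0.
rewrite big_ord_recr/=; have [gr|rg] := ltP (g N) r => /=; last first.
  rewrite addr0; apply: (le_trans IH); rewrite ler_nat.
  have [h|//] := boolP (r < g N); by rewrite (lt_le_trans h (g_nd N)).
move: IH; rewrite ltNge (ltW gr)/= => IH.
by apply: (@le_trans _ _ (0 + (r < g N.+1)%R%:R)); [rewrite lerD2r|rewrite add0r].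
Qed.

Lemma sum_overshoot N (x : nat -> R) (kappa : R) : 0 <= kappa ->
  (forall k, (k < N)%N -> `|x k| <= kappa) ->
  (forall k, (k < N)%N -> ~~ ((g k < r) && (r < g k.+1)) -> x k = 0) ->
  \sum_(k < N) `|x k| <= kappa.
Proof.
move=> k0 xk x0.
apply: (@le_trans _ _ (kappa * \sum_(k < N) ((g k < r) && (r < g k.+1))%:R)).
  rewrite mulr_sumr; apply: ler_sum => k _.
  case: (boolP ((g k < r) && (r < g k.+1))) => h; last by rewrite x0// normr0 mulr0.
  by rewrite mulr1 xk.
by rewrite -[leRHS]mulr1 ler_wpM2l// sum_straddle.
Qed.

End Overshoot.

(** * Time integrals of step functions and their approximation *)

Section StepIntegral.
Context (R : realType).
Local Notation mu := (@lebesgue_measure R).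

Lemma integrable_bounded_itv (a b : R) (f : R -> R) (M : R) :
  measurable_fun `[a, b] f -> (forall x, x \in `[a, b] -> `|f x| <= M) ->
  mu.-integrable `[a, b] (EFin \o f).
Proof.
move=> mf fM; have mab : measurable `[a, b]%classic := measurable_itv `[a, b].
have ic : mu.-integrable `[a, b] (EFin \o (fun=> M)).
  apply: continuous_compact_integrable; first exact: segment_compact.
  by apply: continuous_subspaceT => x; exact: cvg_cst.
apply: (le_integrable _ _ _ ic) => //; first exact/measurable_EFinP.
by move=> x xab /=; rewrite lee_fin (le_trans (fM x xab))// ler_norm.
Qed.

Lemma Rintegral_itv_cst (a b c : R) : a <= b ->
  \int[mu]_(s in `]a, b]) c = c * (b - a).
Proof.
move=> ab; rewrite Rintegral_cst//; congr (_ * _).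
rewrite [X in fine X](_ : _ = mu `]a, b])// lebesgue_measure_itv/= lte_fin.
case: ltP => //= ba; have -> : b = a by apply/le_anti; rewrite ab ba.
by rewrite subrr.
Qed.

(** Stopping the grid at [r] makes later steps degenerate, so the sum may run over all [N] steps.
    The value of [phi] at [g 0] is free: it affects a null set only. *)
Lemma step_integral (g : nat -> R) (N : nat) (phi : R -> R) (r : R) :
  (forall k, g k <= g k.+1) -> g 0%N <= r -> r <= g N ->
  mu.-integrable `[g 0%N, r] (EFin \o phi) ->
  (forall k s, (k < N)%N -> g k < s -> s <= g k.+1 -> phi s = phi (g k.+1)) ->
  \int[mu]_(s in `[g 0%N, r]) phi s =
  \sum_(k < N) phi (g k.+1) * (Num.min (g k.+1) r - Num.min (g k) r).
Proof.
move=> gS g0r rN iphi Hphi.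
pose m k := Num.min (g k) r.
have mS k : m k <= m k.+1 by rewrite /m le_min2.
have m0 k : g 0%N <= m k.
  rewrite /m le_min g0r andbT; elim: k => // k IH; exact: le_trans IH (gS k).
have mr k : m k <= r by rewrite /m ge_min lexx orbT.
have int k : mu.-integrable `[g 0%N, m k] (EFin \o phi).
  apply: integrableS iphi => // s; rewrite /= !in_itv/= => /andP[-> h] /=.
  exact: le_trans h (mr k).
suff H n : (n <= N)%N -> \int[mu]_(s in `[g 0%N, m n]) phi s =
    \sum_(k < n) phi (g k.+1) * (m k.+1 - m k).
  by rewrite -(H N (leqnn N)) /m min_r.
elim: n => [_|n IH nN].
  rewrite big_ord0 /m min_l// set_itv1; exact: Rintegral_set1.
rewrite big_ord_recr/= -IH; last exact: ltnW.
apply/eqP; rewrite addrC -subr_eq; apply/eqP.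
have h1 : (BLeft (g 0%N) <= BRight (m n))%O by rewrite bnd_simp.
have h2 : (BRight (m n) <= BRight (m n.+1))%O by rewrite bnd_simp.
rewrite (Rintegral_itvB (int n.+1) h1 h2).
rewrite (@eq_Rintegral _ _ _ _ _ (fun=> phi (g n.+1))); first exact: Rintegral_itv_cst.
move=> s; rewrite inE/= in_itv/= /m gt_min le_min => /andP[/orP[gs|rs] /andP[sg sr]].
  exact: Hphi.
by have := lt_le_trans rs sr; rewrite ltxx.
Qed.

(* The weight [lambda] splits the cross term [2 b (h - b)] of [h ^ 2 - b ^ 2]. *)
Lemma sqr_product_dist (u v h U V b L eps : R) : 0 < eps -> eps <= 1 -> 0 <= L ->
  `|u - U| <= eps -> `|v - V| <= eps -> `|U| <= L -> `|V| <= L -> `|b| <= L ->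
  `|(u ^+ 2 + v ^+ 2) * h ^+ 2 - (U ^+ 2 + V ^+ 2) * b ^+ 2| <=
  2 * (L + 1) ^+ 2 * (1 + L / eps) * (h - b) ^+ 2 +
  (2 * (L + 1) ^+ 2 * L + 2 * (2 * L + 1) * L ^+ 2) * eps.
Proof.
move=> e0 e1 L0 uU vV UL VL bL.
have sq x X : `|x - X| <= eps -> `|X| <= L -> `|x ^+ 2 - X ^+ 2| <= (2 * L + 1) * eps.
  move=> xX XL; rewrite subr_sqr normrM mulrC; apply: ler_pM => //.
  rewrite (_ : x + X = (x - X) + 2 * X); last by ring.
  apply: (le_trans (ler_normD _ _)); rewrite normrM ger0_norm// addrC.
  by apply: lerD; [rewrite ler_pM2l|exact: le_trans e1].
have sq2 x X : `|x - X| <= eps -> `|X| <= L -> x ^+ 2 <= (L + 1) ^+ 2.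
  move=> xX XL; rewrite -real_normK ?num_real// lerXn2r ?nnegrE ?addr_ge0//.
  rewrite (_ : x = X + (x - X)); last by ring.
  by apply: (le_trans (ler_normD _ _)); apply: lerD => //; exact: le_trans e1.
have C1 : `|u ^+ 2 + v ^+ 2| <= 2 * (L + 1) ^+ 2.
  rewrite ger0_norm ?addr_ge0 ?sqr_ge0//.
  by have := sq2 _ _ uU UL; have := sq2 _ _ vV VL; lra.
have b2 : b ^+ 2 <= L ^+ 2 by rewrite -real_normK ?num_real// lerXn2r ?nnegrE.
have D1 : `|(u ^+ 2 + v ^+ 2) - (U ^+ 2 + V ^+ 2)| <= 2 * (2 * L + 1) * eps.
  rewrite (_ : _ - _ = (u ^+ 2 - U ^+ 2) + (v ^+ 2 - V ^+ 2)); last by ring.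
  apply: (le_trans (ler_normD _ _)).
  by have := sq _ _ uU UL; have := sq _ _ vV VL; lra.
have E1 : `|h ^+ 2 - b ^+ 2| <= (1 + L / eps) * (h - b) ^+ 2 + L * eps.
  rewrite (_ : h ^+ 2 - b ^+ 2 = (h - b) ^+ 2 + 2 * b * (h - b)); last by ring.
  apply: (le_trans (ler_normD _ _)); rewrite (ger0_norm (sqr_ge0 (h - b))).
  rewrite (_ : (1 + L / eps) * (h - b) ^+ 2 + L * eps =
    (h - b) ^+ 2 + (L / eps * (h - b) ^+ 2 + L * eps)); last by ring.
  rewrite lerD2l.
  rewrite !normrM (ger0_norm (x := 2))//.
  apply: (@le_trans _ _ (L * (2 * `|h - b|))).
    by rewrite (mulrC 2) -mulrA ler_wpM2r// mulr_ge0.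
  rewrite -mulrA -mulrDr ler_wpM2l// -[(h - b) ^+ 2]real_normK ?num_real//.
  set x := `|h - b|.
  (* Young's inequality [2 x <= x^2/eps + eps]. *)
  have : 0 <= (x - eps) ^+ 2 / eps by rewrite divr_ge0 ?sqr_ge0// ltW.
  have -> : (x - eps) ^+ 2 / eps = eps^-1 * x ^+ 2 - 2 * x + eps.
    by field; rewrite gt_eqF.
  lra.
rewrite (_ : _ - _ = (u ^+ 2 + v ^+ 2) * (h ^+ 2 - b ^+ 2) +
   ((u ^+ 2 + v ^+ 2) - (U ^+ 2 + V ^+ 2)) * b ^+ 2); last by ring.
apply: (le_trans (ler_normD _ _)); rewrite normrM [X in _ + X]normrM (ger0_norm (sqr_ge0 b)).
have h1 := ler_pM (normr_ge0 _) (normr_ge0 _) C1 E1.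
have h2 := ler_pM (normr_ge0 _) (sqr_ge0 b) D1 b2.
apply: (le_trans (lerD h1 h2)); rewrite le_eqVlt; apply/orP; left; apply/eqP; ring.
Qed.

(** [u] and [v] are uniformly close, but [h] only in mean square; the hypothesis [eps^2] on its
    distance absorbs the factor [1/eps] of the pointwise estimate. Closeness is asked on []a, r]]
    because simple processes vanish at the initial time. The bound [B] does not survive in the
    conclusion. *)
Lemma integral_sqr_product_dist (a r : R) (u v h U V b : R -> R) (B L eps : R) :
  a <= r -> 0 < eps -> eps <= 1 -> 0 <= L ->
  measurable_fun `[a, r] u -> measurable_fun `[a, r] v -> measurable_fun `[a, r] h ->
  measurable_fun `[a, r] U -> measurable_fun `[a, r] V -> measurable_fun `[a, r] b ->
  (forall s, s \in `[a, r] -> [/\ `|u s| <= B, `|v s| <= B & `|h s| <= B]) ->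
  (forall s, s \in `[a, r] -> [/\ `|U s| <= L, `|V s| <= L & `|b s| <= L]) ->
  (forall s, s \in `]a, r] -> `|u s - U s| <= eps /\ `|v s - V s| <= eps) ->
  \int[mu]_(s in `[a, r]) ((h s - b s) ^+ 2) <= eps ^+ 2 ->
  `|\int[mu]_(s in `[a, r]) ((u s ^+ 2 + v s ^+ 2) * h s ^+ 2) -
    \int[mu]_(s in `[a, r]) ((U s ^+ 2 + V s ^+ 2) * b s ^+ 2)| <=
  (2 * (L + 1) ^+ 2 * (eps + L) +
   (2 * (L + 1) ^+ 2 * L + 2 * (2 * L + 1) * L ^+ 2) * (r - a)) * eps.
Proof.
move=> ar e0 e1 L0 mU1 mV1 mh mU mV mb bB bL close hb.
have prod_bnd (x y z K : R) : `|x| <= K -> `|y| <= K -> `|z| <= K ->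
    `|(x ^+ 2 + y ^+ 2) * z ^+ 2| <= 2 * K ^+ 2 * K ^+ 2.
  move=> xK yK zK; rewrite normrM ler_pM//.
    rewrite mulr_natl mulr2n; apply: (le_trans (ler_normD _ _)).
    by apply: lerD; rewrite normrX lerXn2r// nnegrE (le_trans _ xK).
  by rewrite normrX lerXn2r// nnegrE (le_trans _ zK).
have iuv : mu.-integrable `[a, r] (EFin \o (fun s => (u s ^+ 2 + v s ^+ 2) * h s ^+ 2)).
  apply: (@integrable_bounded_itv _ _ _ (2 * B ^+ 2 * B ^+ 2)).
    by apply: measurable_funM; [apply: measurable_funD|]; exact: measurable_funX.
  by move=> s /bB[h1 h2 h3]; exact: prod_bnd.
have iUV : mu.-integrable `[a, r] (EFin \o (fun s => (U s ^+ 2 + V s ^+ 2) * b s ^+ 2)).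
  apply: (@integrable_bounded_itv _ _ _ (2 * L ^+ 2 * L ^+ 2)).
    by apply: measurable_funM; [apply: measurable_funD|]; exact: measurable_funX.
  by move=> s /bL[h1 h2 h3]; exact: prod_bnd.
have ihb : mu.-integrable `[a, r] (EFin \o (fun s => (h s - b s) ^+ 2)).
  apply: (@integrable_bounded_itv _ _ _ ((B + L) ^+ 2)).
    by apply: measurable_funX; exact: measurable_funB.
  move=> s sar; have [_ _ hB] := bB s sar; have [_ _ bbL] := bL s sar.
  rewrite normrX lerXn2r ?nnegrE ?addr_ge0 ?(le_trans _ hB)//.
  by apply: (le_trans (ler_normB _ _)); exact: lerD.
set K1 := 2 * (L + 1) ^+ 2 * (1 + L / eps).
set K2 := 2 * (L + 1) ^+ 2 * L + 2 * (2 * L + 1) * L ^+ 2.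
have sub : `]a, r]%classic `<=` `[a, r]%classic.
  by move=> s; rewrite /= !in_itv/= => /andP[/ltW -> ->].
have mar : measurable (`]a, r]%classic : set (measurableTypeR R)) := measurable_itv `]a, r].
have mar' : measurable (`[a, r]%classic : set (measurableTypeR R)) := measurable_itv `[a, r].
rewrite -RintegralB//.
have iD := integrableB mar' iuv iUV.
have iD' := integrableS mar' mar sub iD.
have ihb' := integrableS mar' mar sub ihb.
have iK1 := integrableZl mar K1 ihb'.
have iK2 : mu.-integrable `]a, r] (EFin \o (fun=> K2 * eps)).
  apply: (integrableS mar' mar sub).
  apply: continuous_compact_integrable; first exact: segment_compact.
  by apply: continuous_subspaceT => x; exact: cvg_cst.
rewrite -Rintegral_itv_obnd_cbnd; last exact: iD'.
apply: (le_trans (le_normr_Rintegral mar iD')).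
apply: (@le_trans _ _ (\int[mu]_(s in `]a, r]) (K1 * (h s - b s) ^+ 2 + K2 * eps))).
  apply: le_Rintegral => //.
  - exact: (integrable_norm iD').
  - exact: (integrableD mar iK1 iK2).
  - move=> s sar; have [uU vV] := close s sar.
    by have [UL VL bbL] := bL s (sub _ sar); exact: sqr_product_dist.
rewrite RintegralD// RintegralZl// Rintegral_itv_cst//.
rewrite Rintegral_itv_obnd_cbnd; last exact: ihb'.
have K10 : 0 <= K1.
  by rewrite /K1 mulr_ge0 ?mulr_ge0 ?sqr_ge0 ?addr_ge0 ?divr_ge0// ltW.
apply: (@le_trans _ _ (K1 * eps ^+ 2 + K2 * eps * (r - a))).
  by rewrite lerD2r ler_wpM2l.
rewrite le_eqVlt; apply/orP; left; apply/eqP; rewrite /K1 /K2.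
by field; rewrite gt_eqF.
Qed.

End StepIntegral.

(** * Uniformly continuous paths *)

Section Paths.
Context (R : realType).
Implicit Types (f : R -> R) (a b : R).

(** An epsilon-delta form, stable under stopping, whose [delta] can be compared with the mesh of a
    grid. *)
Definition uniformly_continuous_on a b f :=
  forall e : R, 0 < e -> exists2 delta : R, 0 < delta &
  forall s t, s \in `[a, b] -> t \in `[a, b] -> `|s - t| <= delta -> `|f s - f t| <= e.

(** Heine's theorem, through the near-covering form of compactness: the halved radius serves both
    the moving point and its neighbour. *)
Lemma within_continuous_uniformly a b f :
  {within `[a, b], continuous f} -> uniformly_continuous_on a b f.
Proof.
move=> /subspace_continuousP cf e e0.
have e20 : 0 < e / 2 by rewrite divr_gt0.
have := @segment_compact R a b; move/compact_near_coveringP.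
move=> /(_ R (0^'+) (fun delta x => forall t, x \in `[a, b] -> t \in `[a, b] ->
  `|x - t| <= delta -> `|f x - f t| <= e) _) [].
  move=> x xab; have /cvgrPdist_lt /(_ _ e20) := cf x xab.
  rewrite near_withinE => /nbhs_ballP[d /= d0 Hd].
  exists (ball x (d / 2), [set delta | delta < d / 2]) => /=.
    split; first by apply: nbhsx_ballx; rewrite divr_gt0.
    by apply: nbhs_right_lt; rewrite divr_gt0.
  move=> [x' delta] /= [xx' dd] t x'ab tab x't.
  have h1 : `|f x - f x'| < e / 2.
    by apply: Hd => //; apply: lt_le_trans xx' _; rewrite ler_pdivrMr// ler_peMr ?ler1n// ltW.
  have h2 : `|f x - f t| < e / 2.
    apply: Hd => //; rewrite /ball/= (_ : x - t = (x - x') + (x' - t)); last by ring.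
    apply: (le_lt_trans (ler_normD _ _)); move: xx' dd x't; rewrite /ball/=; lra.
  rewrite (_ : f x' - f t = - (f x - f x') + (f x - f t)); last by ring.
  by apply: (le_trans (ler_normD _ _)); rewrite normrN; lra.
move=> d /= d0 Hd; exists (d / 2); first by rewrite divr_gt0.
move=> s t sab tab st; apply: (Hd (d / 2)) => //=; last by rewrite divr_gt0.
by rewrite sub0r normrN ger0_norm ?divr_ge0 ?ltW//; lra.
Qed.

Lemma uniformly_continuous_within a b f :
  uniformly_continuous_on a b f -> {within `[a, b], continuous f}.
Proof.
move=> uf; apply/subspace_continuousP => x xab; apply/cvgrPdist_le => e e0.
have [d d0 Hd] := uf e e0; rewrite near_withinE; apply/nbhs_ballP; exists d => //= t xt tab.
by apply: Hd => //; exact: ltW.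
Qed.

Lemma uniformly_continuous_bounded a b f :
  uniformly_continuous_on a b f -> exists M, forall s, s \in `[a, b] -> `|f s| <= M.
Proof.
move=> /uniformly_continuous_within cf.
have /compact_bounded[M [_ mrt]] := continuous_compact cf (@segment_compact _ a b).
exists (M + 1) => s sab; apply: (mrt (M + 1)); first by rewrite ltrDl.
by exists s.
Qed.

Lemma uniformly_continuous_stopped a b c f : a <= c -> uniformly_continuous_on a c f ->
  uniformly_continuous_on a b (fun t => f (Num.min t c)).
Proof.
move=> ac uf e e0; have [d d0 Hd] := uf e e0; exists d => // s t.
rewrite !in_itv/= => /andP[a1 _] /andP[b1 _] st; apply: Hd.
- by rewrite in_itv/= le_min a1 ac ge_min lexx orbT.
- by rewrite in_itv/= le_min b1 ac ge_min lexx orbT.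
- apply: le_trans st; case: (leP s c) => h1; case: (leP t c) => h2 //.
  + by rewrite !ler0_norm; lra.
  + by rewrite !ger0_norm; lra.
  + by rewrite subrr normr0.
Qed.

Lemma uniformly_continuous_measurable a b f :
  uniformly_continuous_on a b f -> measurable_fun `[a, b] f.
Proof.
move=> /uniformly_continuous_within cf.
by apply: subspace_continuous_measurable_fun => //; exact: measurable_itv.
Qed.

(** A countable dense sequence of the segment: the enumerated rationals, with 0 for the codes of
    none, pushed into [[a, b]]. *)
Definition dense_point a b (n : nat) : R :=
  Num.max a (Num.min b (ratr (odflt 0 (unpickle n)))).

Lemma dense_point_in a b n : a <= b -> dense_point a b n \in `[a, b].
Proof. by move=> ab; rewrite in_itv/= /dense_point le_max lexx/= ge_max ab ge_min lexx. Qed.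

Lemma dense_pointP a b s delta : a <= b -> s \in `[a, b] -> 0 < delta ->
  exists n, `|s - dense_point a b n| <= delta.
Proof.
move=> ab; rewrite in_itv/= => /andP[sa sb] d0.
have [q] := @rat_in_itvoo R (s - delta) (s + delta) ltac:(lra).
rewrite in_itv/= => /andP[q1 q2]; exists (pickle q).
rewrite /dense_point pickleK/=; move: (ratr q) q1 q2 => x x1 x2.
rewrite ler_norml; case: (leP b x) => h1; [case: (leP a b)|case: (leP a x)] => h2; lra.
Qed.

End Paths.

(** * Deterministic bounds for random continuous paths off small events *)

Section PathEvents.
Context d (Omega : measurableType d) (R : realType) (P : probability Omega R).
Variables (a b : R) (Z : R -> Omega -> R).
Hypothesis ab : a <= b.
Hypothesis mZ : forall t, t \in `[a, b] -> measurable_fun setT (Z t).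
Hypothesis cZ : {ae P, forall omega, uniformly_continuous_on a b (Z ^~ omega)}.

Let c := dense_point a b.
Let cab n : c n \in `[a, b]. Proof. exact: dense_point_in. Qed.

(** Bounds at the points of a countable dense set form measurable events that increase with [n] and
    exhaust almost every path; continuity extends them to the segment, at the cost of adding 1. *)
Lemma path_bounded_off (p : R) : 0 < p -> exists2 L : R, 0 < L &
  off_event P p (fun omega => forall s, s \in `[a, b] -> `|Z s omega| <= L).
Proof.
move=> p0; have [||||n Hn] := @off_event_monotone _ _ _ P
  (fun n omega => forall k, `|Z (c k) omega| <= n%:R) _ _ _ p => //.
- move=> n; rewrite (_ : [set _ | _] = \bigcap_k [set omega | `|Z (c k) omega| <= n%:R]).
    apply: bigcapT_measurable => k.
    have := measurableT_comp (@normr_measurable R setT) (mZ (cab k)).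
    move=> /(_ measurableT `]-oo, n%:R]%classic (measurable_itv _)); rewrite setTI.
    by congr measurable.
  by apply/seteqP; split=> [omega H k _|omega H k]; exact: H.
- by move=> n omega H k; apply: (le_trans (H k)); rewrite ler_nat.
- apply: filterS cZ => omega /uniformly_continuous_bounded[M HM].
  exists (Num.truncn M).+1 => k; apply: (le_trans (HM _ (cab k))).
  exact: ltW (truncnS_gt _).
have H0 := off_eventI Hn (ae_off_event cZ); rewrite addr0 in H0.
exists (n%:R + 1); first by rewrite ltr_wpDl.
apply: off_eventW H0 => // omega [Q uZ] s sab.
have [dl dl0 Hd] := uZ 1 ltr01; have [k Hk] := dense_pointP ab sab dl0.
have h1 := Q k; have h2 := Hd _ _ sab (cab k) Hk.
rewrite (_ : Z s omega = Z (c k) omega + (Z s omega - Z (c k) omega)); last by ring.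
by apply: (le_trans (ler_normD _ _)); exact: lerD.
Qed.

Lemma path_oscillation_off (kappa p : R) : 0 < kappa -> 0 < p -> exists2 delta : R, 0 < delta &
  off_event P p (fun omega => forall s t, s \in `[a, b] -> t \in `[a, b] ->
     `|s - t| <= delta -> `|Z s omega - Z t omega| <= kappa).
Proof.
move=> k0 p0; have k30 : 0 < kappa / 3 by rewrite divr_gt0.
have [||||n Hn] := @off_event_monotone _ _ _ P
  (fun n omega => forall i j, `|c i - c j| <= n.+1%:R^-1 ->
     `|Z (c i) omega - Z (c j) omega| <= kappa / 3) _ _ _ p => //.
- move=> n; rewrite (_ : [set _ | _] = \bigcap_i \bigcap_j
      [set omega | `|c i - c j| <= n.+1%:R^-1 ->
         `|Z (c i) omega - Z (c j) omega| <= kappa / 3]).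
    apply: bigcapT_measurable => i; apply: bigcapT_measurable => j.
    have [h|h] := boolP (`|c i - c j| <= n.+1%:R^-1); last first.
      by rewrite (_ : [set _ | _] = setT)//; apply/seteqP; split.
    have := measurableT_comp (@normr_measurable R setT)
      (measurable_funB (mZ (cab i)) (mZ (cab j))).
    move=> /(_ measurableT `]-oo, kappa / 3]%classic (measurable_itv _)); rewrite setTI.
    congr measurable; apply/seteqP; split=> omega /=; rewrite in_itv/=; last exact.
    by move=> ->.
  by apply/seteqP; split=> [omega H i _ j _|omega H i j]; exact: H.
- move=> n omega H i j h; apply: H; apply: (le_trans h).
  by rewrite lef_pV2 ?posrE// ler_nat.
- apply: filterS cZ => omega /(_ _ k30)[dl dl0 Hd].
  exists (Num.truncn dl^-1) => i j h; apply: Hd => //; apply: (le_trans h).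
  by rewrite invf_ple ?posrE// ltW// truncnS_gt.
have H0 := off_eventI Hn (ae_off_event cZ); rewrite addr0 in H0.
have n0 : 0 < n.+1%:R^-1 :> R by rewrite invr_gt0.
(* One third for [|s - t|] and one for each move to a dense point, so that the two dense points are
   within [1/(n+1)]; the oscillation [kappa] is shared in the same way. *)
exists (n.+1%:R^-1 / 3); first by rewrite divr_gt0.
apply: off_eventW H0 => // omega [Q uZ] s t sab tab st.
have [dl dl0 Hd] := uZ _ k30.
pose dl' := Num.min dl (n.+1%:R^-1 / 3).
have dl'0 : 0 < dl' by rewrite lt_min dl0 divr_gt0.
have [i Hi] := dense_pointP ab sab dl'0; have [j Hj] := dense_pointP ab tab dl'0.
move: Hi Hj; rewrite /dl' !le_min => /andP[i1 i2] /andP[j1 j2].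
have h1 := Hd _ _ sab (cab i) i1; have h2 := Hd _ _ tab (cab j) j1.
have h3 : `|Z (c i) omega - Z (c j) omega| <= kappa / 3.
  apply: Q; rewrite (_ : c i - c j = - (s - c i) + (s - t) + (t - c j)); last by ring.
  apply: (le_trans (ler_normD _ _)); apply: (le_trans (lerD (ler_normD _ _) (lexx _))).
  rewrite normrN /c; move: i2 j2 st; move: (n.+1%:R^-1) => z; lra.
rewrite (_ : Z s omega - Z t omega = (Z s omega - Z (c i) omega) +
  (Z (c i) omega - Z (c j) omega) - (Z t omega - Z (c j) omega)); last by ring.
apply: (le_trans (ler_normB _ _)); apply: (le_trans (lerD (ler_normD _ _) (lexx _))).
by move: h1 h2 h3; lra.
Qed.

End PathEvents.

(** * Pathwise estimate of the squared modulus *)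

Section SimpleIntegralFacts.
Context d (Omega : measurableType d) (R : realType) (theta T : R) (F : R -> set (set Omega)).
Implicit Type H : simple_process theta T F.

Lemma sp_integralD H (X Z : R -> Omega -> R) t omega :
  sp_integral H (fun s o => X s o + Z s o) t omega =
  sp_integral H X t omega + sp_integral H Z t omega.
Proof. by rewrite /sp_integral -big_split/=; apply: eq_bigr => k _; ring. Qed.

Lemma sp_val_measurable H omega : measurable_fun setT (fun s => sp_val H s omega).
Proof.
by rewrite /sp_val; apply: measurable_sum => k; apply: measurable_funM.
Qed.

End SimpleIntegralFacts.

Lemma Rintegral_ge0_subset (R : realType) (A B : set R) (f : R -> R) (c : R) :
  measurable A -> measurable B -> A `<=` B -> measurable_fun B f ->
  (forall x, 0 <= f x) ->
  (\int[@lebesgue_measure R]_(s in B) (f s)%:E <= c%:E)%E ->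
  \int[@lebesgue_measure R]_(s in A) f s <= c.
Proof.
move=> mA mB AB mf f0 Hc.
have h : (\int[@lebesgue_measure R]_(s in A) (f s)%:E <= c%:E)%E.
  apply: le_trans Hc; apply: ge0_subset_integral => //.
    exact/measurable_EFinP.
  by move=> x _; rewrite lee_fin.
rewrite /Rintegral -lee_fin fineK// ge0_fin_numE; last first.
  by apply: integral_ge0 => x _; rewrite lee_fin.
by apply: (le_lt_trans h); rewrite ltry.
Qed.

Lemma sqr_le_norm (R : realType) (x K : R) : `|x| <= K -> x ^+ 2 <= K ^+ 2.
Proof.
by move=> h; rewrite -real_normK ?num_real// lerXn2r// nnegrE// (le_trans _ h).
Qed.

(** The square of [1 + B] dominates 1, [B] and [B^2], so a single smallness condition yields
    three. *)
Lemma le_mul_square_shift (R : realType) (x B e : R) : 0 <= B -> 0 <= x ->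
  x * (1 + B) ^+ 2 <= e -> [/\ B * x <= e, B ^+ 2 * x <= e & x <= e].
Proof.
move=> B0 x0; have h := mulr_ge0 B0 x0; have h' := mulr_ge0 B0 h.
rewrite (_ : x * (1 + B) ^+ 2 = x + 2 * (B * x) + B * (B * x)); last by ring.
rewrite (_ : B ^+ 2 * x = B * (B * x)); last by ring.
by move: (B * (B * x)) (B * x) h h' => p q h h' H; split; lra.
Qed.

(** The sum of the error constants: the first two lines come from [discrete_ito], the next two from
    [integral_sqr_product_dist], and the final [8 * (L + 1)] from replacing two squares by those of
    their approximations. It is free of [B], which grows as [eps] shrinks. *)
Definition path_error (R : realType) (L T0 : R) : R :=
  (16 * (L + 1) * L + 2 * (L + 1) ^+ 2 * L ^+ 2 + 4 * (L + 1) ^+ 2 * L) * T0 +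
  (16 * (L + 1) + 6 * (L + 1) ^+ 2) +
  (2 * (L + 1) ^+ 2 * (1 + L) +
   (2 * (L + 1) ^+ 2 * L + 2 * (2 * L + 1) * L ^+ 2) * T0) + 8 * (L + 1).

Lemma path_error_le (R : realType) (L B eps kappa delta rho T0 : R) :
  0 <= L -> 0 <= B -> 0 <= eps -> eps <= 1 -> 0 <= kappa -> 0 <= delta ->
  0 <= rho -> rho <= T0 ->
  B * kappa <= eps -> B ^+ 2 * kappa <= eps -> kappa <= eps ->
  B ^+ 2 * delta <= eps -> delta <= eps ->
  (2 * (8 * eps * (L + 1)) * L + 2 * (L + 1) ^+ 2 * L ^+ 2 * delta +
    2 * (2 * (L + 1) ^+ 2) * L * B * kappa) * T0 +
  (2 * (8 * eps * (L + 1)) * B + 2 * (2 * (L + 1) ^+ 2) * B ^+ 2 * kappa) * kappa +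
  2 * (L + 1) ^+ 2 * B ^+ 2 * delta +
  (2 * (L + 1) ^+ 2 * (eps + L) +
   (2 * (L + 1) ^+ 2 * L + 2 * (2 * L + 1) * L ^+ 2) * rho) * eps +
  8 * eps * (L + 1) <= path_error L T0 * eps.
Proof.
move=> L0 B0 e0 e1 k0 d0 r0 rT Bk B2k ke B2d de.
have T0' : 0 <= T0 := le_trans r0 rT.
pose C := (L + 1) ^+ 2; pose K2 := 2 * C * L + 2 * (2 * L + 1) * L ^+ 2.
have C0 : 0 <= C by exact: sqr_ge0.
have M0 : 0 <= L + 1 by rewrite addr_ge0.
have K20 : 0 <= K2 by rewrite /K2 addr_ge0 ?mulr_ge0 ?addr_ge0 ?exprn_ge0// mulr_ge0.
have h1 : C * L ^+ 2 * T0 * delta <= C * L ^+ 2 * T0 * eps.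
  by rewrite ler_wpM2l// !mulr_ge0// sqr_ge0.
have h2 : C * L * T0 * (B * kappa) <= C * L * T0 * eps by rewrite ler_wpM2l// !mulr_ge0.
have h3 : (L + 1) * (eps * (B * kappa)) <= (L + 1) * eps.
  by rewrite ler_wpM2l// ler_piMr// (le_trans Bk).
have h4 : C * (B ^+ 2 * kappa * kappa) <= C * eps.
  rewrite ler_wpM2l//; apply: le_trans B2k; rewrite ler_piMr ?(le_trans ke)//.
  by rewrite mulr_ge0// sqr_ge0.
have h5 : C * (B ^+ 2 * delta) <= C * eps by rewrite ler_wpM2l.
have h6 : C * (eps * eps) <= C * eps by rewrite ler_wpM2l// ler_piMr.
have h7 : K2 * rho * eps <= K2 * T0 * eps by rewrite ler_wpM2r// ler_wpM2l.
rewrite -/C -/K2.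
rewrite (_ : path_error L T0 * eps = 16 * (L + 1) * L * T0 * eps +
  2 * (C * L ^+ 2 * T0 * eps) + 4 * (C * L * T0 * eps) + 16 * ((L + 1) * eps) +
  6 * (C * eps) + 2 * (C * eps) + 2 * C * L * eps + K2 * T0 * eps + 8 * (L + 1) * eps);
  last by rewrite /path_error /K2 /C; ring.
rewrite [leLHS](_ : _ = 16 * (L + 1) * L * T0 * eps +
  2 * (C * L ^+ 2 * T0 * delta) + 4 * (C * L * T0 * (B * kappa)) +
  16 * ((L + 1) * (eps * (B * kappa))) + 4 * (C * (B ^+ 2 * kappa * kappa)) +
  2 * (C * (B ^+ 2 * delta)) + 2 * (C * (eps * eps)) + 2 * C * L * eps +
  K2 * rho * eps + 8 * (L + 1) * eps); last by ring.
clearbody C K2; lra.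
Qed.

Section PathEstimate.
Context d (Omega : measurableType d) (R : realType).
Variables (theta T : R) (F : R -> set (set Omega)).
Local Notation mu := (@lebesgue_measure R).
Variables (X1 X2 H1 H2 J1 J2 y a b I w : R -> Omega -> R) (tau : Omega -> R).
Variables (U V H : simple_process theta T F) (g : nat -> R) (N : nat) (t : R).

Definition stopped_at (omega : Omega) := Num.min t (tau omega).

(* [y] with its martingale part replaced by the integral of a simple process. *)
Definition approx_y s omega := y s omega + (sp_integral H w s omega - I s omega).

(** Integration is along [approx_y] rather than [y], so that each grid increment is exactly a simple
    value times a drift integral plus a simple value times a Wiener increment. *)
Definition approx_X (X : R -> Omega -> R) (W : simple_process theta T F) s omega :=
  X theta omega + sp_integral W approx_y s omega.

(** Marks the steps that begin before stopping and are not degenerate: the smallness of the first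
    order coefficient is read off at a time of the step later than [g k]. *)
Definition act k (omega : Omega) : R :=
  (g k < g k.+1)%R%:R * alive stopped_at (g k) omega.

(** Half the first order coefficient of the squared modulus in the increment of [approx_y], frozen
    at the left end. It approximates [X1 H1 + X2 H2], which is zero. *)
Definition drift_coef k omega := act k omega *
  (approx_X X1 U (g k) omega * sp_val U (g k.+1) omega +
   approx_X X2 V (g k) omega * sp_val V (g k.+1) omega).

Definition quad_coef k omega := act k omega *
  (sp_val U (g k.+1) omega ^+ 2 + sp_val V (g k.+1) omega ^+ 2).

(** * The deterministic estimate along one fixed path *)

Variables (omega : Omega) (L B eps kappa delta iota K e1 : R).
Let r := stopped_at omega.
Let m k := Num.min (g k) r.

Hypothesis theta_le_T : theta <= T.
Hypothesis gg : grid theta T g N.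
Hypothesis g_mesh : forall k, g k.+1 - g k <= delta.
Hypothesis gU : {in sp_nodes U, forall p, exists j, p = g j}.
Hypothesis gV : {in sp_nodes V, forall p, exists j, p = g j}.
Hypothesis gH : {in sp_nodes H, forall p, exists j, p = g j}.
Hypothesis t_in : t \in `[theta, T].
Hypothesis tau_in : theta < tau omega <= T.
Hypotheses (L0 : 0 <= L) (B0 : 0 <= B) (eps0 : 0 < eps) (eps1 : eps <= 1).
Hypotheses (kappa0 : 0 <= kappa) (kappa_le : kappa * (1 + B) ^+ 2 <= eps).
Hypotheses (delta0 : 0 <= delta) (delta_le : delta * (1 + B) ^+ 2 <= eps).
Hypothesis bounds : forall s, s \in `[theta, tau omega] ->
  [/\ `|X1 s omega| <= L /\ `|X2 s omega| <= L,
      `|H1 s omega| <= L /\ `|H2 s omega| <= L, `|a s omega| <= L & `|b s omega| <= L].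
Hypothesis orth : forall s, s \in `[theta, tau omega] ->
  X1 s omega * H1 s omega + X2 s omega * H2 s omega = 0.
Hypothesis eqX1 : forall s, s \in `[theta, tau omega] ->
  X1 s omega = X1 theta omega + J1 s omega.
Hypothesis eqX2 : forall s, s \in `[theta, tau omega] ->
  X2 s omega = X2 theta omega + J2 s omega.
Hypothesis eqy : forall s, s \in `[theta, tau omega] ->
  y s omega = y theta omega + \int[mu]_(s in `[theta, s]) a s omega + I s omega.
Hypothesis int_a : mu.-integrable `[theta, tau omega] (EFin \o a ^~ omega).
Hypothesis cX1 : uniformly_continuous_on theta (tau omega) (X1 ^~ omega).
Hypothesis cX2 : uniformly_continuous_on theta (tau omega) (X2 ^~ omega).
Hypothesis closeU : forall s, s \in `]theta, tau omega] ->
  `|sp_val U s omega - H1 s omega| <= eps.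
Hypothesis closeV : forall s, s \in `]theta, tau omega] ->
  `|sp_val V s omega - H2 s omega| <= eps.
Hypothesis closeJ1 : forall s, s \in `[theta, tau omega] ->
  `|sp_integral U y s omega - J1 s omega| <= eps.
Hypothesis closeJ2 : forall s, s \in `[theta, tau omega] ->
  `|sp_integral V y s omega - J2 s omega| <= eps.
Hypothesis closeI : forall s, s \in `[theta, tau omega] ->
  `|sp_integral H w s omega - I s omega| <= iota.
Hypothesis boundU : forall (Z : R -> Omega -> R) (c s : R), theta <= s ->
  (forall s', s' \in `[theta, s] -> `|Z s' omega| <= c) ->
  `|sp_integral U Z s omega| <= K * c.
Hypothesis boundV : forall (Z : R -> Omega -> R) (c s : R), theta <= s ->
  (forall s', s' \in `[theta, s] -> `|Z s' omega| <= c) ->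
  `|sp_integral V Z s omega| <= K * c.
Hypothesis K_iota : K * iota <= eps.
Hypothesis val_bound : forall s,
  [/\ `|sp_val U s omega| <= B, `|sp_val V s omega| <= B & `|sp_val H s omega| <= B].
Hypothesis closeH :
  (\int[mu]_(s in `[theta, tau omega]) ((sp_val H s omega - b s omega) ^+ 2)%:E
     <= (eps ^+ 2)%:E)%E.
Hypothesis mH1 : measurable_fun `[theta, tau omega] (H1 ^~ omega).
Hypothesis mH2 : measurable_fun `[theta, tau omega] (H2 ^~ omega).
Hypothesis mb : measurable_fun `[theta, tau omega] (b ^~ omega).
Hypothesis osc : forall s s', s \in `[theta, T] -> s' \in `[theta, T] ->
  `|s - s'| <= delta -> `|w s omega - w s' omega| <= kappa.

Let gS k : g k <= g k.+1. Proof. by case: gg. Qed.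
Let g0 : g 0%N = theta. Proof. by case: gg. Qed.
Let gth k : theta <= g k. Proof. exact: grid_ge gg. Qed.
Let gT k : g k <= T. Proof. exact: grid_le gg. Qed.

Let r_ge : theta <= r.
Proof.
move: t_in tau_in; rewrite in_itv/= => /andP[t1 _] /andP[t2 _].
by rewrite /r /stopped_at le_min t1 ltW.
Qed.

Let r_le : r <= tau omega. Proof. by rewrite /r /stopped_at ge_min lexx orbT. Qed.
Let r_leT : r <= T. Proof. by case/andP: tau_in => _; exact: le_trans. Qed.

Let m_in k : m k \in `[theta, tau omega].
Proof. by rewrite in_itv/= /m le_min gth r_ge/= ge_min r_le orbT. Qed.

Let m_inT k : m k \in `[theta, T].
Proof. by rewrite in_itv/= /m le_min gth r_ge/= ge_min gT. Qed.

Let mS k : m k <= m k.+1. Proof. by rewrite /m le_min2. Qed.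

(** One [eps] is the distance of the simple integral along [y] from its limit; the other bounds the
    integral along the small difference of martingale parts, by [K * iota]. *)
Lemma approx_X_close s : s \in `[theta, tau omega] ->
  `|approx_X X1 U s omega - X1 s omega| <= 2 * eps /\
  `|approx_X X2 V s omega - X2 s omega| <= 2 * eps.
Proof.
move=> sin; have := sin; rewrite in_itv/= => /andP[s1 s2].
have sub s' : s' \in `[theta, s] -> s' \in `[theta, tau omega].
  by rewrite !in_itv/= => /andP[-> h]; rewrite (le_trans h).
have hz s' : s' \in `[theta, s] ->
  `|(fun s o => sp_integral H w s o - I s o) s' omega| <= iota.
  by move=> /sub; exact: closeI.
rewrite /approx_X (eqX1 sin) (eqX2 sin) /approx_y; split.
  rewrite sp_integralD (_ : _ - _ = (sp_integral U y s omega - J1 s omega) +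
    sp_integral U (fun s o => sp_integral H w s o - I s o) s omega); last by ring.
  apply: (le_trans (ler_normD _ _)); rewrite mulr_natl mulr2n; apply: lerD; first exact: closeJ1.
  by apply: le_trans K_iota; exact: (boundU s1 hz).
rewrite sp_integralD (_ : _ - _ = (sp_integral V y s omega - J2 s omega) +
  sp_integral V (fun s o => sp_integral H w s o - I s o) s omega); last by ring.
apply: (le_trans (ler_normD _ _)); rewrite mulr_natl mulr2n; apply: lerD; first exact: closeJ2.
by apply: le_trans K_iota; exact: (boundV s1 hz).
Qed.

Lemma act_cases k : act k omega = 0 \/ [/\ act k omega = 1, g k < g k.+1 & g k < r].
Proof.
rewrite /act /alive indicE; have [h|h] := boolP (g k < g k.+1); last by left; rewrite mul0r.
have [h'|h'] := boolP (omega \in [set o | g k < stopped_at o]); last by left; rewrite mulr0.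
by right; split=> //; rewrite ?mulr1//; rewrite inE in h'.
Qed.

Lemma act_neq1 k : act k omega = 0 -> r <= g k \/ g k = g k.+1.
Proof.
rewrite /act /alive indicE; have [h|h] := ltP (g k) (g k.+1); last first.
  by move=> _; right; apply/le_anti; rewrite gS h.
rewrite mul1r; have [h'|h'] := ltP (g k) r; last by left.
by rewrite mem_set// => /eqP; rewrite oner_eq0.
Qed.

Lemma act_m k : act k omega = 0 -> m k.+1 = m k.
Proof.
move=> /act_neq1[h|h]; last by rewrite /m h.
by rewrite /m !min_r// (le_trans h).
Qed.

(** The approximate coefficient is compared with [X1 H1 + X2 H2 = 0] at a time [s] just after [g k].
    Each product is off by at most [3 eps (L + 1) + L eps], hence the 8. *)
Lemma coef_bounds k : `|drift_coef k omega| <= 8 * eps * (L + 1) /\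
  `|quad_coef k omega| <= 2 * (L + 1) ^+ 2.
Proof.
rewrite /drift_coef /quad_coef; case: (act_cases k) => [->|[-> gk gr]].
  by rewrite !mul0r normr0; split; rewrite !mulr_ge0 ?exprn_ge0 ?addr_ge0// ltW.
rewrite !mul1r; set u := sp_val U _ _; set v := sp_val V _ _.
have gin : g k \in `[theta, tau omega] by rewrite in_itv/= gth ltW// (lt_le_trans gr).
have [d1 d10 Hd1] := cX1 eps0; have [d2 d20 Hd2] := cX2 eps0.
(* The simple values on the step approximate [H1] and [H2] only after [g k], while [approx_X] is
   taken at [g k]. The continuity of [X1] and [X2] closes the gap, so none is asked of [H1] and
   [H2]. *)
pose s := Num.min (m k.+1) (g k + Num.min d1 d2).
have gs : g k < s.
  have gm : g k < m k.+1 by rewrite /m lt_min gk gr.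
  by rewrite /s lt_min gm/= ltrDl lt_min d10 d20.
have sm : s <= m k.+1 by rewrite /s ge_min lexx.
have sg : s <= g k.+1 by apply: (le_trans sm); rewrite /m ge_min lexx.
have sr : s <= r by apply: (le_trans sm); rewrite /m ge_min lexx orbT.
have sin : s \in `[theta, tau omega].
  by rewrite in_itv/= (le_trans sr r_le) andbT (le_trans (gth k))// ltW.
have sin' : s \in `]theta, tau omega].
  by rewrite in_itv/= (le_trans sr r_le) andbT (le_lt_trans (gth k)).
have sgd : `|s - g k| <= Num.min d1 d2.
  by rewrite ger0_norm ?subr_ge0 ?(ltW gs)// lerBlDl /s ge_min lexx orbT.
move: sgd; rewrite le_min => /andP[sd1 sd2].
have hX1 := Hd1 _ _ sin gin sd1; have hX2 := Hd2 _ _ sin gin sd2.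
have [[bX1 bX2] [bH1 bH2] _ _] := bounds sin.
have cu : `|u - H1 s omega| <= eps.
  by rewrite /u -(sp_val_grid gg gU omega gs sg); exact: closeU.
have cv : `|v - H2 s omega| <= eps.
  by rewrite /v -(sp_val_grid gg gV omega gs sg); exact: closeV.
have [x1 x2] := approx_X_close gin.
have bu : `|u| <= L + 1.
  rewrite (_ : u = H1 s omega + (u - H1 s omega)); last by ring.
  by apply: (le_trans (ler_normD _ _)); apply: lerD => //; exact: le_trans eps1.
have bv : `|v| <= L + 1.
  rewrite (_ : v = H2 s omega + (v - H2 s omega)); last by ring.
  by apply: (le_trans (ler_normD _ _)); apply: lerD => //; exact: le_trans eps1.
split; last first.
  rewrite ger0_norm ?addr_ge0 ?sqr_ge0//.
  have h z : `|z| <= L + 1 -> z ^+ 2 <= (L + 1) ^+ 2.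
    by move=> zL; rewrite -real_normK ?num_real// lerXn2r ?nnegrE ?addr_ge0.
  by rewrite mulr_natl mulr2n; apply: lerD; exact: h.
have half (X XX W : R) z (Xs : R) : `|XX - X| <= 2 * eps -> `|Xs - X| <= eps -> `|Xs| <= L ->
    `|z| <= L + 1 -> `|z - W| <= eps -> `|XX * z - Xs * W| <= 3 * eps * (L + 1) + L * eps.
  move=> e1' e2 e3 e4 e5.
  rewrite (_ : XX * z - Xs * W = ((XX - X) - (Xs - X)) * z + Xs * (z - W)); last by ring.
  apply: (le_trans (ler_normD _ _)); apply: lerD; last by rewrite normrM ler_pM.
  rewrite normrM ler_pM//; apply: (le_trans (ler_normB _ _)).
  by rewrite (_ : 3 * eps = 2 * eps + eps); [exact: lerD|ring].
have h1 := half _ _ _ _ _ x1 hX1 bX1 bu cu; have h2 := half _ _ _ _ _ x2 hX2 bX2 bv cv.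
rewrite (_ : approx_X X1 U (g k) omega * u + approx_X X2 V (g k) omega * v =
   (approx_X X1 U (g k) omega * u - X1 s omega * H1 s omega) +
   (approx_X X2 V (g k) omega * v - X2 s omega * H2 s omega)); last first.
  by have := orth sin => h; rewrite -[LHS]subr0 -h; ring.
apply: (le_trans (ler_normD _ _)); apply: (le_trans (lerD h1 h2)).
have : 0 <= eps by exact: ltW.
lra.
Qed.

Let dr k := m k.+1 - m k.
Let hh k := sp_val H (g k.+1) omega.
Let om k := w (m k.+1) omega - w (m k) omega.
Let aa k := \int[mu]_(s in `]m k, m k.+1]) a s omega.
Let dw k := act k omega * (w (g k.+1) omega - w (g k) omega).
Let dt k := act k omega * (g k.+1 - g k).

Lemma approx_y_step k : (k < N)%N ->
  approx_y (m k.+1) omega - approx_y (m k) omega = aa k + hh k * om k.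
Proof.
move=> kN; rewrite /approx_y (eqy (m_in k.+1)) (eqy (m_in k)).
have <- := sp_integral_step gg gH w omega r_ge kN; rewrite -/(m k.+1) -/(m k).
have iak : mu.-integrable `[theta, m k.+1] (EFin \o a ^~ omega).
  apply: integrableS int_a; [exact: measurable_itv|exact: measurable_itv|].
  move=> s; rewrite /= !in_itv/= => /andP[-> h] /=; apply: (le_trans h).
  by have := m_in k.+1; rewrite in_itv/= => /andP[].
have h1 : (BLeft theta <= BRight (m k))%O.
  by rewrite bnd_simp; have := m_in k; rewrite in_itv/= => /andP[].
have h2 : (BRight (m k) <= BRight (m k.+1))%O by rewrite bnd_simp.
have := Rintegral_itvB iak h1 h2; rewrite -/(aa k) => <-; ring.
Qed.

Lemma drift_increment_le k : `|aa k| <= L * dr k.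
Proof.
have sub : `]m k, m k.+1]%classic `<=` `[theta, tau omega]%classic.
  have := m_in k; have := m_in k.+1; rewrite !in_itv/= => /andP[_ h1] /andP[h2 _] s.
  by rewrite /= !in_itv/= => /andP[h3 h4]; rewrite (le_trans h2 (ltW h3)) (le_trans h4 h1).
have mI : measurable (`]m k, m k.+1]%classic : set (measurableTypeR R)) := measurable_itv _.
have ia : mu.-integrable `]m k, m k.+1] (EFin \o a ^~ omega).
  by apply: integrableS int_a => //; exact: measurable_itv.
apply: (le_trans (le_normr_Rintegral mI ia)).
rewrite -(Rintegral_itv_cst L (mS k)); apply: le_Rintegral => //.
- exact: (integrable_norm ia).
- apply: (@integrableS _ _ _ mu `[m k, m k.+1]%classic) => //.
  + by move=> s; rewrite /= !in_itv/= => /andP[/ltW -> ->].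
  + apply: continuous_compact_integrable; first exact: segment_compact.
    by apply: continuous_subspaceT => x; exact: cvg_cst.
- by move=> s /sub sin; have [_ _] := bounds sin.
Qed.

(** An exact identity: on each step [x] moves by [u d], and the square by [2 x u d + u^2 d^2].
    Inactive steps have zero increment. *)
Lemma approx_sqr_telescope :
  approx_X X1 U r omega ^+ 2 + approx_X X2 V r omega ^+ 2
    - (X1 theta omega ^+ 2 + X2 theta omega ^+ 2) =
  \sum_(k < N) (2 * drift_coef k omega * (aa k + hh k * om k)
    + quad_coef k omega * (aa k + hh k * om k) ^+ 2).
Proof.
pose Q s := approx_X X1 U s omega ^+ 2 + approx_X X2 V s omega ^+ 2.
have mN : m N = r by rewrite /m; case: gg => _ -> // _; rewrite min_r.
have m0 : m 0%N = theta by rewrite /m g0 min_l.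
(* All nodes are at least [theta], so simple integrals start at 0. *)
have sp0 (W : simple_process theta T F) Z : sp_integral W Z theta omega = 0.
  rewrite /sp_integral big1// => k _.
  have nd j : (j <= sp_size W)%N -> Num.min (sp_node W j) theta = theta.
    by move=> jn; rewrite min_r//; have := sp_node_in jn; rewrite in_itv/= => /andP[].
  by rewrite !nd ?subrr ?mulr0// ltnW.
transitivity (Q (m N) - Q (m 0%N)).
  by rewrite mN m0 /Q /approx_X !sp0 !addr0.
rewrite -(telescope_sumr (fun k => Q (m k)))// big_mkord; apply: eq_bigr => k _.
rewrite -approx_y_step// /Q.
have step X (W : simple_process theta T F) : {in sp_nodes W, forall p, exists j, p = g j} ->
    approx_X X W (m k.+1) omega = approx_X X W (m k) omega +
    sp_val W (g k.+1) omega * (approx_y (m k.+1) omega - approx_y (m k) omega).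
  move=> gW; rewrite /approx_X.
  have := sp_integral_step gg gW approx_y omega r_ge (ltn_ord k); rewrite -/(m _) -/(m _) => <-.
  ring.
rewrite (step _ _ gU) (step _ _ gV) /drift_coef /quad_coef.
case: (act_cases k) => [a0|[-> gk gr]].
  by rewrite a0 (act_m a0) subrr !mul0r !mulr0; ring.
have -> : m k = g k by rewrite /m min_l// ltW.
by rewrite !mul1r; ring.
Qed.

Lemma no_straddle k : ~~ ((g k < r) && (r < g k.+1)) -> dw k = om k /\ dt k = dr k.
Proof.
rewrite /dw /om /dt /dr; case: (act_cases k) => [a0|[-> gk gr]].
  by rewrite a0 (act_m a0) !subrr !mul0r.
rewrite gr/= -leNgt => gr'; rewrite !mul1r.
by rewrite /m (min_l gr') (min_l (ltW gr)).
Qed.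

Lemma grid_step_le k : 0 <= dr k <= delta.
Proof.
rewrite /dr subr_ge0 mS/=; apply: (le_trans _ (g_mesh k)); rewrite /m.
case: (leP (g k.+1) r) => h1; case: (leP (g k) r) => h2.
- by [].
- by have := lt_le_trans h2 (le_trans (gS k) h1); rewrite ltxx.
- by rewrite lerD2r ltW.
- by rewrite subrr subr_ge0.
Qed.

Let gin k : g k \in `[theta, T]. Proof. by rewrite in_itv/= gth gT. Qed.

Let g_close k : `|g k.+1 - g k| <= delta.
Proof. by rewrite ger0_norm ?subr_ge0. Qed.

Lemma brownian_step_le k : `|om k| <= kappa /\ `|dw k| <= kappa.
Proof.
split.
  apply: osc => //; have /andP[h1 h2] := grid_step_le k; by rewrite ger0_norm.
rewrite /dw; case: (act_cases k) => [->|[-> _ _]]; first by rewrite mul0r normr0.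
by rewrite mul1r; apply: osc.
Qed.

Lemma sum_brownian_overshoot : \sum_(k < N) `|dw k - om k| <= kappa.
Proof.
apply: (@sum_overshoot _ g r gS N (fun k => dw k - om k)) => // k _; last first.
  by move=> /no_straddle[-> _]; rewrite subrr.
have [/andP[gr rg]|ns] := boolP ((g k < r) && (r < g k.+1)); last first.
  by have [-> _] := no_straddle ns; rewrite subrr normr0.
rewrite /dw /om; case: (act_cases k) => [/act_neq1[h|h]|[-> _ _]].
- by move: gr; rewrite ltNge h.
- by have := lt_trans gr rg; rewrite h ltxx.
rewrite mul1r /m (min_l (ltW gr)) (min_r (ltW rg)).
(* On the straddling step the overshoot is the Wiener increment from [r] to the next grid point,
   which may lie beyond [tau]. *)
rewrite (_ : _ - _ = w (g k.+1) omega - w r omega); last by ring.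
apply: osc => //; first by rewrite in_itv/= r_ge.
rewrite ger0_norm ?subr_ge0 ?(ltW rg)//.
by apply: le_trans (g_mesh k); rewrite lerD2l lerN2 (ltW gr).
Qed.

Lemma sum_time_overshoot : \sum_(k < N) `|dt k - dr k| <= delta.
Proof.
apply: (@sum_overshoot _ g r gS N (fun k => dt k - dr k)) => // k _; last first.
  by move=> /no_straddle[_ ->]; rewrite subrr.
have /andP[h1 h2] := grid_step_le k.
have h3 : 0 <= dt k <= delta.
  rewrite /dt; case: (act_cases k) => [->|[-> _ _]]; first by rewrite mul0r lexx.
  by rewrite mul1r subr_ge0 gS g_mesh.
by case/andP: h3 => h3 h4; rewrite ler_norml; lra.
Qed.

Lemma sum_time_step : \sum_(k < N) dr k = r - theta.
Proof.
have := telescope_sumr m (leq0n N); rewrite big_mkord /dr => ->.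
by rewrite /m g0 (min_l r_ge); case: gg => _ -> // _; rewrite min_r.
Qed.

Let BD : [/\ B * kappa <= eps, B ^+ 2 * kappa <= eps & kappa <= eps].
Proof. exact: le_mul_square_shift. Qed.

Let DD : [/\ B * delta <= eps, B ^+ 2 * delta <= eps & delta <= eps].
Proof. exact: le_mul_square_shift. Qed.

Let sub_r : `[theta, r]%classic `<=` `[theta, tau omega]%classic.
Proof. by move=> s; rewrite /= !in_itv/= => /andP[-> h]; rewrite (le_trans h r_le). Qed.

Let mI : measurable (`[theta, r]%classic : set (measurableTypeR R)).
Proof. exact: measurable_itv. Qed.

Let restrict_meas (f : R -> R) : measurable_fun `[theta, tau omega] f ->
  measurable_fun `[theta, r] f.
Proof. by move=> mf; exact: measurable_funS sub_r mf. Qed.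

Lemma val_integral_le :
  \int[mu]_(s in `[theta, r]) ((sp_val H s omega - b s omega) ^+ 2) <= eps ^+ 2.
Proof.
apply: Rintegral_ge0_subset closeH => //.
  apply: measurable_funX; apply: measurable_funB => //.
  by apply: measurable_funTS; exact: sp_val_measurable.
by move=> s; exact: sqr_ge0.
Qed.

Lemma sum_step_integral (phi : R -> R) (M : R) :
  (forall k s, g k < s -> s <= g k.+1 -> phi s = phi (g k.+1)) ->
  measurable_fun setT phi -> (forall s, `|phi s| <= M) ->
  \sum_(k < N) phi (g k.+1) * dr k = \int[mu]_(s in `[theta, r]) phi s.
Proof.
move=> Hphi mphi Mphi; have iphi : mu.-integrable `[g 0%N, r] (EFin \o phi).
  by apply: (@integrable_bounded_itv _ _ _ _ M) => //; exact: measurable_funTS.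
have rN : r <= g N by case: gg => _ ->.
have g0r : g 0%N <= r by rewrite g0.
by rewrite -g0 (step_integral gS g0r rN iphi)// => k s _; exact: Hphi.
Qed.

Let val_step k s : g k < s -> s <= g k.+1 ->
  [/\ sp_val U s omega = sp_val U (g k.+1) omega,
      sp_val V s omega = sp_val V (g k.+1) omega &
      sp_val H s omega = sp_val H (g k.+1) omega].
Proof.
move=> gs sg; split; [exact: (sp_val_grid gg gU)|exact: (sp_val_grid gg gV)|
  exact: (sp_val_grid gg gH)].
Qed.

(** The mean square of the simple integrand is at most [2 + 2 L^2 (T - theta)], by closeness to [b],
    and the overshoot adds at most 1. The coefficients [c] are left general so that a clamped
    version of [drift_coef] can be used. *)
Lemma total_variance_le (c : nat -> R) :
  (forall k, `|c k| <= 8 * eps * (L + 1)) -> (forall k, act k omega = 0 -> c k = 0) ->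
  \sum_(k < N) (c k * hh k) ^+ 2 * (g k.+1 - g k) <=
  (8 * eps * (L + 1)) ^+ 2 * (3 + 2 * L ^+ 2 * (T - theta)).
Proof.
move=> c_le c0; set e8 := 8 * eps * (L + 1).
have e80 : 0 <= e8 by rewrite !mulr_ge0 ?addr_ge0// ltW.
apply: (@le_trans _ _ (e8 ^+ 2 * \sum_(k < N) hh k ^+ 2 * dt k)).
  rewrite mulr_sumr; apply: ler_sum => k _; rewrite /dt.
  case: (act_cases k) => [a0|[-> _ _]].
    by rewrite a0 (c0 _ a0) !mul0r expr0n/= mul0r mulr0 mulr0.
  rewrite mul1r exprMn -mulrA ler_wpM2r//.
    by rewrite mulr_ge0 ?sqr_ge0 ?subr_ge0.
  exact: sqr_le_norm (c_le k).
rewrite ler_wpM2l ?sqr_ge0//.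
have h_le s : `|sp_val H s omega| <= B by have [] := val_bound s.
have hh2 k : 0 <= hh k ^+ 2 <= B ^+ 2.
  by rewrite sqr_ge0/=; exact: sqr_le_norm (h_le _).
have e1' : \sum_(k < N) hh k ^+ 2 * dt k <= \sum_(k < N) hh k ^+ 2 * dr k + B ^+ 2 * delta.
  rewrite -lerBlDl -sumrB.
  apply: (@le_trans _ _ (B ^+ 2 * \sum_(k < N) `|dt k - dr k|)); last first.
    by rewrite ler_wpM2l ?sqr_ge0// sum_time_overshoot.
  rewrite mulr_sumr; apply: ler_sum => k _; rewrite -mulrBr.
  have /andP[q0 qB] := hh2 k; apply: (@le_trans _ _ (hh k ^+ 2 * `|dt k - dr k|)).
    by rewrite ler_wpM2l// ler_norm.
  by rewrite ler_wpM2r.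
have e2' : \sum_(k < N) hh k ^+ 2 * dr k <= 2 + 2 * L ^+ 2 * (T - theta).
  rewrite (@sum_step_integral (fun s => sp_val H s omega ^+ 2) (B ^+ 2)); last 3 first.
  - by move=> k s gs sg; have [_ _ ->] := val_step gs sg.
  - by apply: measurable_funX; exact: sp_val_measurable.
  - by move=> s; rewrite normrX lerXn2r// nnegrE.
  have mh : measurable_fun `[theta, r] (fun s => sp_val H s omega).
    by apply: measurable_funTS; exact: sp_val_measurable.
  have mb' := restrict_meas mb.
  have bb s : s \in `[theta, r] -> `|b s omega| <= L.
    by move=> sin; have [_ _ _] := bounds (sub_r sin).
  have i1 : mu.-integrable `[theta, r] (EFin \o (fun s => sp_val H s omega ^+ 2)).
    apply: (@integrable_bounded_itv _ _ _ _ (B ^+ 2)); first exact: measurable_funX.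
    by move=> s _; rewrite normrX lerXn2r// nnegrE.
  have i2 : mu.-integrable `[theta, r]
      (EFin \o (fun s => (sp_val H s omega - b s omega) ^+ 2)).
    apply: (@integrable_bounded_itv _ _ _ _ ((B + L) ^+ 2)).
      by apply: measurable_funX; exact: measurable_funB.
    move=> s sin; rewrite normrX lerXn2r ?nnegrE ?addr_ge0//.
    by apply: (le_trans (ler_normB _ _)); apply: lerD => //; exact: bb.
  have ic : mu.-integrable `[theta, r] (EFin \o (fun=> 2 * L ^+ 2)).
    apply: continuous_compact_integrable; first exact: segment_compact.
    by apply: continuous_subspaceT => x; exact: cvg_cst.
  have i22 := integrableZl mI 2 i2.
  apply: (@le_trans _ _ (\int[mu]_(s in `[theta, r])
      (2 * (sp_val H s omega - b s omega) ^+ 2 + 2 * L ^+ 2))).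
    apply: le_Rintegral => //; first exact: (integrableD mI i22 ic).
    move=> s sin; have : b s omega ^+ 2 <= L ^+ 2.
      exact: sqr_le_norm (bb _ sin).
    (* The inequality [h^2 <= 2 (h - b)^2 + 2 b^2] is [(h - 2 b)^2 >= 0]. *)
    have := sqr_ge0 (sp_val H s omega - 2 * b s omega); nra.
  rewrite RintegralD// RintegralZl//.
  have -> : \int[mu]_(_ in `[theta, r]) (2 * L ^+ 2) = 2 * L ^+ 2 * (r - theta).
    rewrite -Rintegral_itv_cst// Rintegral_itv_obnd_cbnd//.
    by apply: integrableS ic => // s; rewrite /= !in_itv/= => /andP[/ltW -> ->].
  have := val_integral_le; have L2 : 0 <= L ^+ 2 by exact: sqr_ge0.
  have := ler_wpM2l L2 (lerB r_leT (lexx theta)).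
  have : eps ^+ 2 <= 1 by rewrite exprn_ile1// ltW.
  lra.
have [_ h1 _] := DD; apply: (le_trans e1'); apply: (le_trans (lerD e2' (le_trans h1 eps1))).
by rewrite le_eqVlt; apply/orP; left; apply/eqP; ring.
Qed.

(** The two hypotheses are the only probabilistic input: a martingale transform, which enters twice,
    and a sum of compensated squares, which enters once; hence [3 * e1]. *)
Lemma path_estimate :
  `|\sum_(k < N) drift_coef k omega * hh k * (w (g k.+1) omega - w (g k) omega)| <= e1 ->
  `|\sum_(k < N) quad_coef k omega * hh k ^+ 2 *
     ((w (g k.+1) omega - w (g k) omega) ^+ 2 - (g k.+1 - g k))| <= e1 ->
  `|X1 r omega ^+ 2 + X2 r omega ^+ 2 - (X1 theta omega ^+ 2 + X2 theta omega ^+ 2) -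
    \int[mu]_(s in `[theta, r]) ((H1 s omega ^+ 2 + H2 s omega ^+ 2) * b s omega ^+ 2)| <=
  3 * e1 + path_error L (T - theta) * eps.
Proof.
move=> T2 T5; have [kB kB2 ke] := BD; have [_ dB2 de] := DD.
have e0 : 0 <= eps := ltW eps0.
have e80 : 0 <= 8 * eps * (L + 1) by rewrite !mulr_ge0// addr_ge0.
have C00 : 0 <= 2 * (L + 1) ^+ 2 by rewrite mulr_ge0// sqr_ge0.
have rT : r - theta <= T - theta by rewrite lerD2r.
have r0 : 0 <= r - theta by rewrite subr_ge0.
have disc : `|\sum_(k < N) (2 * drift_coef k omega * (aa k + hh k * om k)
      + quad_coef k omega * (aa k + hh k * om k) ^+ 2)
    - \sum_(k < N) quad_coef k omega * hh k ^+ 2 * dr k| <=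
  2 * `|\sum_(k < N) drift_coef k omega * hh k * dw k| +
  `|\sum_(k < N) quad_coef k omega * hh k ^+ 2 * (dw k ^+ 2 - dt k)| +
  (2 * (8 * eps * (L + 1)) * L + 2 * (L + 1) ^+ 2 * L ^+ 2 * delta +
    2 * (2 * (L + 1) ^+ 2) * L * B * kappa) * (T - theta) +
  (2 * (8 * eps * (L + 1)) * B + 2 * (2 * (L + 1) ^+ 2) * B ^+ 2 * kappa) * kappa +
  2 * (L + 1) ^+ 2 * B ^+ 2 * delta.
  apply: (@discrete_ito R N (drift_coef ^~ omega) (quad_coef ^~ omega) hh aa om dw dt dr
    (8 * eps * (L + 1)) L B (2 * (L + 1) ^+ 2) (T - theta) kappa delta) => //.
  - by move=> k _; have [] := coef_bounds k.
  - by move=> k _; have [] := coef_bounds k.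
  - by move=> k _; have [_ _] := val_bound (g k.+1).
  - by move=> k _; exact: drift_increment_le.
  - by move=> k _; exact: grid_step_le.
  - by move=> k _; have [] := brownian_step_le k.
  - by move=> k _; have [] := brownian_step_le k.
  - by rewrite sum_time_step.
  - exact: sum_brownian_overshoot.
  - exact: sum_time_overshoot.
rewrite -approx_sqr_telescope in disc.
have E1 : \sum_(k < N) drift_coef k omega * hh k * dw k =
    \sum_(k < N) drift_coef k omega * hh k * (w (g k.+1) omega - w (g k) omega).
  apply: eq_bigr => k _; rewrite /dw; case: (act_cases k) => [a0|[-> _ _]].
    by rewrite /drift_coef a0 !mul0r.
  by rewrite mul1r.
have E2 : \sum_(k < N) quad_coef k omega * hh k ^+ 2 * (dw k ^+ 2 - dt k) =
    \sum_(k < N) quad_coef k omega * hh k ^+ 2 *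
     ((w (g k.+1) omega - w (g k) omega) ^+ 2 - (g k.+1 - g k)).
  apply: eq_bigr => k _; rewrite /dw /dt; case: (act_cases k) => [a0|[-> _ _]].
    by rewrite /quad_coef a0 !mul0r.
  by rewrite !mul1r.
have uB s : `|sp_val U s omega| <= B by have [] := val_bound s.
have vB s : `|sp_val V s omega| <= B by have [] := val_bound s.
have hB s : `|sp_val H s omega| <= B by have [] := val_bound s.
have E3 : \sum_(k < N) quad_coef k omega * hh k ^+ 2 * dr k =
    \int[mu]_(s in `[theta, r])
      ((sp_val U s omega ^+ 2 + sp_val V s omega ^+ 2) * sp_val H s omega ^+ 2).
  rewrite -(@sum_step_integral (fun s => (sp_val U s omega ^+ 2 + sp_val V s omega ^+ 2) *
      sp_val H s omega ^+ 2) (2 * B ^+ 2 * B ^+ 2)).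
  - apply: eq_bigr => k _; rewrite /quad_coef; case: (act_cases k) => [a0|[-> _ _]].
      by rewrite /dr (act_m a0) subrr !mulr0.
    by rewrite mul1r.
  - by move=> k s gs sg; have [-> -> ->] := val_step gs sg.
  - by apply: measurable_funM; [apply: measurable_funD|]; apply: measurable_funX;
      exact: sp_val_measurable.
  - move=> s; rewrite ger0_norm; last by rewrite mulr_ge0 ?addr_ge0 ?sqr_ge0.
    apply: ler_pM; rewrite ?addr_ge0 ?sqr_ge0//; last exact: sqr_le_norm.
    by rewrite mulr_natl mulr2n; apply: lerD; exact: sqr_le_norm.
have sub' s : s \in `]theta, r] -> s \in `]theta, tau omega].
  by rewrite !in_itv/= => /andP[-> h]; rewrite (le_trans h).
have cmp := @integral_sqr_product_dist R theta r (fun s => sp_val U s omega)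
  (fun s => sp_val V s omega) (fun s => sp_val H s omega) (H1 ^~ omega) (H2 ^~ omega)
  (b ^~ omega) B L eps r_ge eps0 eps1 L0
  (measurable_funTS (@sp_val_measurable _ _ _ _ _ _ U omega))
  (measurable_funTS (@sp_val_measurable _ _ _ _ _ _ V omega))
  (measurable_funTS (@sp_val_measurable _ _ _ _ _ _ H omega))
  (restrict_meas mH1) (restrict_meas mH2) (restrict_meas mb)
  (fun s _ => val_bound s).
have {}cmp := cmp _ _ val_integral_le.
have {}cmp : `|\int[mu]_(s in `[theta, r])
      ((sp_val U s omega ^+ 2 + sp_val V s omega ^+ 2) * sp_val H s omega ^+ 2) -
    \int[mu]_(s in `[theta, r]) ((H1 s omega ^+ 2 + H2 s omega ^+ 2) * b s omega ^+ 2)| <=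
  (2 * (L + 1) ^+ 2 * (eps + L) +
   (2 * (L + 1) ^+ 2 * L + 2 * (2 * L + 1) * L ^+ 2) * (r - theta)) * eps.
  apply: cmp.
  - by move=> s sin; have [_ [h1 h2] _ h3] := bounds (sub_r sin).
  - by move=> s /sub' sin; split; [exact: closeU|exact: closeV].
have rin : r \in `[theta, tau omega] by rewrite in_itv/= r_ge.
have sqd (x X : R) : `|x - X| <= 2 * eps -> `|X| <= L ->
    `|X ^+ 2 - x ^+ 2| <= 4 * eps * (L + 1).
  move=> h1 h2; rewrite distrC subr_sqr normrM (_ : 4 * eps * (L + 1) = 2 * eps * (2 * (L + 1)));
    last by ring.
  apply: ler_pM => //; rewrite (_ : x + X = (x - X) + 2 * X); last by ring.
  apply: (le_trans (ler_normD _ _)); rewrite normrM (ger0_norm (x := 2))// mulrDr addrC.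
  by apply: lerD; [rewrite ler_pM2l|apply: (le_trans h1); rewrite ler_pM2l].
have [c1 c2] := approx_X_close rin.
have [[b1 b2] _ _ _] := bounds rin.
have q1 := sqd _ _ c1 b1; have q2 := sqd _ _ c2 b2.
have fin := path_error_le L0 B0 e0 eps1 kappa0 delta0 r0 rT kB kB2 ke dB2 de.
rewrite E1 E2 E3 in disc.
move: fin disc cmp q1 q2 T2 T5.
move: (path_error _ _ * _); set p1 := (_ * (T - theta)); set p2 := (_ * kappa).
set p3 := (_ * delta); set p4 := (_ * eps); set p5 := (8 * eps * (L + 1)).
move: p1 p2 p3 p4 => p1 p2 p3 p4 pe.
set I1 := Rintegral _ _ _; set I2 := Rintegral _ _ _.
set S1 := `|\sum_(k < N) _|; set S2 := `|\sum_(k < N) _|.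
set Z0 := X1 theta omega ^+ 2 + X2 theta omega ^+ 2.
move=> fin disc cmp q1 q2 T2 T5.
rewrite (_ : _ - I2 = (X1 r omega ^+ 2 - approx_X X1 U r omega ^+ 2) +
  (X2 r omega ^+ 2 - approx_X X2 V r omega ^+ 2) +
  (approx_X X1 U r omega ^+ 2 + approx_X X2 V r omega ^+ 2 - Z0 - I1) + (I1 - I2));
  last by ring.
apply: (le_trans (ler_normD _ _)); apply: (le_trans (lerD (ler_normD _ _) (lexx _))).
apply: (le_trans (lerD (lerD (ler_normD _ _) (lexx _)) (lexx _))).
apply: (le_trans (lerD (lerD (lerD q1 q2) disc) cmp)).
move: fin; rewrite /p5; move: (eps * (L + 1)) => q; lra.
Qed.

End PathEstimate.

(** * Wiener increments along a grid *)

Section WienerGrid.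
Context d (Omega : measurableType d) (R : realType) (P : probability Omega R).
Variables (theta T : R) (F : R -> set (set Omega)) (w : R -> Omega -> R).
Hypothesis F_filtration : complete_rc_filtration P theta T F.
Hypothesis w_wiener : wiener_process P theta T F w.
Variables (g : nat -> R) (N : nat).
Hypothesis gg : grid theta T g N.

Let xi k omega := w (g k.+1) omega - w (g k) omega.
(** Compensated squares of the increments: martingale differences for the same filtration, whose
    variance is governed by the fourth moment. *)
Let zeta k omega := xi k omega ^+ 2 - (g k.+1 - g k).

Let gin k : g k \in `[theta, T] := grid_in k gg.
Let sG k : sigma_algebra setT (F (g k)).
Proof. by have [sF _ _ _] := F_filtration; have [] := sF _ (gin k). Qed.
Let Gm k : F (g k) `<=` measurable.
Proof. by have [sF _ _ _] := F_filtration; have [] := sF _ (gin k). Qed.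
Let Gmono k : F (g k) `<=` F (g k.+1).
Proof.
have [_ Fm _ _] := F_filtration; have [_ _ gS] := gg.
by apply: Fm; [exact: grid_ge gg|exact: gS|exact: grid_le gg].
Qed.

Let xi_meas k : measurable_wrt (F (g k.+1)) (xi k).
Proof.
have [_ aw _ _ _] := w_wiener.
apply: (measurable_wrtB (sG _)); first exact: aw.
by apply: (measurable_wrtS (@Gmono k)); exact: aw.
Qed.

Let mxi k : measurable_fun setT (xi k).
Proof. exact: measurable_wrt_measurable (@Gm k.+1) (xi_meas k). Qed.

Lemma independent_of_cst (G : set (set Omega)) (c : R) : independent_of P G (fun=> c).
Proof.
move=> A B _ _; have [Bc|nBc] := pselect (B c).
  rewrite (_ : _ @^-1` B = setT); last by apply/seteqP; split.
  by rewrite setIT probability_setT mule1.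
rewrite (_ : _ @^-1` B = set0); last by apply/seteqP; split.
by rewrite setI0 measure0 mule0.
Qed.

(** The normal law is available for a positive time step only; on a degenerate step the increment is
    identically zero. *)
Let xi_cases k : xi k = (fun=> 0) /\ g k.+1 - g k = 0 \/
  0 < g k.+1 - g k /\ (forall B, measurable B ->
     P (xi k @^-1` B) = normal_prob 0 (Num.sqrt (g k.+1 - g k)) B).
Proof.
have [_ _ _ lw _] := w_wiener; have [_ _ gS] := gg.
have := gS k; rewrite le_eqVlt => /orP[/eqP e|lt].
  by left; rewrite /xi e subrr; split => //; apply/funext => omega; rewrite subrr.
right; rewrite subr_gt0; split => // B mB.
by apply: lw => //; [exact: grid_ge gg|exact: grid_le gg].
Qed.

Let xi_indep k : independent_of P (F (g k)) (xi k).
Proof.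
have [_ _ _ _ iw] := w_wiener; have [_ _ gS] := gg.
have := gS k; rewrite le_eqVlt => /orP[/eqP e|lt].
  rewrite (_ : xi k = fun=> 0); first exact: independent_of_cst.
  by apply/funext => omega; rewrite /xi e subrr.
by apply: iw => //; [exact: grid_ge gg|exact: grid_le gg].
Qed.

Let xi_sqr k : P.-integrable setT (EFin \o (fun omega => xi k omega ^+ 2)) /\
  \int[P]_omega (xi k omega ^+ 2) = g k.+1 - g k.
Proof.
case: (xi_cases k) => [[-> ->]|[lt law]]; last exact: normal_law_sqr.
rewrite (_ : (fun=> 0 ^+ 2) = fun=> 0 :> R); last by apply/funext => omega; rewrite expr0n.
split; first exact: finite_measure_integrable_cst.
by rewrite /Rintegral integral0.
Qed.

Let xi_mean k : \int[P]_omega xi k omega = 0.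
Proof.
case: (xi_cases k) => [[-> _]|[lt law]]; last exact: (normal_law_mean lt (mxi k) law).
by rewrite /Rintegral integral0.
Qed.

Lemma wiener_lenglart (c : nat -> Omega -> R) (M p eta kappa : R) :
  (forall k, measurable_wrt (F (g k)) (c k)) -> (forall k omega, `|c k omega| <= M) ->
  0 < kappa -> 0 <= eta ->
  off_event P p (fun omega =>
    \sum_(k < N) c k omega ^+ 2 * (g k.+1 - g k) <= eta) ->
  off_event P (p + eta / kappa ^+ 2) (fun omega =>
    `|\sum_(k < N) c k omega * (w (g k.+1) omega - w (g k) omega)| <= kappa).
Proof.
move=> mc bc k0 eta0 H.
apply: (@lenglart _ _ _ P (fun k => F (g k)) xi sG Gm Gmono xi_meas xi_indep
  (fun k => (xi_sqr k).1) xi_mean c M N) => //.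
apply: off_eventW H => // omega; congr (_ <= _).
by apply: eq_bigr => k _; rewrite (xi_sqr k).2.
Qed.

Let zeta_meas k : measurable_wrt (F (g k.+1)) (zeta k).
Proof.
apply: (measurable_wrtB (sG _)); last exact: (measurable_wrt_cst (sG _)).
by apply: (@measurable_wrt_comp _ _ _ _ (sG _) (fun x => x ^+ 2)).
Qed.

Let zeta_indep k : independent_of P (F (g k)) (zeta k).
Proof.
apply: (@independent_of_comp _ _ _ P _ (xi k) (fun x => x ^+ 2 - (g k.+1 - g k))) => //.
exact: measurable_funB.
Qed.

Let zeta_mean k : \int[P]_omega zeta k omega = 0.
Proof.
rewrite /zeta RintegralB//; last 2 first.
- exact: (xi_sqr k).1.
- exact: finite_measure_integrable_cst.
rewrite (xi_sqr k).2 [X in _ - X](_ : _ = g k.+1 - g k) ?subrr//.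
by rewrite /Rintegral integral_cst// [X in (_ * X)%E]probability_setT mule1.
Qed.

Let zeta_sqr k : P.-integrable setT (EFin \o (fun omega => zeta k omega ^+ 2)) /\
  \int[P]_omega (zeta k omega ^+ 2) <= 30 * (g k.+1 - g k) ^+ 2.
Proof.
rewrite /zeta; case: (xi_cases k) => [[-> ->]|[lt law]]; last exact: normal_law_sqr_deviation.
rewrite (_ : (fun=> (0 ^+ 2 - 0) ^+ 2) = fun=> 0 :> R); last first.
  by apply/funext => omega; rewrite expr0n/= subrr expr0n.
split; first exact: finite_measure_integrable_cst.
by rewrite /Rintegral integral0// expr0n/= mulr0.
Qed.

(** The variances sum to at most a multiple of the squares of the time steps, hence of
    [delta * (T - theta)]: the failure probability vanishes with the mesh. *)
Lemma wiener_quadratic_variation (c : nat -> Omega -> R) (M kappa delta : R) :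
  (forall k, measurable_wrt (F (g k)) (c k)) -> (forall k omega, `|c k omega| <= M) ->
  0 < kappa -> (forall k, g k.+1 - g k <= delta) ->
  off_event P (30 * M ^+ 2 * delta * (T - theta) / kappa ^+ 2) (fun omega =>
    `|\sum_(k < N) c k omega *
       ((w (g k.+1) omega - w (g k) omega) ^+ 2 - (g k.+1 - g k))| <= kappa).
Proof.
move=> mc bc k0 mesh.
apply: (@martingale_transform_small _ _ _ P (fun k => F (g k)) zeta sG Gm Gmono zeta_meas
  zeta_indep (fun k => (zeta_sqr k).1) zeta_mean c M) => //.
move=> omega; have [g0 gN gS] := gg.
have -> : 30 * M ^+ 2 * delta * (T - theta) =
    \sum_(k < N) 30 * M ^+ 2 * delta * (g k.+1 - g k).
  rewrite -mulr_sumr; congr (_ * _).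
  by have := telescope_sumr g (leq0n N); rewrite big_mkord => ->; rewrite g0 gN.
apply: ler_sum => k _; have dk : 0 <= g k.+1 - g k by rewrite subr_ge0.
apply: (@le_trans _ _ (M ^+ 2 * (30 * (g k.+1 - g k) ^+ 2))).
  apply: ler_pM; rewrite ?sqr_ge0//; last exact: (zeta_sqr k).2.
    by apply: Rintegral_ge0 => o _; exact: sqr_ge0.
  exact: sqr_le_norm.
rewrite (_ : M ^+ 2 * _ = 30 * M ^+ 2 * (g k.+1 - g k) * (g k.+1 - g k)); last by ring.
by rewrite ler_wpM2r// ler_wpM2l// mulr_ge0// sqr_ge0.
Qed.

End WienerGrid.

(** * Choice of simple processes, small constants and truncations *)

Section Approximation.
Context d (Omega : measurableType d) (R : realType) (P : probability Omega R).
Variables (theta T : R) (F : R -> set (set Omega)) (tau : Omega -> R).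

Lemma sup_dist_le (J : interval R) (A B : R -> Omega -> R) omega (e : R) :
  (sup_dist J A B omega <= e%:E)%E ->
  forall s, s \in J -> `|A s omega - B s omega| <= e.
Proof.
move=> H s sJ; rewrite -lee_fin; apply: le_trans H.
by apply: ereal_sup_ubound; exists s.
Qed.

Lemma semimartingale_integral_approx (X H J : R -> Omega -> R) (e p : R) :
  semimartingale_integral P theta T F tau X H J -> 0 < e -> 0 < p ->
  exists W : simple_process theta T F, off_event P (p + p) (fun omega =>
    (forall s, s \in `]theta, tau omega] -> `|sp_val W s omega - H s omega| <= e) /\
    (forall s, s \in `[theta, tau omega] -> `|sp_integral W X s omega - J s omega| <= e)).
Proof.
move=> [Hn [c1 c2]] e0 p0.
have [n1 h1] := off_event_cvg0 c1 e0 p0; have [n2 h2] := off_event_cvg0 c2 e0 p0.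
exists (Hn (maxn n1 n2)).
have := off_eventI (h1 _ (leq_maxl n1 n2)) (h2 _ (leq_maxr n1 n2)).
apply: off_eventW => // omega [q1 q2]; split; exact: sup_dist_le.
Qed.

Lemma ito_integral_approx (w b I : R -> Omega -> R) (e1 e2 p : R) :
  ito_integral P theta T F tau w b I -> 0 < e1 -> 0 < e2 -> 0 < p ->
  exists W : simple_process theta T F, off_event P (p + p) (fun omega =>
    (\int[@lebesgue_measure R]_(s in `[theta, tau omega])
       ((sp_val W s omega - b s omega) ^+ 2)%:E <= e1%:E)%E /\
    (forall s, s \in `[theta, tau omega] -> `|sp_integral W w s omega - I s omega| <= e2)).
Proof.
move=> [Hn [c1 c2]] e10 e20 p0.
have [n1 h1] := off_event_cvg0 c1 e10 p0; have [n2 h2] := off_event_cvg0 c2 e20 p0.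
exists (Hn (maxn n1 n2)).
have := off_eventI (h1 _ (leq_maxl n1 n2)) (h2 _ (leq_maxr n1 n2)).
by apply: off_eventW => // omega [q1 q2]; split => //; exact: sup_dist_le.
Qed.

End Approximation.

(** The denominators [|A| + 1] allow any sign of [A], and zero. *)
Lemma exists_small (R : realType) (A1 A2 c0 c1 c2 : R) : 0 < c0 -> 0 < c1 -> 0 < c2 ->
  exists e : R, [/\ 0 < e, e <= c0, A1 * e <= c1 & A2 * e <= c2].
Proof.
move=> c00 c10 c20; pose q (A c : R) : R := c / (`|A| + 1).
have q0 (A c : R) : 0 < c -> 0 < q A c by move=> h; rewrite divr_gt0// ltr_wpDl.
exists (Num.min c0 (Num.min (q A1 c1) (q A2 c2))).
have e0 : 0 < Num.min c0 (Num.min (q A1 c1) (q A2 c2)) by rewrite !lt_min c00 !q0.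
split=> //; first by rewrite ge_min lexx.
- have h : Num.min c0 (Num.min (q A1 c1) (q A2 c2)) <= q A1 c1 by rewrite !ge_min lexx orbT.
  apply: (le_trans (ler_wpM2r (ltW e0) (ler_norm A1))).
  apply: (le_trans (ler_wpM2l (normr_ge0 A1) h)).
  by rewrite /q mulrA ler_pdivrMr ?ltr_wpDl// mulrC ler_pM2l// lerDl.
- have h : Num.min c0 (Num.min (q A1 c1) (q A2 c2)) <= q A2 c2 by rewrite !ge_min lexx !orbT.
  apply: (le_trans (ler_wpM2r (ltW e0) (ler_norm A2))).
  apply: (le_trans (ler_wpM2l (normr_ge0 A2) h)).
  by rewrite /q mulrA ler_pdivrMr ?ltr_wpDl// mulrC ler_pM2l// lerDl.
Qed.

(** [drift_coef] is small only off an exceptional event, whereas the second moment computation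
    requires coefficients bounded for every [omega]. *)
Definition clamp (R : realType) (c x : R) := Num.max (- c) (Num.min x c).

Lemma clamp_le (R : realType) (c x : R) : 0 <= c -> `|clamp c x| <= c.
Proof.
move=> c0; rewrite ler_norml /clamp le_max lexx/= ge_max ge_min lexx orbT andbT.
by rewrite (le_trans _ c0)// oppr_le0.
Qed.

Lemma clamp_id (R : realType) (c x : R) : `|x| <= c -> clamp c x = x.
Proof. by rewrite ler_norml /clamp => /andP[h1 h2]; rewrite min_l// max_r. Qed.

Lemma measurable_clamp (R : realType) (c : R) : measurable_fun setT (clamp c).
Proof. by apply: measurable_maxr => //; exact: measurable_minr. Qed.

(** * The squared modulus *)

Section SquaredModulus.
Context d (Omega : measurableType d) (R : realType) (P : probability Omega R).
Variables (theta T : R) (F : R -> set (set Omega)).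
Local Notation mu := (@lebesgue_measure R).
Variables (X1 X2 H1 H2 J1 J2 y a b I w : R -> Omega -> R) (tau : Omega -> R).
Hypothesis theta_lt_T : theta < T.
Hypothesis F_filtration : complete_rc_filtration P theta T F.
Hypothesis w_wiener : wiener_process P theta T F w.
Hypothesis tau_stopping : stopping_time theta T F tau.
Hypothesis tau_range : {ae P, forall omega, theta < tau omega <= T}.
Hypothesis known_X1 : known_before theta T F tau X1.
Hypothesis known_X2 : known_before theta T F tau X2.
Hypothesis known_y : known_before theta T F tau y.
Hypothesis J1_integral : semimartingale_integral P theta T F tau y H1 J1.
Hypothesis J2_integral : semimartingale_integral P theta T F tau y H2 J2.
Hypothesis I_integral : ito_integral P theta T F tau w b I.
Hypothesis bounds : forall p : R, 0 < p -> exists2 L : R, 0 <= L &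
  off_event P p (fun omega => forall s, s \in `[theta, tau omega] ->
  [/\ `|X1 s omega| <= L /\ `|X2 s omega| <= L,
      `|H1 s omega| <= L /\ `|H2 s omega| <= L, `|a s omega| <= L & `|b s omega| <= L]).
Hypothesis orth : {ae P, forall omega, forall s, s \in `[theta, tau omega] ->
  X1 s omega * H1 s omega + X2 s omega * H2 s omega = 0}.
Hypothesis eqX1 : {ae P, forall omega, forall s, s \in `[theta, tau omega] ->
  X1 s omega = X1 theta omega + J1 s omega}.
Hypothesis eqX2 : {ae P, forall omega, forall s, s \in `[theta, tau omega] ->
  X2 s omega = X2 theta omega + J2 s omega}.
Hypothesis eqy : {ae P, forall omega, forall s, s \in `[theta, tau omega] ->
  y s omega = y theta omega + \int[mu]_(s in `[theta, s]) a s omega + I s omega}.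
Hypothesis int_a : {ae P, forall omega,
  mu.-integrable `[theta, tau omega] (EFin \o a ^~ omega)}.
Hypothesis cX1 : {ae P, forall omega,
  uniformly_continuous_on theta (tau omega) (X1 ^~ omega)}.
Hypothesis cX2 : {ae P, forall omega,
  uniformly_continuous_on theta (tau omega) (X2 ^~ omega)}.
Hypothesis mH1 : {ae P, forall omega, measurable_fun `[theta, tau omega] (H1 ^~ omega)}.
Hypothesis mH2 : {ae P, forall omega, measurable_fun `[theta, tau omega] (H2 ^~ omega)}.
Hypothesis mb : {ae P, forall omega, measurable_fun `[theta, tau omega] (b ^~ omega)}.

Let theta_le_T : theta <= T := ltW theta_lt_T.

Let sF t : t \in `[theta, T] -> sigma_algebra setT (F t).
Proof. by have [h _ _ _] := F_filtration => /h[]. Qed.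

Let known_w : known_before theta T F tau w.
Proof.
have [_ aw _ _ _] := w_wiener => s sin.
exact: (known_before_adapted F_filtration tau_stopping aw sin).
Qed.

Lemma stopped_at_stopping t : stopping_time theta T F (stopped_at tau t).
Proof.
move=> s sin; have sFs := sF sin; have [ts|st] := leP t s.
  have [F0 _ _] := sFs; have := wrt_setC sFs F0; rewrite setC0.
  by congr (F s _); apply/seteqP; split=> // omega _; rewrite /= /stopped_at ge_min ts.
have := tau_stopping sin; congr (F s _); apply/seteqP; split=> omega /=.
  by rewrite /stopped_at ge_min => ->; rewrite orbT.
by rewrite /stopped_at ge_min leNgt st.
Qed.

Section Grid.
Variables (U V H : simple_process theta T F) (g : nat -> R) (N : nat) (t : R).
Hypothesis gg : grid theta T g N.
Hypothesis gU : {in sp_nodes U, forall p, exists j, p = g j}.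
Hypothesis gV : {in sp_nodes V, forall p, exists j, p = g j}.

Let gin k : g k \in `[theta, T] := grid_in k gg.

Lemma act_measurable k : measurable_wrt (F (g k)) (act tau g t k).
Proof.
apply: (measurable_wrtM (sF (gin k))); first exact: measurable_wrt_cst (sF (gin k)) _.
exact: (alive_measurable F_filtration (@stopped_at_stopping t) (gin k)).
Qed.

(** An active step begins before [tau], so the factor that makes [known_before] processes measurable
    can be inserted for free. *)
Lemma act_alive k omega : act tau g t k omega = act tau g t k omega * alive tau (g k) omega.
Proof.
rewrite /act -mulrA; congr (_ * _); rewrite /alive !indicE.
have [h|h] := boolP (omega \in [set o | g k < stopped_at tau t o]); last by rewrite mul0r.
rewrite mem_set ?mulr1//=; rewrite inE /= /stopped_at in h.
by apply: (lt_le_trans h); rewrite ge_min lexx orbT.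
Qed.

Lemma known_before_ito_integral : known_before theta T F tau I.
Proof.
apply: (known_before_limit F_filtration) => e e0.
have [W HW] := ito_integral_approx I_integral ltr01 e0 (divr_gt0 e0 (ltr0Sn R 1)).
exists (sp_integral W w).
  by move=> s sin; exact: (known_before_integral F_filtration tau_stopping W known_w sin).
apply: off_eventW HW; first by rewrite -splitr.
by move=> omega [].
Qed.

Lemma approx_X_known X W : known_before theta T F tau X ->
  known_before theta T F tau (approx_X y I w H X W).
Proof.
move=> kX t' t'in; have := t'in; rewrite in_itv/= => /andP[t1 t2].
have ky : known_before theta T F tau (approx_y y I w H).
  apply: (known_beforeD F_filtration) => //; apply: (known_beforeB F_filtration).
    by move=> s sin; exact: (known_before_integral F_filtration tau_stopping H known_w sin).
  exact: known_before_ito_integral.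
have := measurable_wrtD (sF t'in)
  (known_before_earlier F_filtration tau_stopping kX (lexx theta) t1 t2)
  (known_before_integral F_filtration tau_stopping W ky t'in).
by congr measurable_wrt; apply/funext => omega; rewrite /approx_X mulrDr.
Qed.

Lemma drift_coef_measurable k :
  measurable_wrt (F (g k)) (drift_coef X1 X2 y I w tau U V H g t k).
Proof.
have sFk := sF (gin k).
rewrite (_ : drift_coef _ _ _ _ _ _ _ _ _ _ _ _ = fun omega => act tau g t k omega *
  (alive tau (g k) omega * approx_X y I w H X1 U (g k) omega * sp_val U (g k.+1) omega +
   alive tau (g k) omega * approx_X y I w H X2 V (g k) omega * sp_val V (g k.+1) omega)).
  apply: (measurable_wrtM sFk); first exact: act_measurable.
  apply: (measurable_wrtD sFk); apply: (measurable_wrtM sFk).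
  - exact: approx_X_known.
  - refine (sp_val_grid_meas F_filtration gg gU k).
  - exact: approx_X_known.
  - refine (sp_val_grid_meas F_filtration gg gV k).
by apply/funext => omega; rewrite /drift_coef [in LHS]act_alive; ring.
Qed.

Lemma quad_coef_measurable k : measurable_wrt (F (g k)) (quad_coef tau U V g t k).
Proof.
have sFk := sF (gin k).
have mU := sp_val_grid_meas F_filtration gg gU k.
have mV := sp_val_grid_meas F_filtration gg gV k.
apply: (measurable_wrtM sFk); first exact: act_measurable.
apply: (measurable_wrtD sFk).
  by apply: (measurable_wrtM sFk mU mU).
by apply: (measurable_wrtM sFk mV mV).
Qed.

End Grid.

(** The order of the choices is the point: the bound [L], the tolerance [eps], the integrands [U]
    and [V], then [iota] and [H], which must suit them, and finally the oscillation and the mesh,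
    which must beat the bound [B] of all three. *)
Lemma sqr_modulus_off t e p : t \in `[theta, T] -> 0 < e -> 0 < p ->
  off_event P (18 * p) (fun omega => let r := stopped_at tau t omega in
  `|X1 r omega ^+ 2 + X2 r omega ^+ 2 - (X1 theta omega ^+ 2 + X2 theta omega ^+ 2) -
    \int[mu]_(s in `[theta, r]) ((H1 s omega ^+ 2 + H2 s omega ^+ 2) * b s omega ^+ 2)| <= e).
Proof.
move=> t_in e0 p0; have [L L0 oL] := bounds p0.
(* [path_estimate] gives [3 * e1] plus a multiple of [eps]; each receives half of [e]. *)
pose e1 := e / 6; have e10 : 0 < e1 by rewrite divr_gt0.
(* [A2 * eps ^+ 2] bounds the accumulated variance of the first order sum. Keeping it below
   [p * e1 ^+ 2] makes Lenglart's inequality cost one further [p]. *)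
pose A2 := (8 * (L + 1)) ^+ 2 * (3 + 2 * L ^+ 2 * (T - theta)).
have [eps [eps0 eps1 epsA epsV]] := @exists_small R (path_error L (T - theta)) A2 1 (e / 2)
  (p * e1 ^+ 2) ltr01 (divr_gt0 e0 (ltr0Sn R 1)) (mulr_gt0 p0 (exprn_gt0 2 e10)).
have [U oU] := semimartingale_integral_approx J1_integral eps0 p0.
have [V oV] := semimartingale_integral_approx J2_integral eps0 p0.
have [KU [KU0 boundU]] := sp_integral_bound U; have [KV [KV0 boundV]] := sp_integral_bound V.
pose K := KU + KV.
have [iota [iota0 _ K_iota _]] := @exists_small R K 0 1 eps 1 ltr01 eps0 ltr01.
have [H oH] := ito_integral_approx I_integral (exprn_gt0 2 eps0) iota0 p0.
have [BU [BU0 vU]] := sp_val_bounded U; have [BV [BV0 vV]] := sp_val_bounded V.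
have [BH [BH0 vH]] := sp_val_bounded H.
pose B := BU + BV + BH; have B0 : 0 <= B by rewrite !addr_ge0.
have val_bound omega s :
    [/\ `|sp_val U s omega| <= B, `|sp_val V s omega| <= B & `|sp_val H s omega| <= B].
  split; [apply: (le_trans (vU s omega))|apply: (le_trans (vV s omega))|
          apply: (le_trans (vH s omega))]; rewrite /B.
  - by rewrite -addrA lerDl addr_ge0.
  - by rewrite addrAC lerDr addr_ge0.
  - by rewrite lerDr addr_ge0.
pose kappa := eps / (1 + B) ^+ 2.
have B10 : 0 < (1 + B) ^+ 2 by rewrite exprn_gt0// ltr_wpDr.
have kappa0 : 0 < kappa by rewrite divr_gt0.
have kappa_le : kappa * (1 + B) ^+ 2 <= eps by rewrite /kappa divfK// gt_eqF.
have [_ aw cw _ _] := w_wiener; have [sFm _ _ _] := F_filtration.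
have mw s : s \in `[theta, T] -> measurable_fun setT (w s).
  by move=> sin; exact: measurable_wrt_measurable (sFm s sin).2 (aw s sin).
have ucw : {ae P, forall omega, uniformly_continuous_on theta T (w ^~ omega)}.
  by apply: filterS cw => omega; exact: within_continuous_uniformly.
have [d0 d00 osc] := path_oscillation_off theta_le_T mw ucw kappa0 p0.
pose M := 2 * B ^+ 2 * B ^+ 2.
(* The mesh stays below the oscillation scale [d0], absorbs [B], and lets the compensated squares
   fail with probability at most [p]. *)
have [delta [delta0 delta_d0 delta_le delta_qv]] := @exists_small R ((1 + B) ^+ 2)
  (30 * M ^+ 2 * (T - theta) / e1 ^+ 2) d0 eps p d00 eps0 p0.
have {}delta_le : delta * (1 + B) ^+ 2 <= eps by rewrite mulrC.
have [g [N [gg g_mesh nodes]]] := @refining_grid R theta T theta_le_T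
  (sp_nodes U ++ sp_nodes V ++ sp_nodes H) delta delta0 ltac:(
    by move=> q; rewrite !mem_cat => /or3P[] /sp_nodes_in).
have gU : {in sp_nodes U, forall q, exists j, q = g j}.
  by move=> q h; apply: nodes; rewrite mem_cat h.
have gV : {in sp_nodes V, forall q, exists j, q = g j}.
  by move=> q h; apply: nodes; rewrite !mem_cat h orbT.
have gH : {in sp_nodes H, forall q, exists j, q = g j}.
  by move=> q h; apply: nodes; rewrite !mem_cat h !orbT.
pose M1 := 8 * eps * (L + 1).
have M10 : 0 <= M1 by rewrite /M1 !mulr_ge0 ?addr_ge0// ltW.
(* Cost [8 * p]: one for the bounds, two for each of the three approximations, one for the
   oscillation; almost sure facts cost nothing. *)
have base := off_eventI (off_eventI (off_eventI oL (off_eventI oU (off_eventI oV oH))) osc)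
  (off_eventI (off_eventI (off_eventI (ae_off_event tau_range) (ae_off_event orth))
     (off_eventI (off_eventI (ae_off_event eqX1) (ae_off_event eqX2))
        (off_eventI (ae_off_event eqy) (ae_off_event int_a))))
   (off_eventI (off_eventI (ae_off_event cX1) (ae_off_event cX2))
     (off_eventI (off_eventI (ae_off_event mH1) (ae_off_event mH2)) (ae_off_event mb)))).
pose c1 k omega := clamp M1 (drift_coef X1 X2 y I w tau U V H g t k omega) *
  sp_val H (g k.+1) omega.
pose c2 k omega := quad_coef tau U V g t k omega * sp_val H (g k.+1) omega ^+ 2.
have gin k : g k \in `[theta, T] := grid_in k gg.
have mH' k := sp_val_grid_meas F_filtration gg gH k.
have c1_meas k : measurable_wrt (F (g k)) (c1 k).
  apply: (measurable_wrtM (sF (gin k))) => //.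
  apply: (measurable_wrt_comp (sF (gin k)) (@measurable_clamp R M1)).
  refine (@drift_coef_measurable U V H g N t gg gU gV k).
have c2_meas k : measurable_wrt (F (g k)) (c2 k).
  apply: (measurable_wrtM (sF (gin k))); first refine (@quad_coef_measurable U V g N t gg gU gV k).
  exact: (measurable_wrtM (sF (gin k)) (mH' k) (mH' k)).
have c1_bound k omega : `|c1 k omega| <= M1 * B.
  by rewrite normrM; apply: ler_pM => //; [exact: clamp_le|have [] := val_bound omega (g k.+1)].
have c2_bound k omega : `|c2 k omega| <= M.
  rewrite /c2 /quad_coef normrM; have [h1 h2 h3] := val_bound omega (g k.+1).
  apply: ler_pM => //; last by rewrite ger0_norm ?sqr_ge0//; exact: sqr_le_norm.
  have q1 := sqr_le_norm h1; have q2 := sqr_le_norm h2.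
  rewrite ger0_norm; last first.
    by rewrite mulr_ge0 ?addr_ge0 ?sqr_ge0// /act /alive indicE mulr_ge0.
  have : act tau g t k omega <= 1.
    by rewrite /act /alive indicE; case: (_ < _); case: (_ \in _); rewrite ?mulr1 ?mulr0.
  have q0 := sqr_ge0 (sp_val U (g k.+1) omega); have q0' := sqr_ge0 (sp_val V (g k.+1) omega).
  move=> h; apply: (le_trans (ler_wpM2r (addr_ge0 q0 q0') h)).
  by rewrite mul1r mulr_natl mulr2n lerD.
have boundUK omega (Z : R -> Omega -> R) (c s : R) : theta <= s ->
    (forall s', s' \in `[theta, s] -> `|Z s' omega| <= c) ->
    `|sp_integral U Z s omega| <= K * c.
  move=> ts hz; apply: (le_trans (boundU Z c s omega ts hz)).
  have c0 : 0 <= c.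
    by apply: (le_trans (normr_ge0 (Z theta omega))); apply: hz; rewrite in_itv/= lexx.
  by rewrite ler_wpM2r// lerDl.
have boundVK omega (Z : R -> Omega -> R) (c s : R) : theta <= s ->
    (forall s', s' \in `[theta, s] -> `|Z s' omega| <= c) ->
    `|sp_integral V Z s omega| <= K * c.
  move=> ts hz; apply: (le_trans (boundV Z c s omega ts hz)).
  have c0 : 0 <= c.
    by apply: (le_trans (normr_ge0 (Z theta omega))); apply: hz; rewrite in_itv/= lexx.
  by rewrite ler_wpM2r// lerDr.
have len : off_event P (9 * p) (fun omega =>
    `|\sum_(k < N) c1 k omega * (w (g k.+1) omega - w (g k) omega)| <= e1).
  have C0 : 0 <= 3 + 2 * L ^+ 2 * (T - theta).
    by rewrite addr_ge0// mulr_ge0 ?subr_ge0// mulr_ge0// sqr_ge0.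
  apply: (off_eventW _ (fun _ h => h) (@wiener_lenglart _ _ _ P theta T F w F_filtration w_wiener
    g N gg c1 (M1 * B) (8 * p) (M1 ^+ 2 * (3 + 2 * L ^+ 2 * (T - theta))) e1
    c1_meas c1_bound e10 _ _)).
  - rewrite (_ : 9 * p = 8 * p + p); last by ring.
    rewrite lerD2l ler_pdivrMr ?exprn_gt0//; apply: le_trans epsV.
    rewrite (_ : M1 ^+ 2 * _ = A2 * (eps * eps)); last by rewrite /M1 /A2; ring.
    rewrite ler_wpM2l//; first by rewrite /A2 mulr_ge0// sqr_ge0.
    by rewrite ler_piMr// ltW.
  - by rewrite mulr_ge0// sqr_ge0.
  - apply: off_eventW base; first by rewrite !addr0 le_eqVlt; apply/orP; left; apply/eqP; ring.
    move=> omega [[[bd [_ [_ [cH _]]]] _] [[[tr _] _] [_ [_ mb']]]].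
    apply: (@total_variance_le d Omega R theta T F X1 X2 H1 H2 a b w tau U V H g N t omega
      L B eps delta gg g_mesh gU gV gH t_in tr L0 B0 eps0 eps1 (ltW delta0) delta_le bd
      (val_bound omega) cH mb'
      (fun k => clamp M1 (drift_coef X1 X2 y I w tau U V H g t k omega))).
      by move=> k; exact: clamp_le.
    by move=> k a0; rewrite /drift_coef a0 mul0r clamp_id// normr0.
have qv := @wiener_quadratic_variation _ _ _ P theta T F w F_filtration w_wiener g N gg c2 M e1
  delta c2_meas c2_bound e10 g_mesh.
(* The total 18 is 8 for [base], 9 for [len], which pays for [base] again, and 1 for [qv]. *)
have := off_eventI base (off_eventI len qv).
apply: off_eventW.
  move: delta_qv; rewrite (_ : 30 * M ^+ 2 * delta * (T - theta) / e1 ^+ 2 =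
    30 * M ^+ 2 * (T - theta) / e1 ^+ 2 * delta); last by ring.
  rewrite !addr0 => h; rewrite (_ : 18 * p = 8 * p + (9 * p + p)); last by ring.
  by rewrite !lerD// le_eqVlt; apply/orP; left; apply/eqP; ring.
move=> omega [[[[bd [[cU jU] [[cV jV] [cH iH]]]] osw]
  [[[tr orth'] [[ex1 ex2] [ey ia]]] [[cx1 cx2] [[m1 m2] mb']]]] [T2 T5]] /=.
have [cb _] := all_and2 (fun k => @coef_bounds d Omega R theta T F X1 X2 H1 H2 J1 J2 y a b I w tau
  U V H g N t omega L eps iota K gg gU gV L0 eps0 eps1 bd orth' ex1 ex2 cx1 cx2 cU cV jU jV iH
  (boundUK omega) (boundVK omega) K_iota k).
have -> : e = 3 * e1 + e / 2 by rewrite /e1; field.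
apply: le_trans (lerD (lexx _) epsA).
apply: (@path_estimate d Omega R theta T F X1 X2 H1 H2 J1 J2 y a b I w tau U V H g N t omega
  L B eps kappa delta iota K e1 gg g_mesh gU gV gH t_in tr L0 B0 eps0 eps1 (ltW kappa0) kappa_le
  (ltW delta0) delta_le bd orth' ex1 ex2 ey ia cx1 cx2 cU cV jU jV iH (boundUK omega)
  (boundVK omega) K_iota (val_bound omega) cH m1 m2 mb') => //.
- by move=> s s' sin s'in ss; apply: osw => //; exact: (le_trans ss).
(* Off the exceptional event the coefficient obeys its bound, so the clamp acts as the identity. *)
- move: T2; congr (`|_| <= e1); apply: eq_bigr => k _; by rewrite /c1 clamp_id.
Qed.

Lemma sqr_modulus_ae t : t \in `[theta, T] -> {ae P, forall omega,
  let r := stopped_at tau t omega in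
  X1 r omega ^+ 2 + X2 r omega ^+ 2 = X1 theta omega ^+ 2 + X2 theta omega ^+ 2 +
    \int[mu]_(s in `[theta, r]) ((H1 s omega ^+ 2 + H2 s omega ^+ 2) * b s omega ^+ 2)}.
Proof.
move=> t_in; have : {ae P, forall omega, forall n, let r := stopped_at tau t omega in
  `|X1 r omega ^+ 2 + X2 r omega ^+ 2 - (X1 theta omega ^+ 2 + X2 theta omega ^+ 2) -
    \int[mu]_(s in `[theta, r]) ((H1 s omega ^+ 2 + H2 s omega ^+ 2) * b s omega ^+ 2)| <=
  n.+1%:R^-1}.
  apply/ae_foralln => n; apply: off_event_ae => p p0.
  have p180 : 0 < p / 18 by rewrite divr_gt0.
  have n0 : 0 < n.+1%:R^-1 :> R by rewrite invr_gt0.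
  have := sqr_modulus_off t_in n0 p180; rewrite (_ : 18 * (p / 18) = p); last by field.
  exact.
apply: filterS => omega /= Hn; apply/eqP; rewrite -subr_eq0 opprD addrA.
apply/negPn/negP; rewrite -normr_gt0 => z0; move: z0 Hn; move: `|_| => z z0 Hn.
by have := Hn (Num.truncn z^-1); rewrite leNgt invf_plt ?posrE// truncnS_gt.
Qed.

End SquaredModulus.

(** * From the squared modulus to its logarithm *)

Section LogIntegral.
Context (R : realType).
Local Notation mu := (@lebesgue_measure R).

(** For an exponent in [[0, 1]] the power is at most [1 + x]; a negative exponent is read as a power
    of [1/x]. *)
Lemma powR_le (x p : R) : 0 < x -> -1 <= p <= 1 -> x `^ p <= 1 + x + x^-1.
Proof.
have half (z q : R) : 0 < z -> 0 <= q <= 1 -> z `^ q <= 1 + z.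
  move=> z0 /andP[q0 q1]; have [z1|z1] := leP 1 z.
    by apply: (le_trans (ler1_powR z1 q1)); rewrite lerDr.
  have : z `^ q <= 1 `^ q by rewrite ge0_ler_powR ?nnegrE// ltW.
  by rewrite powR1 => h; apply: (le_trans h); rewrite lerDl ltW.
move=> x0 /andP[p1 p2]; have [p0|p0] := leP 0 p.
  by apply: (le_trans (half _ _ x0 _)); rewrite ?p0// lerDl invr_ge0 ltW.
have -> : x `^ p = (x^-1) `^ (- p).
  by rewrite -powR_inv1 ?(ltW x0)// -powRrM mulN1r opprK.
apply: (le_trans (half _ _ _ _)); first by rewrite invr_gt0.
  by rewrite oppr_ge0 (ltW p0) lerNl.
by rewrite -addrA lerD2l lerDr ltW.
Qed.

(** The inequality [ln u - ln v <= (u - v)/v], used in both directions. Since [z0] and [z1] are at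
    least 1, dividing the error [e * G] by them only helps. *)
Lemma ln_increment (z0 z1 G e : R) : 1 <= z0 -> 1 <= z1 -> 0 <= G -> 0 <= e ->
  (z0 - e) * G <= z1 - z0 <= (z0 + e) * G -> (z1 - e) * G <= z1 - z0 ->
  `|ln z1 - ln z0 - G| <= e * G.
Proof.
move=> h0 h1 G0 e0 /andP[l0 u0] l1.
have p0 : 0 < z0 := lt_le_trans ltr01 h0; have p1 : 0 < z1 := lt_le_trans ltr01 h1.
have ln_le (u v : R) : 0 < u -> 0 < v -> ln u - ln v <= (u - v) / v.
  move=> u0' v0; rewrite -ln_div ?posrE//.
  rewrite (_ : u / v = 1 + (u - v) / v); last by rewrite mulrBl divff ?gt_eqF// addrC subrK.
  apply: le_ln1Dx; rewrite ltr_pdivlMr// mulN1r ltrBrDl subrr//.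
have up := ln_le _ _ p1 p0; have lo := ln_le _ _ p0 p1.
have eG : 0 <= e * G by rewrite mulr_ge0.
have q0 : e * G / z0 <= e * G by rewrite ler_pdivrMr// ler_peMr.
have q1 : e * G / z1 <= e * G by rewrite ler_pdivrMr// ler_peMr.
have a0 : (z1 - z0) / z0 <= G + e * G / z0.
  by rewrite ler_pdivrMr// mulrDl divfK ?gt_eqF// (le_trans u0)// mulrDl [G * _]mulrC.
have a1 : (z0 - z1) / z1 <= - G + e * G / z1.
  rewrite ler_pdivrMr// mulrDl divfK ?gt_eqF//; move: l1; rewrite mulrBl mulNr [G * _]mulrC; lra.
by rewrite ler_norml; apply/andP; split; lra.
Qed.

(** A discrete chain rule: [g] is only measurable, so [Z] need not be differentiable. The equation
    for [Z] is assumed only at the points of uniform grids of [[a, T]] stopped at [c]: these grids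
    are deterministic and countably many even when [c] is random. *)
Lemma log_integral (a c T : R) (Z g : R -> R) (C : R) : a <= c -> c <= T ->
  uniformly_continuous_on a c Z -> measurable_fun `[a, c] g ->
  (forall s, s \in `[a, c] -> 0 <= Z s) ->
  (forall s, s \in `[a, c] -> 0 <= g s <= C) ->
  (forall N k, let m := Num.min (a + k%:R * ((T - a) / N.+1%:R)) c in
     Z m = 1 + \int[mu]_(s in `[a, m]) (Z s * g s)) ->
  ln (Z c) = \int[mu]_(s in `[a, c]) g s.
Proof.
move=> ac cT ucZ mg Z0 g0 HZ.
have [MZ HMZ] := uniformly_continuous_bounded ucZ.
have mZ := uniformly_continuous_measurable ucZ.
have gb s : s \in `[a, c] -> `|g s| <= C.
  by move=> sin; have /andP[h1 h2] := g0 s sin; rewrite ger0_norm.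
have ig : mu.-integrable `[a, c] (EFin \o g) := integrable_bounded_itv mg gb.
have iZg : mu.-integrable `[a, c] (EFin \o (fun s => Z s * g s)).
  apply: (@integrable_bounded_itv _ _ _ _ (MZ * C)); first exact: measurable_funM.
  by move=> s sin; rewrite normrM; apply: ler_pM => //; [exact: HMZ|exact: gb].
have T0 : 0 <= T - a by rewrite subr_ge0 (le_trans ac).
pose I := \int[mu]_(s in `[a, c]) g s.
(* A relative error [e] for every [e > 0] forces equality, because [I] does not depend on [e]. *)
suff H e : 0 < e -> `|ln (Z c) - I| <= e * I.
  have I0 : 0 <= I by apply: Rintegral_ge0 => s; rewrite /= => /g0 /andP[].
  apply/eqP; rewrite -subr_eq0; apply/negPn/negP; rewrite -normr_gt0 -/I => z0.
  have q0 : 0 < `|ln (Z c) - I| / (2 * (I + 1)).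
    by rewrite divr_gt0// mulr_gt0// ltr_wpDl.
  have := H _ q0; rewrite leNgt; case/negP.
  rewrite -mulrA gtr_pMr// mulrC ltr_pdivrMr ?mulr_gt0 ?ltr_wpDl//; lra.
move=> e0; have [d d0 Hd] := ucZ e e0.
(* The mesh [h] is made at most the modulus [d], so [Z] varies by at most [e] on each step. *)
pose N := Num.truncn ((T - a) / d); pose h := (T - a) / N.+1%:R.
have h0 : 0 <= h by rewrite divr_ge0.
have hd : h <= d.
  rewrite /h ler_pdivrMr// mulrC -ler_pdivrMr//; exact: ltW (truncnS_gt _).
pose m k := Num.min (a + k%:R * h) c.
have min_ k : m k \in `[a, c].
  by rewrite in_itv/= /m le_min ac lerDl mulr_ge0//= ge_min lexx orbT.
have m0 : m 0%N = a by rewrite /m mul0r addr0 min_l.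
have mN : m N.+1 = c.
  by rewrite /m /h mulrC divfK ?pnatr_eq0// addrC subrK min_r.
have mS k : m k <= m k.+1.
  by rewrite /m le_min2// lerD2l ler_wpM2r// ler_nat.
have mh k : m k.+1 - m k <= d.
  apply: le_trans hd; rewrite /m -natr1 mulrDl mul1r addrA.
  by move: (a + _) => x; case: (leP x c) => ?; case: (leP (x + h) c) => ?; lra.
have sub s k : s \in `]m k, m k.+1] -> s \in `[a, c].
  have := min_ k; have := min_ k.+1; rewrite !in_itv/= => /andP[_ h2] /andP[h3 _] /andP[h4 h5].
  by rewrite (le_trans h3 (ltW h4)) (le_trans h5).
pose G k := \int[mu]_(s in `]m k, m k.+1]) g s.
have split_int f k : mu.-integrable `[a, c] (EFin \o f) ->
    \int[mu]_(s in `[a, m k.+1]) f s - \int[mu]_(s in `[a, m k]) f s =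
    \int[mu]_(s in `]m k, m k.+1]) f s.
  move=> intf; rewrite Rintegral_itvB//.
  - apply: integrableS intf => // s; rewrite /= !in_itv/= => /andP[-> /le_trans] h'.
    by apply: h'; have := min_ k.+1; rewrite in_itv/= => /andP[].
  - by rewrite bnd_simp; have := min_ k; rewrite in_itv/= => /andP[].
  - by rewrite bnd_simp.
have Z1 k : 1 <= Z (m k).
  rewrite (HZ N k) -/h -/(m k) lerDl; apply: Rintegral_ge0 => s; rewrite /= => sin.
  have sin' : s \in `[a, c].
    move: sin; rewrite !in_itv/= => /andP[-> /le_trans] h'; apply: h'.
    by have := min_ k; rewrite in_itv/= => /andP[].
  by have /andP[h1 _] := g0 s sin'; rewrite mulr_ge0// Z0.
have mI k : measurable (`]m k, m k.+1]%classic : set (measurableTypeR R)) := measurable_itv _.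
have iG k : mu.-integrable `]m k, m k.+1] (EFin \o g).
  by apply: integrableS ig => // s; exact: sub.
have iZG k : mu.-integrable `]m k, m k.+1] (EFin \o (fun s => Z s * g s)).
  by apply: integrableS iZg => // s; exact: sub.
have G0 k : 0 <= G k.
  by apply: Rintegral_ge0 => s /= /sub /g0 /andP[].
have dZ k : Z (m k.+1) - Z (m k) = \int[mu]_(s in `]m k, m k.+1]) (Z s * g s).
  rewrite -split_int// (HZ N k) (HZ N k.+1) -/h -/(m k) -/(m k.+1).
  by rewrite opprD addrACA subrr add0r.
have osc k s : s \in `]m k, m k.+1] ->
    `|Z s - Z (m k)| <= e /\ `|Z s - Z (m k.+1)| <= e.
  move=> sin; have sin' := sub _ _ sin; have := mh k; move: sin.
  rewrite in_itv/= => /andP[h1 h2] h3; split; apply: Hd => //.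
    by rewrite ger0_norm ?subr_ge0 ?(ltW h1)//; lra.
  by rewrite ler0_norm ?subr_le0//; lra.
(* Used with [z] the value of [Z] at either end of the step, as [ln_increment] requires. *)
have lowZ k z : (forall s, s \in `]m k, m k.+1] -> `|Z s - z| <= e) ->
    (z - e) * G k <= Z (m k.+1) - Z (m k) <= (z + e) * G k.
  move=> hz; rewrite dZ; apply/andP; split.
    rewrite -RintegralZl//; apply: le_Rintegral => //; first exact: (integrableZl (mI k) _ (iG k)).
    move=> s sin; apply: ler_wpM2r; first by have /andP[] := g0 _ (sub _ _ sin).
    by have := hz s sin; rewrite ler_norml => /andP[]; lra.
  rewrite -RintegralZl//; apply: le_Rintegral => //; first exact: (integrableZl (mI k) _ (iG k)).
  move=> s sin; apply: ler_wpM2r; first by have /andP[] := g0 _ (sub _ _ sin).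
  by have := hz s sin; rewrite ler_norml => /andP[]; lra.
have step k : `|ln (Z (m k.+1)) - ln (Z (m k)) - G k| <= e * G k.
  apply: ln_increment => //; first exact: ltW.
    by apply: lowZ => s /osc[].
  by have /andP[] : (Z (m k.+1) - e) * G k <= Z (m k.+1) - Z (m k) <= (Z (m k.+1) + e) * G k
    by apply: lowZ => s /osc[].
have sumG : \sum_(0 <= k < N.+1) G k = I.
  under eq_bigr do rewrite /G -split_int//.
  by rewrite telescope_sumr// mN m0 set_itv1 Rintegral_set1 subr0.
have lnZa : ln (Z (m 0%N)) = 0.
  by rewrite (HZ N 0%N) -/h -/(m 0%N) m0 set_itv1 Rintegral_set1 addr0 ln1.
have -> : ln (Z c) = \sum_(0 <= k < N.+1) (ln (Z (m k.+1)) - ln (Z (m k))).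
  by rewrite (telescope_sumr (fun k => ln (Z (m k))))// mN lnZa subr0.
rewrite -sumG -sumrB mulr_sumr.
by apply: (le_trans (ler_norm_sum _ _ _)); apply: ler_sum => k _; exact: step.
Qed.

End LogIntegral.

(** The path is bounded, so the real infimum is a genuine lower bound of its values. *)
Lemma inf_gt0_lower_bound (R : realType) (f : R -> R) (a b : R) : a <= b ->
  uniformly_continuous_on a b f -> 0 < inf [set f s | s in `[a, b]] ->
  exists2 e : R, 0 < e & forall s, s \in `[a, b] -> e <= f s.
Proof.
move=> ab /uniformly_continuous_bounded[M HM] i0.
exists (inf [set f s | s in `[a, b]]) => // s sab; apply: ge_inf; last by exists s.
exists (- M) => _ [t tab <-]; have := HM t tab; rewrite ler_norml.
by case/andP.
Qed.

Lemma uniformly_continuous_sum_sqr (R : realType) (f g : R -> R) (a b : R) :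
  uniformly_continuous_on a b f -> uniformly_continuous_on a b g ->
  uniformly_continuous_on a b (fun s => f s ^+ 2 + g s ^+ 2).
Proof.
move=> /uniformly_continuous_within/subspace_continuousP cf.
move=> /uniformly_continuous_within/subspace_continuousP cg.
apply: within_continuous_uniformly; apply/subspace_continuousP => x xab.
have hf := cf x xab; have hg := cg x xab.
exact: cvgD (cvgM hf hf) (cvgM hg hg).
Qed.

Lemma uniformly_continuousV (R : realType) (f : R -> R) (a b e : R) : 0 < e ->
  (forall s, s \in `[a, b] -> e <= f s) -> uniformly_continuous_on a b f ->
  uniformly_continuous_on a b (fun s => (f s)^-1).
Proof.
move=> e0 fe uf k k0; have ke : 0 < k * e ^+ 2 by rewrite mulr_gt0// exprn_gt0.
have [d d0 Hd] := uf _ ke; exists d => // s t sab tab st.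
have fs := fe s sab; have ft := fe t tab.
have s0 := lt_le_trans e0 fs; have t0 := lt_le_trans e0 ft.
rewrite (_ : (f s)^-1 - (f t)^-1 = - (f s - f t) / (f s * f t)); last first.
  by field; rewrite !gt_eqF.
rewrite normrM normrN normrV ?unitfE ?mulf_neq0 ?gt_eqF// (gtr0_norm (mulr_gt0 s0 t0)).
rewrite ler_pdivrMr ?mulr_gt0//; apply: (le_trans (Hd _ _ sab tab st)).
by rewrite ler_pM2l// expr2 ler_pM// ltW.
Qed.

Lemma le_sum4 (R : realType) (x u v z : R) : 0 <= x -> 0 <= u -> 0 <= v -> 0 <= z ->
  [/\ 0 <= x + u + v + z, x <= x + u + v + z, u <= x + u + v + z, v <= x + u + v + z &
      z <= x + u + v + z].
Proof. by move=> x0 u0 v0 z0; split; lra. Qed.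

Lemma powR_double_le (R : realType) (x k L e : R) : 0 < e -> e <= x -> x <= L ->
  -1 <= k <= 1 -> x `^ (2 * k) <= (1 + L + e^-1) ^+ 2.
Proof.
move=> e0 ex xL k1; have x0 := lt_le_trans e0 ex.
rewrite mulrC powRrM powR_mulrn ?powR_ge0//; apply: sqr_le_norm.
rewrite ger0_norm ?powR_ge0//; apply: (le_trans (powR_le x0 k1)).
by rewrite lerD ?lerD2l// lef_pV2 ?posrE.
Qed.

(** * Integrability and positivity of the integral of a power of [y] *)

Section IntegralPower.
Context (R : realType) (x : R -> R) (a b e k : R).
Hypotheses (ab : a < b) (e0 : 0 < e) (ex : forall s, s \in `[a, b] -> e <= x s).
Hypotheses (ucx : uniformly_continuous_on a b x) (k1 : -1 <= k <= 1).

Let Q_exists : exists2 Q : R, 0 < Q & forall s q, s \in `[a, b] -> -1 <= q <= 1 ->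
  x s `^ (2 * q) <= Q.
Proof.
have [L HL] := uniformly_continuous_bounded ucx.
have xL s : s \in `[a, b] -> x s <= L by move=> /HL; exact: le_trans (ler_norm _).
have L0 : 0 <= L.
  have ain : a \in `[a, b] by rewrite in_itv/= lexx ltW.
  by rewrite (le_trans (ltW e0))// (le_trans (ex ain))// xL.
exists ((1 + L + e^-1) ^+ 2).
  by rewrite exprn_gt0// addr_gt0 ?invr_gt0// ltr_pwDl.
by move=> s q sab q1; apply: powR_double_le => //; [exact: ex|exact: xL].
Qed.

Lemma integrable_powR : lebesgue_measure.-integrable `[a, b] (EFin \o (fun s => x s `^ (2 * k))).
Proof.
have [Q Q0 HQ] := Q_exists; apply: (@integrable_bounded_itv _ _ _ _ Q).
  apply: (measurableT_comp (@measurable_powR R (2 * k))).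
  exact: (uniformly_continuous_measurable ucx).
by move=> s sab; rewrite ger0_norm ?powR_ge0//; exact: HQ.
Qed.

(** The power is the inverse of the one with exponent [- 2 k], which has an upper bound [Q]; so the
    integrand is at least [Q^-1]. This justifies dividing by the integral. *)
Lemma integral_powR_gt0 : 0 < \int[@lebesgue_measure R]_(s in `[a, b]) (x s `^ (2 * k)).
Proof.
have [Q Q0 HQ] := Q_exists.
have ic : lebesgue_measure.-integrable `[a, b] (EFin \o (fun=> Q^-1)).
  apply: (@integrable_bounded_itv _ _ _ _ Q^-1) => // s _.
  by rewrite ger0_norm// invr_ge0 ltW.
apply: (@lt_le_trans _ _ (\int[@lebesgue_measure R]_(s in `[a, b]) Q^-1)).
  rewrite -Rintegral_itv_obnd_cbnd; last first.
    by apply: integrableS ic => // s; rewrite /= !in_itv/= => /andP[/ltW -> ->].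
  by rewrite Rintegral_itv_cst ?(ltW ab)// mulr_gt0 ?invr_gt0 ?subr_gt0.
apply: le_Rintegral => //; first exact: integrable_powR.
move=> s sab; have k1' : -1 <= - k <= 1 by rewrite lerN2 lerNl andbC.
rewrite -[x s `^ _]invrK -powRN lef_pV2 ?posrE//; last first.
  by rewrite powR_gt0// (lt_le_trans e0 (ex sab)).
by rewrite -mulrN; exact: HQ.
Qed.

End IntegralPower.

(** * Real and imaginary parts of the integrand of [Y] *)

Section ImaginaryFactor.
Context (R : realType).

Lemma Re_i_mul_powR (z : R[i]) (x h : R) :
  complex.Re ('i%C * z / real_complex R (x `^ h)) = - complex.Im z * x `^ (- h).
Proof.
rewrite powRN -fmorphV; case: z => u v; set c := (_ `^ _)^-1.
by rewrite /=; ring.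
Qed.

Lemma Im_i_mul_powR (z : R[i]) (x h : R) :
  complex.Im ('i%C * z / real_complex R (x `^ h)) = complex.Re z * x `^ (- h).
Proof.
rewrite powRN -fmorphV; case: z => u v; set c := (_ `^ _)^-1.
by rewrite /=; ring.
Qed.

Lemma ln_sqr_normc (z : R[i]) : 0 < complex.Re z ^+ 2 + complex.Im z ^+ 2 ->
  ln (complex.Re z ^+ 2 + complex.Im z ^+ 2) = 2 * ln (Normc.normc z).
Proof.
case: z => u v /= uv; rewrite -[in LHS](sqr_sqrtr (ltW uv)) lnXn ?sqrtr_gt0//.
by rewrite mulr_natl.
Qed.

End ImaginaryFactor.

(** * Application to the processes [y] and [Y] *)

Section LogModulus.
Context (d : measure_display) (Omega : measurableType d) (R : realType)
  (P : probability Omega R) (theta T : R) (F : R -> set (set Omega))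
  (w : R -> Omega -> R) (gamma : R) (sigma : R -> Omega -> R)
  (f : (R -> R) -> R -> Omega -> R) (tau : Omega -> R) (y : R -> Omega -> R).
Local Notation mu := (@lebesgue_measure R).
Hypothesis theta_lt_T : theta < T.
Hypothesis F_filtration : complete_rc_filtration P theta T F.
Hypothesis w_wiener : wiener_process P theta T F w.
Hypothesis gamma01 : gamma \in `[0, 1].
Hypothesis sigma_bounded : exists M : R, forall t omega,
  t \in `[theta, T] -> `|sigma t omega| <= M.
Hypothesis sigma_measurable : jointly_measurable theta T sigma.
Hypothesis f_regular : drift_lipschitz_growth P theta T f.
Hypothesis tau_stopping : stopping_time theta T F tau.
Hypothesis tau_range : {ae P, forall omega, tau omega \in `]theta, T]}.
Hypothesis y_sol : y_solution P theta T F tau f sigma w gamma y.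
Hypothesis y_pos : {ae P, forall omega, 0 < inf [set y s omega | s in `[theta, tau omega]]}.

Let theta_le_T : theta <= T := ltW theta_lt_T.

Lemma y_lower_bound : {ae P, forall omega, [/\ theta < tau omega <= T,
  uniformly_continuous_on theta (tau omega) (y ^~ omega) &
  exists2 e : R, 0 < e & forall s, s \in `[theta, tau omega] -> e <= y s omega]}.
Proof.
have [[cy _] _ _] := y_sol.
apply: filterS3 tau_range cy y_pos => omega.
rewrite in_itv/= => tr /within_continuous_uniformly ucy i0; split=> //.
by apply: inf_gt0_lower_bound => //; rewrite ltW//; case/andP: tr.
Qed.

Lemma stopped_bounded (X : R -> Omega -> R) (p : R) :
  continuous_adapted_upto P theta T F tau X -> 0 < p ->
  exists2 L : R, 0 < L &
  off_event P p (fun omega => forall s, s \in `[theta, T] ->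
    `|X (Num.min s (tau omega)) omega| <= L).
Proof.
move=> [cX aX] p0; have [sF _ _ _] := F_filtration.
apply: (path_bounded_off theta_le_T) => //.
  by move=> t tin; exact: measurable_wrt_measurable (sF t tin).2 (aX t tin).
apply: filterS2 cX tau_range => omega /within_continuous_uniformly uX.
rewrite in_itv/= => /andP[/ltW tr _].
exact: (@uniformly_continuous_stopped R theta T (tau omega) (X ^~ omega)).
Qed.

(** The lower bound of a path of [y] is random, while the constants of [drift_lipschitz_growth]
    belong to a deterministic [delta]. Bounding the continuous path [1/y] off a small event
    reconciles the two. *)
Lemma stopped_inverse_bounded (p : R) : 0 < p -> exists2 L : R, 0 < L &
  off_event P p (fun omega => forall s, s \in `[theta, T] ->
    (y (Num.min s (tau omega)) omega)^-1 <= L).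
Proof.
move=> p0; have [[_ ay] _ _] := y_sol; have [sF _ _ _] := F_filtration.
have [||L L0 HL] := @path_bounded_off _ _ R P theta T
  (fun t omega => y (Num.min t (tau omega)) omega `^ (-1)) theta_le_T _ _ p p0.
- move=> t tin; apply: (measurable_wrt_measurable (sF t tin).2).
  by apply: (measurable_wrt_comp (sF t tin).1 (@measurable_powR R (-1))); exact: ay.
- apply: filterS y_lower_bound => omega [/andP[/ltW tr _] ucy [e e0 He]].
  have uV : uniformly_continuous_on theta (tau omega) (fun s => y s omega `^ (-1)).
    move=> k k0; have [dl dl0 Hd] := uniformly_continuousV e0 He ucy k0.
    exists dl => // s t sin tin st.
    rewrite !powR_inv1 ?(ltW (lt_le_trans e0 (He _ _)))//; exact: Hd.
  exact: (@uniformly_continuous_stopped R theta T _ _ tr uV).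
have := off_eventI HL (ae_off_event y_lower_bound); rewrite addr0 => H0.
exists L => //; apply: off_eventW H0 => // omega [H1 [/andP[/ltW tr _] _ [e e0 He]]] s sin.
apply: le_trans (H1 s sin); rewrite powR_inv1 ?ler_norm//.
apply: (ltW (lt_le_trans e0 (He _ _))); move: sin; rewrite !in_itv/= => /andP[s1 _].
by rewrite le_min s1 tr ge_min lexx orbT.
Qed.

Lemma stopped_Cinf omega (L : R) : theta < tau omega <= T -> 0 < L ->
  (forall s, s \in `[theta, tau omega] -> 0 < y s omega) ->
  (forall s, s \in `[theta, T] -> (y (Num.min s (tau omega)) omega)^-1 <= L) ->
  L^-1 <= Cinf theta T (fun s => y (Num.min s (tau omega)) omega).
Proof.
move=> /andP[/ltW tr _] L0 y0 HL; apply: lb_le_inf.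
  by exists (y (Num.min theta (tau omega)) omega), theta => //; rewrite /= in_itv/= lexx.
move=> _ [s sin <-]; rewrite invf_ple ?posrE//; first exact: HL.
apply: y0; move: sin; rewrite /= !in_itv/= => /andP[s1 _].
by rewrite le_min s1 tr ge_min lexx orbT.
Qed.

Lemma Cnorm_le (s : R -> R) (L : R) : (forall t, t \in `[theta, T] -> `|s t| <= L) ->
  Cnorm theta T s <= L.
Proof.
move=> sL; apply: ge_sup; last by move=> _ [t tin <-]; exact: sL.
by exists `|s theta|, theta => //; rewrite /= in_itv/= lexx.
Qed.

Lemma drift_bounded (p : R) : 0 < p -> exists2 L : R, 0 <= L &
  off_event P p (fun omega => forall s, s \in `[theta, tau omega] ->
    `|f (fun r => y (Num.min r (tau omega)) omega) s omega| <= L).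
Proof.
move=> p0; have p20 : 0 < p / 2 by rewrite divr_gt0.
have [cy _ _] := y_sol.
have [L1 L10 H1] := stopped_bounded cy p20; have [L2 L20 H2] := stopped_inverse_bounded p20.
(* The factor 2 yields the strict inequality between [delta] and the infimum, which is at least
   [L2^-1]. *)
have d0 : 0 < (2 * L2)^-1 by rewrite invr_gt0 mulr_gt0.
have [c1 [c2 [_ c20 Hf]]] := f_regular d0.
exists (c2 * (L1 + 1)); first by rewrite mulr_ge0 ?ltW// addr_gt0.
have := off_eventI (off_eventI H1 H2) (off_eventI (ae_off_event y_lower_bound) (ae_off_event Hf)).
apply: off_eventW; first by rewrite !addr0 -splitr.
move=> omega [[b1 b2] [[tr ucy [e e0 He]] hf]] s sin.
have /andP[/ltW tr1 trT] := tr.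
have sinT : s \in `[theta, T].
  by move: sin; rewrite !in_itv/= => /andP[-> /le_trans]; exact.
have [_ Hs] := hf s sinT; apply: (le_trans (Hs _ _ _)).
- apply: uniformly_continuous_within.
  exact: (@uniformly_continuous_stopped R theta T _ _ tr1 ucy).
- apply: lt_le_trans (stopped_Cinf tr L20 _ b2); last first.
    by move=> t /He; exact: lt_le_trans.
  by rewrite ltf_pV2 ?posrE ?mulr_gt0// ltr_pMl// ltr1n.
- by rewrite ler_pM2l// lerD2r; exact: Cnorm_le.
Qed.

Variables (h : R) (Y : R -> Omega -> R[i]).
Hypothesis h01 : h \in `[0, 1].
Hypothesis Y_sol : Y_solution P theta T F tau y h Y.

Let X1 t omega := complex.Re (Y t omega).
Let X2 t omega := complex.Im (Y t omega).
Let G t omega := 'i%C * Y t omega / real_complex R (y t omega `^ h).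
Let H1 t omega := complex.Re (G t omega).
Let H2 t omega := complex.Im (G t omega).
Let a t omega := f (fun r => y (Num.min r (tau omega)) omega) t omega.
Let b t omega := sigma t omega * y t omega `^ gamma.

(** [H1] and [H2] are components of [Y] times [y^(-h)], up to sign, and the powers of [y] that occur
    are at most [1 + y + 1/y]. One fifth of [p] goes to each of [y], [1/y], the two components of
    [Y] and the drift. *)
Lemma coefficients_bounded (p : R) : 0 < p -> exists2 L : R, 0 <= L &
  off_event P p (fun omega => forall s, s \in `[theta, tau omega] ->
  [/\ `|X1 s omega| <= L /\ `|X2 s omega| <= L,
      `|H1 s omega| <= L /\ `|H2 s omega| <= L, `|a s omega| <= L & `|b s omega| <= L]).
Proof.
move=> p0; have p50 : 0 < p / 5 by rewrite divr_gt0.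
have [cy _ _] := y_sol; have [cX1 cX2 _ _] := Y_sol; have [M HM] := sigma_bounded.
have [Ly Ly0 ky] := stopped_bounded cy p50; have [Li Li0 ki] := stopped_inverse_bounded p50.
have [L1 L10 k1] := stopped_bounded cX1 p50; have [L2 L20 k2] := stopped_bounded cX2 p50.
have [La La0 ka] := drift_bounded p50.
pose q := 1 + Ly + Li; have q0 : 0 <= q by rewrite /q !addr_ge0// ltW.
pose Lx := L1 + L2; have Lx0 : 0 <= Lx by rewrite addr_ge0// ltW.
have Lq : 0 <= Lx * q by rewrite mulr_ge0.
have Mq : 0 <= `|M| * q by rewrite mulr_ge0.
pose S := Lx + Lx * q + La + `|M| * q.
have [S0 S1 S2 S3 S4] : [/\ 0 <= S, Lx <= S, Lx * q <= S, La <= S & `|M| * q <= S].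
  exact: le_sum4.
exists S => //.
have := off_eventI (off_eventI (off_eventI ky ki) (off_eventI k1 k2))
  (off_eventI ka (ae_off_event y_lower_bound)).
apply: off_eventW; first by rewrite addr0 le_eqVlt; apply/orP; left; apply/eqP; field.
move=> omega [[[by' bi] [b1 b2]] [ba [/andP[_ trT] _ [e e0 He]]]] s sin.
have y0 := lt_le_trans e0 (He s sin).
have sinT : s \in `[theta, T].
  by move: sin; rewrite !in_itv/= => /andP[-> /le_trans]; exact.
have ms : Num.min s (tau omega) = s.
  by apply: min_l; move: sin; rewrite in_itv/= => /andP[].
move: (by' s sinT) (bi s sinT) (b1 s sinT) (b2 s sinT); rewrite ms => cy' ci c1 c2.
have pow k : -1 <= k <= 1 -> `|y s omega `^ k| <= q.
  move=> kk; rewrite ger0_norm ?powR_ge0//; apply: (le_trans (powR_le y0 kk)).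
  by rewrite /q lerD// lerD2l (le_trans (ler_norm _) cy').
have h11 : -1 <= - h <= 1.
  move: h01; rewrite in_itv/= => /andP[h0 h1]; rewrite lerN2 h1/= (le_trans _ ler01)//.
  by rewrite oppr_le0.
have g11 : -1 <= gamma <= 1.
  move: gamma01; rewrite in_itv/= => /andP[g0 ->].
  by rewrite (le_trans _ g0).
have x1 : `|X1 s omega| <= Lx by apply: (le_trans c1); rewrite lerDl ltW.
have x2 : `|X2 s omega| <= Lx by apply: (le_trans c2); rewrite lerDr ltW.
split; last 2 first.
- exact: le_trans (ba s sin) S3.
- rewrite /b normrM; apply: le_trans S4.
  by apply: ler_pM => //; [exact: le_trans (HM s omega sinT) (ler_norm M)|exact: pow].
- by split; [exact: le_trans x1 S1|exact: le_trans x2 S1].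
- have Hq z : `|z| <= Lx -> `|z * y s omega `^ (- h)| <= S.
    by move=> zL; rewrite normrM; apply: le_trans S2; apply: ler_pM => //; exact: pow.
  rewrite /H1 /H2 /G Re_i_mul_powR Im_i_mul_powR; split; apply: Hq => //.
  by rewrite normrN.
Qed.

Lemma exponent_range : -1 <= gamma - h <= 1.
Proof.
by move: h01 gamma01; rewrite !in_itv/= => /andP[? ?] /andP[? ?]; apply/andP; split; lra.
Qed.

Lemma path_integrals_measurable : {ae P, forall omega,
  [/\ measurable_fun `[theta, tau omega] (sigma ^~ omega),
      forall k, measurable_fun `[theta, tau omega] (fun s => y s omega `^ k),
      measurable_fun `[theta, tau omega] (X1 ^~ omega) &
      measurable_fun `[theta, tau omega] (X2 ^~ omega)]}.
Proof.
have [[cX1 _] [cX2 _] _ _] := Y_sol.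
apply: filterS3 cX1 cX2 y_lower_bound => omega /within_continuous_uniformly u1.
move=> /within_continuous_uniformly u2 [/andP[_ tT] uy _]; split.
(* A path is a section of the jointly measurable process. *)
- apply: (@measurable_comp _ _ _ _ _ _ ([set` `[theta, T]] `*` setT)
    (fun p : R * Omega => sigma p.1 p.2) _ (pair^~ omega)).
  + by apply: measurableX => //; exact: measurable_itv.
  + move=> _ [s sin <-]; split => //=; move: sin; rewrite /= !in_itv/= => /andP[-> h1] /=.
    exact: le_trans tT.
  + exact: sigma_measurable.
  + by apply: measurable_funTS; exact: pair2_measurable.
- move=> k; apply: (measurableT_comp (@measurable_powR R k)).
  exact: (uniformly_continuous_measurable uy).
- exact: (uniformly_continuous_measurable u1).
- exact: (uniformly_continuous_measurable u2).
Qed.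

Lemma sqr_modulus_equation t : t \in `[theta, T] -> {ae P, forall omega,
  let r := Num.min t (tau omega) in X1 r omega ^+ 2 + X2 r omega ^+ 2 = 1 +
    \int[mu]_(s in `[theta, r]) ((X1 s omega ^+ 2 + X2 s omega ^+ 2) *
       (sigma s omega ^+ 2 * y s omega `^ (2 * (gamma - h))))}.
Proof.
move=> tin; have [[cy ay] int_a [I I_int eqy]] := y_sol.
have [[cX1 aX1] [cX2 aX2] Y1 [J [J1 J2] eqY]] := Y_sol.
have [tr' uX1 uX2] : [/\ {ae P, forall omega, theta < tau omega <= T},
    {ae P, forall omega, uniformly_continuous_on theta (tau omega) (X1 ^~ omega)} &
    {ae P, forall omega, uniformly_continuous_on theta (tau omega) (X2 ^~ omega)}].
  split.
  - by apply: filterS tau_range => omega; rewrite in_itv.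
  - by apply: filterS cX1 => omega; exact: within_continuous_uniformly.
  - by apply: filterS cX2 => omega; exact: within_continuous_uniformly.
have := @sqr_modulus_ae _ _ _ P theta T F X1 X2 H1 H2
  (fun t omega => complex.Re (J t omega)) (fun t omega => complex.Im (J t omega))
  y a b I w tau theta_lt_T F_filtration w_wiener tau_stopping tr'
  (known_before_stopped F_filtration tau_stopping aX1)
  (known_before_stopped F_filtration tau_stopping aX2)
  (known_before_stopped F_filtration tau_stopping ay)
  J1 J2 I_int coefficients_bounded.
have eX1 : {ae P, forall omega, forall s, s \in `[theta, tau omega] ->
    X1 s omega = X1 theta omega + complex.Re (J s omega)}.
  by apply: filterS eqY => omega H s /H; rewrite /X1 => ->; exact: raddfD.
have eX2 : {ae P, forall omega, forall s, s \in `[theta, tau omega] ->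
    X2 s omega = X2 theta omega + complex.Im (J s omega)}.
  by apply: filterS eqY => omega H s /H; rewrite /X2 => ->; exact: raddfD.
have mH1 : {ae P, forall omega, measurable_fun `[theta, tau omega] (H1 ^~ omega)}.
  apply: filterS path_integrals_measurable => omega [_ mp _ m2].
  rewrite (_ : H1 ^~ omega = fun s => - X2 s omega * y s omega `^ (- h)).
    by apply: measurable_funM => //; exact: measurableT_comp.
  by apply/funext => s; exact: Re_i_mul_powR.
have mH2 : {ae P, forall omega, measurable_fun `[theta, tau omega] (H2 ^~ omega)}.
  apply: filterS path_integrals_measurable => omega [_ mp m1 _].
  rewrite (_ : H2 ^~ omega = fun s => X1 s omega * y s omega `^ (- h)).
    by apply: measurable_funM.
  by apply/funext => s; exact: Im_i_mul_powR.
have mb : {ae P, forall omega, measurable_fun `[theta, tau omega] (b ^~ omega)}.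
  apply: filterS path_integrals_measurable => omega [ms mp _ _].
  by apply: measurable_funM.
have orth : {ae P, forall omega, forall s, s \in `[theta, tau omega] ->
    X1 s omega * H1 s omega + X2 s omega * H2 s omega = 0}.
  (* Multiplication by [i] is a rotation by a right angle: [(H1, H2)] is a multiple of
     [(- X2, X1)]. *)
  apply: aeW => omega s _; rewrite /H1 /H2 /G Re_i_mul_powR Im_i_mul_powR /X1 /X2; ring.
move=> /(_ orth eX1 eX2 eqy int_a uX1 uX2 mH1 mH2 mb t tin).
apply: filterS3 Y1 y_lower_bound => omega Y1 [/andP[tr _] _ [e e0 He]] /=.
rewrite /stopped_at => ->; congr (_ + _).
  by rewrite /X1 /X2 Y1/= expr1n expr0n addr0.
apply: eq_Rintegral => s; rewrite inE/= in_itv/= => /andP[s1]; rewrite le_min => /andP[_ s2].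
have y0 : 0 < y s omega by apply: (lt_le_trans e0); apply: He; rewrite in_itv/= s1 s2.
rewrite /H1 /H2 /G Re_i_mul_powR Im_i_mul_powR /b -/(X1 s omega) -/(X2 s omega).
have -> : y s omega `^ (2 * (gamma - h)) = (y s omega `^ gamma * y s omega `^ (- h)) ^+ 2.
  by rewrite mulrC powRrM powR_mulrn ?powR_ge0// powRD// (gt_eqF y0) implybT.
by ring.
Qed.

Lemma integral_log_modulus : {ae P, forall omega,
  \int[mu]_(s in `[theta, tau omega]) (sigma s omega ^+ 2 * y s omega `^ (2 * (gamma - h))) =
  2 * ln (Normc.normc (Y (tau omega) omega))}.
Proof.
(* Countably many grid times, so a single null set serves all of them. *)
have gridE : {ae P, forall omega, forall N k,
   let r := Num.min (Num.min (theta + k%:R * ((T - theta) / N.+1%:R)) T) (tau omega) in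
   X1 r omega ^+ 2 + X2 r omega ^+ 2 = 1 +
    \int[mu]_(s in `[theta, r]) ((X1 s omega ^+ 2 + X2 s omega ^+ 2) *
       (sigma s omega ^+ 2 * y s omega `^ (2 * (gamma - h))))}.
  apply/ae_foralln => N; apply/ae_foralln => k; apply: sqr_modulus_equation.
  rewrite in_itv/= le_min theta_le_T ge_min lexx orbT !andbT lerDl.
  by rewrite mulr_ge0// divr_ge0// subr_ge0.
have [M HM] := sigma_bounded; have [[cX1 _] [cX2 _] _ _] := Y_sol.
apply: filterS3 gridE y_lower_bound (filterI path_integrals_measurable (filterI cX1 cX2)).
move=> omega gridE [/andP[tr tT] uy [e e0 He]] [[ms mp m1 m2] [c1 c2]].
have u1 := within_continuous_uniformly c1; have u2 := within_continuous_uniformly c2.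
have [Ly HLy] := uniformly_continuous_bounded uy.
have tr' := ltW tr.
have Ztau : 0 < X1 (tau omega) omega ^+ 2 + X2 (tau omega) omega ^+ 2.
  (* With one step and [k = 1] the grid time is [T], which stopping turns into [tau]. *)
  have := gridE 0%N 1%N; rewrite mul1r divr1 addrC subrK minxx (min_r tT) => /= ->.
  rewrite ltr_wpDr//; apply: Rintegral_ge0 => s _; apply: mulr_ge0; last first.
    by rewrite mulr_ge0 ?sqr_ge0 ?powR_ge0.
  by rewrite addr_ge0 ?sqr_ge0.
rewrite -(ln_sqr_normc Ztau); symmetry.
apply: (@log_integral R theta (tau omega) T (fun s => X1 s omega ^+ 2 + X2 s omega ^+ 2)
  (fun s => sigma s omega ^+ 2 * y s omega `^ (2 * (gamma - h)))
  (M ^+ 2 * (1 + Ly + e^-1) ^+ 2)) => //.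
- exact: uniformly_continuous_sum_sqr.
- by apply: measurable_funM => //; exact: measurable_funX.
- by move=> s _; rewrite addr_ge0// sqr_ge0.
- move=> s sin; have sT : s \in `[theta, T].
    by move: sin; rewrite !in_itv/= => /andP[-> /le_trans]; exact.
  rewrite mulr_ge0 ?sqr_ge0 ?powR_ge0//=; apply: ler_pM; rewrite ?sqr_ge0 ?powR_ge0//.
    by apply: sqr_le_norm; exact: HM.
  apply: powR_double_le => //; first exact: He.
    exact: le_trans (ler_norm _) (HLy s sin).
  exact: exponent_range.
- move=> N k; have := gridE N k.
  have -> // : Num.min (Num.min (theta + k%:R * ((T - theta) / N.+1%:R)) T) (tau omega) =
    Num.min (theta + k%:R * ((T - theta) / N.+1%:R)) (tau omega).
  by rewrite -minA (min_r tT).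
Qed.

End LogModulus.

Theorem corollary3p1
  (d : measure_display) (Omega : measurableType d) (R : realType)
  (P : probability Omega R) (theta T : R) (F : R -> set (set Omega))
  (w : R -> Omega -> R) (gamma : R) (sigma : R -> Omega -> R)
  (f : (R -> R) -> R -> Omega -> R) (tau : Omega -> R) (y : R -> Omega -> R)
  (theta_lt_T : theta < T)
  (P_complete : measure_is_complete P)
  (F_filtration : complete_rc_filtration P theta T F)
  (w_wiener : wiener_process P theta T F w)
  (gamma01 : gamma \in `[0, 1])
  (sigma_bounded : exists M : R, forall t omega,
     t \in `[theta, T] -> `|sigma t omega| <= M)
  (sigma_measurable : jointly_measurable theta T sigma)
  (sigma_adapted : adapted theta T F sigma)
  (f_measurable : drift_measurable theta T f)
  (f_adapted : drift_adapted theta T F f)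
  (f_nonanticipating : nonanticipating theta T f)
  (f_regular : drift_lipschitz_growth P theta T f)
  (tau_stopping : stopping_time theta T F tau)
  (tau_range : {ae P, forall omega, tau omega \in `]theta, T]})
  (y_init : {ae P, forall omega, 0 < y theta omega})
  (y_sol : y_solution P theta T F tau f sigma w gamma y)
  (y_pos : {ae P, forall omega,
     0 < inf [set y s omega | s in `[theta, tau omega]]}) :
  (forall Y : R -> Omega -> complex R,
     Y_solution P theta T F tau y gamma Y ->
     {ae P, forall omega,
        \int[lebesgue_measure]_(s in `[theta, tau omega]) (sigma s omega ^+ 2)
        = 2 * ln (Normc.normc (Y (tau omega) omega))}) /\
  (forall sigma0 : R,
     (forall t omega, t \in `[theta, T] -> sigma t omega = sigma0) ->
     forall h : R, h \in `[0, 1] ->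
     forall Y : R -> Omega -> complex R,
     Y_solution P theta T F tau y h Y ->
     {ae P, forall omega,
        sigma0 ^+ 2
        = 2 * (\int[lebesgue_measure]_(s in `[theta, tau omega])
                 ((y s omega) `^ (2 * (gamma - h))))^-1
            * ln (Normc.normc (Y (tau omega) omega))}).
Proof.
have main h (h01 : h \in `[0, 1]) Y (Y_sol : Y_solution P theta T F tau y h Y) :=
  integral_log_modulus theta_lt_T F_filtration w_wiener gamma01 sigma_bounded
    sigma_measurable f_regular tau_stopping tau_range y_sol y_pos h01 Y_sol.
split=> [Y Y_sol|sigma0 sigmaE h h01 Y Y_sol].
  apply: filterS (main _ gamma01 _ Y_sol) => omega <-.
  (* For [h = gamma] the power of [y] has exponent 0 and equals 1. *)
  by apply: eq_Rintegral => s _; rewrite subrr mulr0 powRr0 mulr1.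
have lb := y_lower_bound tau_range y_sol y_pos.
apply: filterS2 (main _ h01 _ Y_sol) lb => omega E [/andP[tr tT] ucy [e e0 He]].
have k1 := exponent_range gamma01 h01.
(* Positivity allows the constant [sigma0 ^+ 2], once pulled out of the integral, to be isolated by
   division. *)
have I0 := integral_powR_gt0 tr e0 He ucy k1.
have E' : \int[lebesgue_measure]_(s in `[theta, tau omega])
    (sigma s omega ^+ 2 * y s omega `^ (2 * (gamma - h))) =
    \int[lebesgue_measure]_(s in `[theta, tau omega])
      (sigma0 ^+ 2 * y s omega `^ (2 * (gamma - h))).
  apply: eq_Rintegral => s; rewrite inE/= in_itv/= => /andP[s1 s2]; rewrite sigmaE//.
  by rewrite in_itv/= s1 (le_trans s2).
rewrite mulrAC -E E' RintegralZl//; first by rewrite mulfK ?gt_eqF.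
exact: (integrable_powR tr e0 He ucy k1).
Qed.
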